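(* Let $\nu_{\boldsymbol\mu}$ be a self-affine measure on a sponge $F\subset\mathbb R^d$ satisfying the SPPC. Then $$\dim_{\mathrm F}\nu_{\boldsymbol\mu}=\min_{\sigma\in\mathcal A}\inf_{\mathbf P_{\!\sigma}\in\mathcal Q^\sigma}S_\sigma(\mathbf P_{\!\sigma})=\lim_{q\to+\infty}\frac{T(\nu_{\boldsymbol\mu},q)}{-q}\ge\max\Big\{0,\min_{\sigma\in\mathcal A}\underline S_d^{\boldsymbol\mu,\sigma}\Big\},$$ $$\dim_{\mathrm B}\nu_{\boldsymbol\mu}=\max_{\sigma\in\mathcal A}\sup_{\mathbf P_{\!\sigma}\in\mathcal Q^\sigma}S_\sigma(\mathbf P_{\!\sigma})=\lim_{q\to-\infty}\frac{T(\nu_{\boldsymbol\mu},q)}{-q}\le\max_{\sigma\in\mathcal A}\overline S_d^{\boldsymbol\mu,\sigma}.$$ In particular, if $F$ is a $\sigma$-ordered Lalley–Gatzouras sponge, then $\dim_{\mathrm F}\nu_{\boldsymbol\mu}=\underline S_d^{\boldsymbol\mu,\sigma}$ and $\dim_{\mathrm B}\nu_{\boldsymbol\mu}=\overline S_d^{\boldsymbol\mu,\sigma}$.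
   Context: Sponge setup: $d\ge1$, $\mathcal I=\{1,\dots,N\}$, $f_i(x)=A_ix+t_i$ with $A_i=\mathrm{diag}(a_i^{(1)},\dots,a_i^{(d)})$, $\lambda_i^{(n)}=|a_i^{(n)}|\in(0,1)$, $f_i([0,1]^d)\subset[0,1]^d$, no two distinct $f_i$ agree on $[0,1]^d$, and for some $r_0>0$ each face $\{x_n=u\}$ ($u\in\{0,1\}$) of $[0,1]^d$ is at distance $\ge r_0$ from some $f_k([0,1]^d)$. $F$ the attractor, $\Sigma=\mathcal I^{\mathbb N}$, $\pi(\mathbf i)=\lim f_{i_1}\circ\dots\circ f_{i_k}(0)$. Orderings: for a permutation $\sigma$, $E_n^\sigma$ = span of coordinate axes $\sigma_1,\dots,\sigma_n$, $\Pi_n^\sigma$ orthogonal projection; $f_i,f_j$ overlap exactly on $E_n^\sigma$ if $\Pi_n^\sigma f_i=\Pi_n^\sigma f_j$ on $[0,1]^d$; $\mathcal I_n^\sigma$ = smallest elements of classes of this equivalence relation, $\Pi_n^\sigma j$ = smallest element of class of $j$. $L_\delta(\mathbf i,n)$ is the unique integer with $\prod_{\ell\le L_\delta(\mathbf i,n)}\lambda_{i_\ell}^{(n)}\le\delta<\prod_{\ell\le L_\delta(\mathbf i,n)-1}\lambda_{i_\ell}^{(n)}$; $\mathcal A$ = set of permutations $\sigma$ for which some $\mathbf i,\delta$ satisfy $L_\delta(\mathbf i,\sigma_d)\le\dots\le L_\delta(\mathbf i,\sigma_1)$ (ties broken by $\sigma_n>\sigma_{n-1}$). Variational quantities: $\mathcal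 P_n^\sigma$ = probability vectors on $\mathcal I_n^\sigma$, $\mathcal P^\sigma=\mathcal P_d^\sigma\times\dots\times\mathcal P_1^\sigma$, elements $(\mathbf p_{\sigma_d},\dots,\mathbf p_{\sigma_1})$; $\chi_n^\sigma(\mathbf p_{\sigma_m})=-\sum_{i\in\mathcal I_m^\sigma}p_{\sigma_m}(i)\log\lambda_i^{(\sigma_n)}$; $C_d^{(d),\sigma}=1/\chi_d^\sigma(\mathbf p_{\sigma_d})$, $C_n^{(d),\sigma}=(1-\sum_{m>n}C_m^{(d),\sigma}\chi_n^\sigma(\mathbf p_{\sigma_m}))/\chi_n^\sigma(\mathbf p_{\sigma_n})$; $\mathcal Q^\sigma=\{\mathbf P_{\!\sigma}:C_n^{(d),\sigma}(\mathbf P_{\!\sigma})\ge0\ \forall n\}$. Measure: $\boldsymbol\mu$ strictly positive probability vector on $\mathcal I$, $\nu_{\boldsymbol\mu}=\boldsymbol\mu^{\mathbb N}\circ\pi^{-1}$, $\mu_n^\sigma(i)=\sum_{j:\Pi_n^\sigma j=i}\mu(j)$. $S_\sigma(\mathbf P_{\!\sigma})=-\sum_nC_n^{(d),\sigma}(\mathbf P_{\!\sigma})\sum_{i\in\mathcal I_n^\sigma}p_{\sigma_n}(i)\log\mu_n^\sigma(i)$. $\overline S_0^{\boldsymbol\mu,\sigma}=\underline S_0^{\boldsymbol\mu,\sigma}=0$, $\overline S_n^{\boldsymbol\mu,\sigma}=\overline S_{n-1}^{\boldsymbol\mu,\sigma}+\max_{i\in\mathcal I_n^\sigma}\frac{1}{\log\lambda_i^{(\sigma_n)}}\big(\log\mu_n^\sigma(i)+\sum_{m=1}^{n-1}(\overline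 S_{m-1}^{\boldsymbol\mu,\sigma}-\overline S_m^{\boldsymbol\mu,\sigma})\log\lambda_i^{(\sigma_m)}\big)$, and $\underline S_n^{\boldsymbol\mu,\sigma}$ the same with $\min$ and $\underline S$. SPPC: for every $\sigma\in\mathcal A$, $n$, $i,j$: either $f_i,f_j$ overlap exactly on $E_n^\sigma$ or $\Pi_n^\sigma(f_i((0,1)^d))\cap\Pi_n^\sigma(f_j((0,1)^d))=\emptyset$. A $\sigma$-ordered Lalley–Gatzouras sponge satisfies the SPPC and $\lambda_i^{(\sigma_d)}\le\dots\le\lambda_i^{(\sigma_1)}$ for all $i$. Dimensions: $T(\nu,q)=\lim_{\delta\to0}\log T_\delta(\nu,q)/(-\log\delta)$ with $T_\delta(\nu,q)=\sup\sum_i\nu(B(x_i,\delta))^q$ over disjoint closed balls centred in $\mathrm{supp}\,\nu$. $\dim_{\mathrm F}\nu=\sup\{s\ge0:\exists C\ge1,\ \nu(B(x,\delta))\le C\delta^s\ \forall x\in\mathrm{supp}\,\nu,0<\delta<1\}$; $\overline\dim_{\mathrm B}\nu=\inf\{s\ge0:\exists c>0,\ \nu(B(x,\delta))\ge c\delta^s\ \forall x\in\mathrm{supp}\,\nu,0<\delta<1\}$; $\underline\dim_{\mathrm B}\nu$ is defined the same except that the inequality need only hold along some sequence $\delta_n\to0$; $\dim_{\mathrm B}\nu$ is their common value when they agree. *)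

(* Defs.v *)
From HB Require Import structures.
From mathcomp Require Import all_boot all_order all_algebra all_fingroup.
From mathcomp Require Import all_classical all_reals all_analysis.
Set Implicit Arguments. Unset Strict Implicit. Unset Printing Implicit Defensive.
Import Order.TTheory GRing.Theory Num.Theory.
Import numFieldNormedType.Exports.
Local Open Scope classical_set_scope.
Local Open Scope ring_scope.

Section Sponge.
Variable R : realType.
Variables d N : nat.
(* points of R^d are functions 'I_d -> R; coordinates are 0-indexed *)
Notation vec := ('I_d -> R).
(* f_i(x) = A_i x + t_i with A_i = diag(a i 0, ..., a i (d-1)) *)
Variables (a t : 'I_N -> 'I_d -> R).

Definition ifsmap (i : 'I_N) (x : vec) : vec := fun n => a i n * x n + t i n.

Definition lam (i : 'I_N) (n : 'I_d) : R := `|a i n|.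

Definition cube : set vec := [set x | forall n, 0 <= x n <= 1].
Definition ocube : set vec := [set x | forall n, 0 < x n < 1].

Definition eucl_dist (x y : vec) : R := Num.sqrt (\sum_(n < d) (x n - y n) ^+ 2).
Definition cballE (x : vec) (r : R) : set vec := [set y | eucl_dist x y <= r].

Definition Sigma := nat -> 'I_N.

(* f_{s_0} o f_{s_1} o ... o f_{s_{k-1}}  (paper: f_{i_1} o ... o f_{i_k}) *)
Fixpoint compo (s : Sigma) (k : nat) : vec -> vec :=
  match k with 0 => id | k'.+1 => compo s k' \o ifsmap (s k') end.

Definition coding (s : Sigma) : vec :=
  fun n => lim ((fun k => compo s k (fun _ => 0) n) @ \oo).

Definition cyl (k : nat) (w : 'I_k -> 'I_N) : set Sigma :=
  [set s | forall j : 'I_k, s j = w j].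

(* coordinate sigma_n (paper, 1 <= n <= d) = sigma (n-1) *)
Definition sigc (s : {perm 'I_d}) (n : nat) : option 'I_d :=
  if (insub n.-1 : option 'I_d) is Some c then Some (s c) else None.

Definition lamS (s : {perm 'I_d}) (i : 'I_N) (n : nat) : R :=
  if sigc s n is Some c then lam i c else 1.

Definition projE (s : {perm 'I_d}) (n : nat) (v : vec) : vec :=
  fun c => if [exists k : 'I_d, ((k < n)%N && (s k == c))] then v c else 0.

Definition overlap (s : {perm 'I_d}) (n : nat) (i j : 'I_N) : Prop :=
  forall x, cube x -> projE s n (ifsmap i x) = projE s n (ifsmap j x).

Definition Iset (s : {perm 'I_d}) (n : nat) (i : 'I_N) : bool :=
  `[< forall k : 'I_N, overlap s n k i -> (i <= k)%N >].

Definition Prep (s : {perm 'I_d}) (n : nat) (j : 'I_N) : 'I_N :=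
  [arg min_(k < j | `[< overlap s n k j >]) (k : nat)].


Definition Lprop (x : Sigma) (delta : R) (c : 'I_d) (L : nat) : Prop :=
  (0 < L)%N /\ \prod_(l < L) lam (x l) c <= delta < \prod_(l < L.-1) lam (x l) c.

Definition Aset : set {perm 'I_d} :=
  [set s | exists (x : Sigma) (delta : R), 0 < delta < 1 /\
     exists Lf : 'I_d -> nat, (forall c, Lprop x delta c (Lf c)) /\
       forall k1 k2 : 'I_d, (k2 : nat) = k1.+1 ->
         (Lf (s k2) <= Lf (s k1))%N /\ (Lf (s k2) = Lf (s k1) -> (s k1 < s k2)%N)].

Definition SPPC : Prop :=
  forall s, Aset s -> forall n, (1 <= n <= d)%N -> forall i j : 'I_N,
    overlap s n i j \/
    [set projE s n y | y in ifsmap i @` ocube] `&` [set projE s n y | y in ifsmap j @` ocube] = set0.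

Definition LG_ordered (s : {perm 'I_d}) : Prop :=
  SPPC /\ forall i n, (1 <= n < d)%N -> lamS s i n.+1 <= lamS s i n.

(* ---- variational quantities ----
   An element (p_{sigma_d}, ..., p_{sigma_1}) of P^sigma is represented by
   p : nat -> 'I_N -> R, with p n = p_{sigma_n} (1 <= n <= d), each p n being a
   probability vector on I_n^sigma (extended by 0 outside I_n^sigma). *)
Definition Pvalid (s : {perm 'I_d}) (p : nat -> 'I_N -> R) : Prop :=
  forall n, (1 <= n <= d)%N ->
    (forall i, 0 <= p n i) /\ (forall i, ~~ Iset s n i -> p n i = 0) /\
    \sum_(i | Iset s n i) p n i = 1.

Definition chi (s : {perm 'I_d}) (p : nat -> 'I_N -> R) (n m : nat) : R :=
  - \sum_(i | Iset s m i) p m i * ln (lamS s i n).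

(* C_n^{(d),sigma}, computed downwards from n = d (fuel-based recursion) *)
Fixpoint Caux (s : {perm 'I_d}) (p : nat -> 'I_N -> R) (fuel n : nat) : R :=
  match fuel with
  | 0 => 0
  | f.+1 => (1 - \sum_(n.+1 <= m < d.+1) Caux s p f m * chi s p n m) / chi s p n n
  end.
Definition Cn (s : {perm 'I_d}) (p : nat -> 'I_N -> R) (n : nat) : R :=
  Caux s p d.+1 n.

Definition Qset (s : {perm 'I_d}) : set (nat -> 'I_N -> R) :=
  [set p | Pvalid s p /\ forall n, (1 <= n <= d)%N -> 0 <= Cn s p n].

Variable mu : 'I_N -> R.

Definition mun (s : {perm 'I_d}) (n : nat) (i : 'I_N) : R :=
  \sum_(j | Prep s n j == i) mu j.

Definition Ssig (s : {perm 'I_d}) (p : nat -> 'I_N -> R) : R :=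
  - \sum_(1 <= n < d.+1) Cn s p n * \sum_(i | Iset s n i) p n i * ln (mun s n i).

(* \overline S_n (ext = sup, i.e. max over the finite set) and
   \underline S_n (ext = inf, i.e. min), fuel-based recursion *)
Fixpoint Saux (ext : set R -> R) (s : {perm 'I_d}) (fuel n : nat) : R :=
  match fuel with
  | 0 => 0
  | f.+1 => match n with
            | 0 => 0
            | n'.+1 => Saux ext s f n' +
                ext [set (ln (lamS s i n'.+1))^-1 *
                       (ln (mun s n'.+1 i) +
                        \sum_(1 <= m < n'.+1) (Saux ext s f m.-1 - Saux ext s f m) * ln (lamS s i m))
                    | i in [set i | Iset s n'.+1 i]]
            end
  end.
Definition Sbar (s : {perm 'I_d}) (n : nat) : R := Saux sup s n n.
Definition Sund (s : {perm 'I_d}) (n : nat) : R := Saux inf s n n.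

End Sponge.

Section Dimensions.
Variable R : realType.
Variable d : nat.
Notation vec := ('I_d -> R).
Local Open Scope ereal_scope.

Definition msupp (nu : set vec -> \bar R) : set vec :=
  [set x | forall r : R, (0 < r)%R -> 0 < nu (cballE x r)].

Definition dimF (nu : set vec -> \bar R) : \bar R :=
  ereal_sup [set s%:E | s in [set s : R | (0 <= s)%R /\ exists C : R, (1 <= C)%R /\
     forall x, msupp nu x -> forall delta : R, (0 < delta < 1)%R ->
       nu (cballE x delta) <= (C * delta `^ s)%:E]].

Definition dimBup (nu : set vec -> \bar R) : \bar R :=
  ereal_inf [set s%:E | s in [set s : R | (0 <= s)%R /\ exists c : R, (0 < c)%R /\
     forall x, msupp nu x -> forall delta : R, (0 < delta < 1)%R ->
       (c * delta `^ s)%:E <= nu (cballE x delta)]].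

Definition dimBlow (nu : set vec -> \bar R) : \bar R :=
  ereal_inf [set s%:E | s in [set s : R | (0 <= s)%R /\ exists c : R, (0 < c)%R /\
     exists dl : nat -> R, (forall k, (0 < dl k < 1)%R) /\ dl @ \oo --> 0%R /\
     forall x, msupp nu x -> forall k,
       (c * dl k `^ s)%:E <= nu (cballE x (dl k))]].

Definition Tdelta (nu : set vec -> \bar R) (q delta : R) : R :=
  sup [set z : R | exists (k : nat) (xs : 'I_k -> vec),
     (forall j, msupp nu (xs j)) /\
     (forall j1 j2, j1 != j2 -> cballE (xs j1) delta `&` cballE (xs j2) delta = set0) /\
     z = (\sum_(j < k) (fine (nu (cballE (xs j) delta))) `^ q)%R].

End Dimensions.

Arguments cube {R d}.
Arguments ocube {R d}.
Arguments Sigma : clear implicits.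

(* Main.v *)
(** A sequence [x] and a scale [delta] determine an approximate cube: the sequences whose [l]-th letter
    agrees with that of [x] on the coordinates [c] with [l < L_delta(x, c)]. By the SPPC the cuboids
    carrying distinct approximate cubes have disjoint interiors, so a ball of radius [delta] meets
    boundedly many of them and the moment sums [T_delta(q)] are comparable to sums over approximate
    cubes. Interleaving [r] words with the same cutoffs produces a cube of size about [delta ^ r]
    whose measure is the product of the measures; hence [log T_delta(q)] is almost superadditive in
    [- log delta] and [T(q)] exists.

    In the variables [w = C_n p_n], the set [Q^sigma] is a polytope on which [S_sigma] is linear.
    Letter frequencies of approximate cubes are approximate points of these polytopes and every
    point of a polytope is realized by words, whence [- q z <= T(q)] for every value [z] of [S_sigma],
    and, by compactness, [T(q) <= C - q v] with [v] the least value if [q > 0] and the largest if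
    [q < 0]. Both dimensions follow from these two bounds. The increments of [Sund] and [Sbar] are
    feasible for the dual program, and optimal for a Lalley-Gatzouras sponge. *)

Require Import Defs.
From HB Require Import structures.
From mathcomp Require Import all_boot all_order all_algebra all_fingroup.
From mathcomp Require Import all_classical all_reals all_analysis.
From mathcomp Require Import measurable_realfun.
From mathcomp Require Import ring lra zify.
Set Implicit Arguments. Unset Strict Implicit. Unset Printing Implicit Defensive.
Import Order.TTheory GRing.Theory Num.Theory.
Import numFieldNormedType.Exports.
Local Open Scope classical_set_scope.
Local Open Scope ring_scope.


(** Words of approximate cubes cannot be concatenated: the last letters of the first are prescribed
    on few coordinates only, the first letters of the second on all of them. Interleaving keeps the
    levels in order, provided that the words share their cutoffs; keeping only the family of cutoffs
    with the largest share costs a factor polynomial in [- ln delta], invisible in the growth rate.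
    A second obstacle is a ball that reaches into neighbouring cuboids: it would spoil the
    disjointness of the balls and, for negative [q], the upper bound on their measures. Hence every
    block contains a fixed word that forces the coded point into the interior. The dimensions need
    [T(q)] only up to a constant independent of [q], because it is divided by [q]; this constant is
    [CN], a bound for the exponential growth rate of the number of approximate cubes. Finally, an
    ordering that makes the sponge Lalley-Gatzouras need not belong to [Aset], where ties between
    cutoffs are broken by the index. Its formulas are therefore not special cases of the general
    ones and are proved by applying duality to each cube. *)

(* The hypotheses of the theorem, read coordinatewise. *)
Record sponge (R : realType) (d N : nat) := Sponge {
  sa : 'I_N -> 'I_d -> R;
  st : 'I_N -> 'I_d -> R;
  smu : 'I_N -> R;
  sc0 : 'I_d;
  si0 : 'I_N;
  lmin : R;
  lmax : R;
  mmin : R;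
  lmin_gt0 : 0 < lmin;
  lmax_lt1 : lmax < 1;
  mmin_gt0 : 0 < mmin;
  lam_ge : forall i c, lmin <= lam sa i c;
  lam_le : forall i c, lam sa i c <= lmax;
  smu_ge : forall i, mmin <= smu i;
  smu_sum : \sum_i smu i = 1;
  unit_stable : forall i c z, 0 <= z <= 1 -> 0 <= sa i c * z + st i c <= 1;
  face_escape : exists2 r0 : R, 0 < r0 & forall c u, u = 0 \/ u = 1 ->
    exists k, forall z, 0 <= z <= 1 -> r0 <= `|sa k c * z + st k c - u|;
  sponge_SPPC : SPPC sa st }.

Definition shiftS (N : nat) (k : nat) (x : Sigma N) : Sigma N := fun l => x (k + l)%N.

(** * Geometry of the coding *)

Section Geometry.
Variables (R : realType) (d N : nat) (S : sponge R d N).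
Implicit Types (x y : Sigma N) (c : 'I_d) (i j : 'I_N) (J : {set 'I_d}) (M : 'I_d -> nat).
Local Notation a := (sa S).
Local Notation t := (st S).
Local Notation mu := (smu S).

(* On coordinate [c], [f_{x 0} o ... o f_{x (k-1)}] is [z |-> bt x k c + al x k c * z]; [ls] is the
   length of the image of [[0, 1]]. *)
Definition al x k c : R := \prod_(l < k) a (x l) c.
Definition bt x k c : R := \sum_(j < k) al x j c * t (x j) c.
Definition ls x k c : R := \prod_(l < k) lam a (x l) c.

Lemma lam_gt0 i c : 0 < lam a i c.
Proof. exact: lt_le_trans (lmin_gt0 S) (lam_ge S i c). Qed.

Lemma lam_lt1 i c : lam a i c < 1.
Proof. exact: le_lt_trans (lam_le S i c) (lmax_lt1 S). Qed.

Lemma lmax_gt0 : 0 < lmax S.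
Proof. exact: lt_le_trans (lam_gt0 (si0 S) (sc0 S)) (lam_le S _ _). Qed.

Lemma lmin_lt1 : lmin S < 1.
Proof. exact: le_lt_trans (lam_ge S (si0 S) (sc0 S)) (lam_lt1 _ _). Qed.

Lemma smu_gt0 i : 0 < mu i.
Proof. exact: lt_le_trans (mmin_gt0 S) (smu_ge S i). Qed.

Lemma smu_le1 i : mu i <= 1.
Proof.
rewrite -(smu_sum S) (bigD1 i) //= lerDl sumr_ge0 // => j _.
exact/ltW/smu_gt0.
Qed.

Lemma mmin_le1 : mmin S <= 1.
Proof. exact: le_trans (smu_ge S (si0 S)) (smu_le1 _). Qed.

Lemma norm_al x k c : `|al x k c| = ls x k c.
Proof. by rewrite /al normr_prod. Qed.

Lemma ls_gt0 x k c : 0 < ls x k c.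
Proof. by apply: prodr_gt0 => l _; exact: lam_gt0. Qed.

Lemma al_neq0 x k c : al x k c != 0.
Proof. by rewrite -normr_gt0 norm_al ls_gt0. Qed.

Lemma lsS x k c : ls x k.+1 c = ls x k c * lam a (x k) c.
Proof. by rewrite /ls big_ord_recr. Qed.

Lemma ls_le x k c : ls x k c <= lmax S ^+ k.
Proof.
rewrite /ls -[X in lmax S ^+ X]card_ord -prodr_const.
by apply: ler_prod => l _; rewrite (ltW (lam_gt0 _ _)) lam_le.
Qed.

Lemma ls_ge x k c : lmin S ^+ k <= ls x k c.
Proof.
rewrite /ls -[X in lmin S ^+ X]card_ord -prodr_const.
by apply: ler_prod => l _; rewrite (ltW (lmin_gt0 S)) lam_ge.
Qed.

Lemma ls_add x k m c : ls x (k + m) c = ls x k c * ls (shiftS k x) m c.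
Proof. by rewrite /ls big_split_ord. Qed.

Lemma al_add x k m c : al x (k + m) c = al x k c * al (shiftS k x) m c.
Proof. by rewrite /al big_split_ord. Qed.

Lemma bt_add x k m c :
  bt x (k + m) c = bt x k c + al x k c * bt (shiftS k x) m c.
Proof.
rewrite /bt big_split_ord /= mulr_sumr; congr (_ + _).
by apply: eq_bigr => j _; rewrite al_add mulrA.
Qed.

Lemma btS x k c : bt x k.+1 c = bt x k c + al x k c * t (x k) c.
Proof. by rewrite /bt big_ord_recr. Qed.

Lemma alS x k c : al x k.+1 c = al x k c * a (x k) c.
Proof. by rewrite /al big_ord_recr. Qed.

Lemma compoE x k v c : compo a t x k v c = bt x k c + al x k c * v c.
Proof.
elim: k v => [|k IH] v /=; first by rewrite /bt /al !big_ord0 add0r mul1r.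
by rewrite IH btS alS /ifsmap; ring.
Qed.

Lemma affine_unit x k c z : 0 <= z <= 1 -> 0 <= bt x k c + al x k c * z <= 1.
Proof.
elim: k z => [|k IH] z z01; first by rewrite /bt /al !big_ord0 add0r mul1r.
have := IH _ (unit_stable S (x k) c z01).
have -> // : bt x k c + al x k c * (a (x k) c * z + t (x k) c) =
  bt x k.+1 c + al x k.+1 c * z by rewrite btS alS; ring.
Qed.

Lemma bt_unit x k c : 0 <= bt x k c <= 1.
Proof. by have := @affine_unit x k c 0; rewrite mulr0 addr0; apply; rewrite lexx ler01. Qed.

Lemma t_unit i c : 0 <= t i c <= 1.
Proof. by have := @unit_stable _ _ _ S i c 0; rewrite mulr0 add0r; apply; rewrite lexx ler01. Qed.

Lemma is_cvg_bt x c : cvgn (fun k => bt x k c).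
Proof.
pose u k := al x k c * t (x k) c.
have -> : (fun k => bt x k c) = series u.
  by apply/funext => k; rewrite /series /= big_mkord.
apply: normed_cvg.
have h := @series_le_cvg R (fun n => `|u n|) (geometric 1 (lmax S)).
apply: h.
- by move=> n /=.
- by move=> n /=; rewrite mul1r exprn_ge0 // ltW // lmax_gt0.
- move=> n /=; rewrite mul1r normrM norm_al.
  have /andP[t0 t1] := t_unit (x n) c.
  rewrite (ger0_norm t0) (le_trans _ (ls_le x n c)) // ler_piMr //.
  exact/ltW/ls_gt0.
- by apply: is_cvg_geometric_series; rewrite ger0_norm ?lmax_lt1 // ltW // lmax_gt0.
Qed.

Lemma coding_lim x c : coding a t x c = limn (fun k => bt x k c).
Proof.
rewrite /coding (_ : (fun k => _) = (fun k => bt x k c)) //.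
by apply/funext => k; rewrite compoE mulr0 addr0.
Qed.

Lemma coding_cvg x c : bt x k c @[k --> \oo] --> coding a t x c.
Proof. by rewrite coding_lim; exact: is_cvg_bt. Qed.

Lemma coding_unit x c : 0 <= coding a t x c <= 1.
Proof.
have cb := @is_cvg_bt x c; rewrite coding_lim.
apply/andP; split.
- by apply: limr_ge => //; near=> k; have /andP[] := bt_unit x k c.
- by apply: limr_le => //; near=> k; have /andP[] := bt_unit x k c.
Unshelve. all: by end_near. Qed.

Lemma coding_shift x k c :
  coding a t x c = bt x k c + al x k c * coding a t (shiftS k x) c.
Proof.
apply: (@cvg_unique _ _ (bt x (k + m) c @[m --> \oo])).
- exact: norm_hausdorff.
- have := @coding_cvg x c; rewrite -(cvg_shiftn k).
  by under eq_fun do rewrite addnC.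
- rewrite /= (_ : (fun m => _) = (fun m => bt x k c + al x k c * bt (shiftS k x) m c)).
    by apply: cvgD; [exact: cvg_cst | apply: cvgM; [exact: cvg_cst | exact: coding_cvg]].
  by apply/funext => m; rewrite bt_add.
Qed.

(* [eqJ J] is exact overlap on the span of the axes in [J]. A family of cutoffs [M] (one word length
   per coordinate) defines the generalized approximate cube [{y | eqM M x y}], in which the [l]-th
   letter is prescribed only on the coordinates whose cutoff exceeds [l]; [mass M x H] is its measure
   as soon as [H] bounds all cutoffs. *)
Definition eqJ J i j : bool := [forall c in J, (a i c == a j c) && (t i c == t j c)].
Definition muJ J i : R := \sum_(j | eqJ J i j) mu j.
Definition Jm M l : {set 'I_d} := [set c | (l < M c)%N].
Definition eqM M x y : Prop := forall l, eqJ (Jm M l) (x l) (y l).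
Definition mass M x H : R := \prod_(l < H) muJ (Jm M l) (x l).

Lemma eqJP J i j :
  reflect (forall c, c \in J -> a i c = a j c /\ t i c = t j c) (eqJ J i j).
Proof.
apply: (iffP 'forall_implyP) => h c /h.
- by move=> /andP[/eqP -> /eqP ->].
- by move=> [-> ->]; rewrite !eqxx.
Qed.

Lemma eqJ_refl J i : eqJ J i i.
Proof. by apply/eqJP. Qed.

Lemma eqJ_sym J i j : eqJ J i j = eqJ J j i.
Proof. by apply/eqJP/eqJP => h c /h[-> ->]. Qed.

Lemma eqJ_trans J i j k : eqJ J i j -> eqJ J j k -> eqJ J i k.
Proof. by move=> /eqJP ij /eqJP jk; apply/eqJP => c cJ; have [-> ->] := ij c cJ; exact: jk. Qed.

Lemma eqJ_left J i j k : eqJ J i j -> eqJ J i k = eqJ J j k.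
Proof.
move=> ij; apply/idP/idP; last exact: eqJ_trans ij.
by rewrite eqJ_sym in ij; exact: eqJ_trans ij.
Qed.

Lemma eqJ_sub J J' i j : J \subset J' -> eqJ J' i j -> eqJ J i j.
Proof. by move=> /fintype.subsetP JJ /eqJP h; apply/eqJP => c /JJ/h. Qed.

Lemma eq_muJ J i j : eqJ J i j -> muJ J i = muJ J j.
Proof. by move=> ij; apply: eq_bigl => k; exact: eqJ_left. Qed.

Lemma muJ_ge_mu J i : mu i <= muJ J i.
Proof.
rewrite /muJ (bigD1 i) ?eqJ_refl //= lerDl sumr_ge0 // => j _; exact/ltW/smu_gt0.
Qed.

Lemma muJ_gt0 J i : 0 < muJ J i.
Proof. exact: lt_le_trans (smu_gt0 i) (muJ_ge_mu J i). Qed.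

Lemma muJ_ge J i : mmin S <= muJ J i.
Proof. exact: le_trans (smu_ge S i) (muJ_ge_mu J i). Qed.

Lemma muJ_le1 J i : muJ J i <= 1.
Proof.
rewrite -(smu_sum S) [leRHS](bigID (eqJ J i)) /= lerDl sumr_ge0 // => j _.
exact/ltW/smu_gt0.
Qed.

Lemma muJ_sub J J' i : J \subset J' -> muJ J' i <= muJ J i.
Proof.
move=> JJ; rewrite /muJ [leRHS](bigID (eqJ J' i)) /=.
rewrite [X in X <= _](_ : _ = \sum_(j | eqJ J i j && eqJ J' i j) mu j).
  by rewrite lerDl sumr_ge0 // => j _; exact/ltW/smu_gt0.
apply: eq_bigl => j; apply/idP/idP => [h|/andP[]//].
by rewrite h (eqJ_sub JJ h).
Qed.

Lemma muJ0 i : muJ finset.set0 i = 1.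
Proof. by rewrite -(smu_sum S); apply: eq_bigl => j; apply/eqJP => c; rewrite inE. Qed.

Lemma mass_gt0 M x H : 0 < mass M x H.
Proof. by apply: prodr_gt0 => l _; exact: muJ_gt0. Qed.

Lemma mass_le1 M x H : mass M x H <= 1.
Proof. by apply: prodr_ile1 => l _; rewrite (ltW (muJ_gt0 _ _)) muJ_le1. Qed.

Lemma mass_ge M x H : mmin S ^+ H <= mass M x H.
Proof.
rewrite /mass -[X in mmin S ^+ X]card_ord -prodr_const.
by apply: ler_prod => l _; rewrite (ltW (mmin_gt0 S)) muJ_ge.
Qed.

Lemma eq_mass M x y H : eqM M x y -> mass M x H = mass M y H.
Proof. by move=> xy; apply: eq_bigr => l _; exact: eq_muJ. Qed.

(** At most [d * E] pairs of a coordinate and a level become prescribed. A factor changes only at a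
    level where [Jm] grows, and there it drops from at most 1 to at least [mmin S]. In the proof
    [e l] counts the coordinates that are new at level [l]. *)
Lemma mass_ext M M' x H E : (forall c, M c <= M' c <= M c + E)%N ->
  (forall c, M' c <= H)%N ->
  mmin S ^+ (d * E) * mass M x H <= mass M' x H <= mass M x H.
Proof.
move=> MM MH.
have JJ l : Jm M l \subset Jm M' l.
  apply/fintype.subsetP => c; rewrite !inE => /leq_trans; apply.
  by have /andP[] := MM c.
apply/andP; split; last first.
  by apply: ler_prod => l _; rewrite (ltW (muJ_gt0 _ _)) muJ_sub.
pose e (l : nat) := (\sum_(c < d) (M c <= l < M' c))%N.
apply: (@le_trans _ _ (\prod_(l < H) (mmin S ^+ e l * muJ (Jm M l) (x l)))).
  rewrite big_split /= ler_pM2r ?mass_gt0 // prodrXr ler_wiXn2l ?mmin_le1 ?(ltW (mmin_gt0 S)) //.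
  rewrite exchange_big /= -[X in (_ <= X * _)%N]card_ord -sum_nat_const leq_sum // => c _.
  have /andP[Mc M'c] := MM c.
  rewrite -(leq_add2l (M c)) (leq_trans _ M'c) //.
  have -> : (\sum_(l < H) (M c <= l < M' c) = M' c - M c)%N.
    have h := big_mkord xpredT (fun l => (M c <= l < M' c)%N : nat).
    rewrite -h (big_cat_nat (n := M c)) //=; last exact: leq_trans Mc (MH c).
    rewrite [X in (X + _)%N]big_nat big1 ?add0n => [|l /andP[_ l1]]; last by rewrite leqNgt l1.
    rewrite (big_cat_nat (n := M' c)) //= [X in (_ + X)%N]big_nat.
    rewrite [X in (_ + X)%N]big1 ?addn0 => [|l /andP[l1 _]]; last first.
      by rewrite ltnNge l1 andbF.
    rewrite big_nat (eq_bigr (fun=> 1%N)) -?big_nat ?sum_nat_const_nat ?muln1 //.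
    by move=> l ->.
  by rewrite subnKC.
apply: ler_prod => l _; rewrite mulr_ge0 ?exprn_ge0 ?(ltW (mmin_gt0 S)) ?(ltW (muJ_gt0 _ _)) //=.
have [|/set0Pn[c]] := eqVneq (Jm M' l :\: Jm M l)%SET finset.set0; last first.
  rewrite !inE -leqNgt => cl.
  apply: (@le_trans _ _ (mmin S)); last exact: muJ_ge.
  rewrite -[leRHS]mulr1 ler_pM ?exprn_ge0 ?(ltW (mmin_gt0 S)) ?(ltW (muJ_gt0 _ _)) ?muJ_le1 //.
  rewrite -[leRHS]expr1 ler_wiXn2l ?mmin_le1 ?(ltW (mmin_gt0 S)) //.
  by rewrite /e (bigD1 c) //= cl.
move=> /eqP; rewrite finset.setD_eq0 => J'J.
have -> : Jm M' l = Jm M l by apply/eqP; rewrite finset.eqEsubset J'J JJ.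
rewrite ler_piMl ?(ltW (muJ_gt0 _ _)) // exprn_ile1 ?mmin_le1 // ltW ?mmin_gt0 //.
Qed.

Definition Eset (s : {perm 'I_d}) (n : nat) : {set 'I_d} := [set s k | k : 'I_d & (k < n)%N].

Lemma in_Eset (s : {perm 'I_d}) n k : (s k \in Eset s n) = (k < n)%N.
Proof.
apply/imsetP/idP => [[j]|kn]; first by rewrite inE => jn /perm_inj ->.
by exists k; rewrite ?inE.
Qed.

Lemma in_EsetE s n c : (c \in Eset s n) = [exists k : 'I_d, (k < n)%N && (s k == c)].
Proof.
apply/imsetP/existsP => [[k]|[k /andP[kn /eqP <-]]]; last by exists k; rewrite ?inE.
by rewrite inE => kn ->; exists k; rewrite kn eqxx.
Qed.

Lemma overlapE s n i j : overlap a t s n i j <-> eqJ (Eset s n) i j.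
Proof.
split=> [h|/eqJP h x _].
- apply/eqJP => c cE.
  have h0 := congr1 (fun f => f c) (h (fun=> 0) (fun=> ltac:(by rewrite lexx ler01))).
  have h1 := congr1 (fun f => f c) (h (fun=> 1) (fun=> ltac:(by rewrite lexx ler01))).
  move: h0 h1; rewrite /projE -in_EsetE cE /ifsmap !mulr0 !mulr1 !add0r => ->.
  by move=> /addIr.
- apply/funext => c; rewrite /projE -in_EsetE; case: ifP => // /h[ac tc].
  by rewrite /ifsmap ac tc.
Qed.

(** The SPPC alternative for the span of the axes in [J]. Images of the open cube are boxes, so
    disjoint projections are already disjoint along one axis. *)
Definition sepJ J := forall i j, eqJ J i j \/ exists2 c, c \in J &
  forall u z, 0 < u < 1 -> 0 < z < 1 -> a i c * u + t i c <> a j c * z + t j c.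

Lemma sepJ0 : sepJ finset.set0.
Proof. by move=> i j; left; apply/eqJP => c; rewrite inE. Qed.

Lemma sepJ_Eset s n : Aset a s -> (1 <= n <= d)%N -> sepJ (Eset s n).
Proof.
move=> As nd i j; have [/overlapE ->|h] := @sponge_SPPC _ _ _ S _ As _ nd i j; first by left.
right; apply: contrapT => nc.
have {}nc c : exists uz : R * R, c \in Eset s n ->
    [/\ 0 < uz.1 < 1, 0 < uz.2 < 1 & a i c * uz.1 + t i c = a j c * uz.2 + t j c].
  have [cE|cE] := boolP (c \in Eset s n); last by exists (0, 0).
  apply: contrapT => nn; apply: nc; exists c => // u z u01 z01 e.
  by apply: nn; exists (u, z).
have [g gP] := choice nc.
(* Common values on all axes of [Eset s n] combine into a common point of the two projected boxes;
   1/2 on the remaining axes keeps both preimages in the open cube. *)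
pose u c := if c \in Eset s n then (g c).1 else 1 / 2.
pose z c := if c \in Eset s n then (g c).2 else 1 / 2.
have half01 : 0 < (1 / 2 : R) < 1 by lra.
have : set0 (projE s n (ifsmap a t i u)).
  rewrite -h; split.
  - exists (ifsmap a t i u) => //; exists u => // c; rewrite /u.
    by case: ifP => // /gP[].
  - exists (ifsmap a t j z).
      by exists z => // c; rewrite /z; case: ifP => // /gP[].
    apply/funext => c; rewrite /projE -in_EsetE.
    by case: ifP => // cE; rewrite /ifsmap /u /z cE; have [_ _ ->] := gP c cE.
by [].
Qed.

Lemma affine_open x k c z : 0 < z < 1 -> 0 < bt x k c + al x k c * z < 1.
Proof.
move=> /andP[z0 z1].
have /andP[b0 b1] := bt_unit x k c.
have /andP[] : 0 <= bt x k c + al x k c * 1 <= 1 by apply: affine_unit; rewrite ler01 lexx.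
have := al_neq0 x k c; rewrite neq_lt => /orP[] A0; nra.
Qed.

(** An open interval that avoids the interior of another interval also avoids its endpoints. Closed
    intervals matter because a coded point may lie on the boundary of its cuboid. *)
Lemma sepJ_closed J i j : sepJ J -> ~~ eqJ J i j -> exists2 c, c \in J &
  forall u z, 0 < u < 1 -> 0 <= z <= 1 -> a i c * u + t i c <> a j c * z + t j c.
Proof.
move=> sJ nij; have [|[c cJ h]] := sJ i j; first by rewrite (negbTE nij).
exists c => // u z /andP[u0 u1] /andP[z0 z1] e.
have ai0 : a i c != 0 by rewrite -normr_gt0 lam_gt0.
(* Moving [z] by [e0 * (1 / 2 - z)] makes it interior, and moving [u] by [e0 * k] preserves the
   equality; [e0] is chosen so small that [u] moves by at most half its distance [m] to the
   endpoints. *)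
pose k := a j c * (1 / 2 - z) / a i c.
pose D := 1 + `|k|.
have D0 : 0 < D by rewrite /D; have := normr_ge0 k; lra.
pose m := Num.min u (1 - u).
have m0 : 0 < m by rewrite lt_min u0 subr_gt0.
have mu' : m <= u by rewrite ge_min lexx.
have mu'' : m <= 1 - u by rewrite ge_min lexx orbT.
pose e0 := m / 2 / D.
have e0D : e0 * D = m / 2 by rewrite /e0 mulfVK // gt_eqF.
have e00 : 0 < e0 by rewrite divr_gt0 // divr_gt0.
have D1 : 1 <= D by rewrite /D; have := normr_ge0 k; lra.
have e01 : e0 < 1 by nra.
have ek : `|e0 * k| <= m / 2.
  rewrite normrM (gtr0_norm e00) -e0D; rewrite /D; nra.
apply: (h (u + e0 * k) (z + e0 * (1 / 2 - z))).
- move: ek; rewrite ler_norml => /andP[]; lra.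
- nra.
- have -> : a j c * (z + e0 * (1 / 2 - z)) + t j c =
      (a j c * z + t j c) + e0 * (a j c * (1 / 2 - z)) by ring.
  by rewrite -e /k; field.
Qed.

Definition goodM M := forall l, sepJ (Jm M l).

Lemma prefix_eq M x y c k : (forall l, (l < k)%N -> eqJ (Jm M l) (x l) (y l)) ->
  (k <= M c)%N -> al x k c = al y k c /\ bt x k c = bt y k c.
Proof.
move=> h kM.
have h' l : (l < k)%N -> a (x l) c = a (y l) c /\ t (x l) c = t (y l) c.
  by move=> lk; have /eqJP := h l lk; apply; rewrite inE (leq_trans lk).
have hal m : (m <= k)%N -> al x m c = al y m c.
  move=> jk; apply: eq_bigr => l _.
  by have [] := h' l (leq_trans (ltn_ord l) jk).
split; first exact: hal.
apply: eq_bigr => j _; rewrite (hal j) ?(ltnW (ltn_ord j)) //.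
by have [_ ->] := h' j (ltn_ord j).
Qed.

(** Up to the first level [l] of disagreement both words induce the same affine map along [c], and
    this injective map transports the separation of the two letters. The equality of [al] is
    recorded for [ctr_sep], where the cutoffs of [y] are not those of [x]. *)
Lemma separation M x y : goodM M -> ~ eqM M x y ->
  exists c, exists2 l, (l < M c)%N /\ al x l c = al y l c &
    forall u z, 0 < u < 1 -> 0 <= z <= 1 ->
    bt x l.+1 c + al x l.+1 c * u <> bt y l.+1 c + al y l.+1 c * z.
Proof.
move=> gM /existsNP ne.
have {}ne : exists l, ~~ eqJ (Jm M l) (x l) (y l) by have [l /negP] := ne; exists l.
case: (ex_minnP ne) => l nl lmn.
have [c cJ h] := sepJ_closed (gM l) nl.
have [ea eb] : al x l c = al y l c /\ bt x l c = bt y l c.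
  apply: (@prefix_eq M); last by move: cJ; rewrite inE => /ltnW.
  by move=> j jl; apply: contraTT jl => /lmn; rewrite -leqNgt.
exists c, l; first by move: cJ; rewrite inE.
move=> u z u01 z01.
rewrite !alS !btS ea eb => e; apply: (h u z u01 z01).
have A0 := al_neq0 y l c.
apply: (mulfI A0); apply: (@addrI _ (bt y l c)).
by move: e; rewrite !mulrDr !mulrA -!addrA [al y l c * _ + _]addrC [_ * z + _]addrC.
Qed.

(** Open on the side of [x] and closed on the side of [y]: balls will supply interior points of one
    cuboid, while [coding_in_cuboid] only gives points of the closed other one. *)
Lemma cuboids_disjoint M x y p : goodM M -> ~ eqM M x y ->
  (forall c, exists2 u, 0 < u < 1 & p c = bt x (M c) c + al x (M c) c * u) ->
  (forall c, exists2 z, 0 <= z <= 1 & p c = bt y (M c) c + al y (M c) c * z) -> False.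
Proof.
move=> gM nxy px py; have [c [l [lM _] h]] := separation gM nxy.
have [u u01 pu] := px c; have [z z01 pz] := py c.
have e : M c = (l.+1 + (M c - l.+1))%N by rewrite subnKC.
set m := (M c - l.+1)%N in e.
apply: (h (bt (shiftS l.+1 x) m c + al (shiftS l.+1 x) m c * u)
          (bt (shiftS l.+1 y) m c + al (shiftS l.+1 y) m c * z)).
- exact: affine_open.
- exact: affine_unit.
- move: pz; rewrite pu e !bt_add !al_add => e'.
  by rewrite !mulrDr !addrA !mulrA.
Qed.

Lemma coding_in_cuboid x k c : exists2 z, 0 <= z <= 1 & coding a t x c = bt x k c + al x k c * z.
Proof. by exists (coding a t (shiftS k x) c); [exact: coding_unit|exact: coding_shift]. Qed.

Lemma coding_close M x y c : eqM M x y -> `|coding a t x c - coding a t y c| <= ls x (M c) c.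
Proof.
move=> xy; rewrite (coding_shift x (M c)) (coding_shift y (M c)).
have [-> ->] : al x (M c) c = al y (M c) c /\ bt x (M c) c = bt y (M c) c.
  by apply: (@prefix_eq M) => // l _; exact: xy.
have -> : ls x (M c) c = ls y (M c) c.
  rewrite -!norm_al; congr `|_|.
  by have [] : al x (M c) c = al y (M c) c /\ bt x (M c) c = bt y (M c) c
    by apply: (@prefix_eq M) => // l _; exact: xy.
set p := coding a t _ c; set q := coding a t _ c.
have -> : bt y (M c) c + al y (M c) c * p - (bt y (M c) c + al y (M c) c * q) =
  al y (M c) c * (p - q) by ring.
rewrite normrM norm_al ler_piMr ?(ltW (ls_gt0 _ _ _)) //.
have := coding_unit (shiftS (M c) x) c; have := coding_unit (shiftS (M c) y) c.
rewrite -/p -/q ler_norml; lra.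
Qed.

Lemma eq_prefix x y k c : (forall l, (l < k)%N -> x l = y l) ->
  al x k c = al y k c /\ bt x k c = bt y k c.
Proof.
move=> h; apply: (@prefix_eq (fun=> k)) => // l lk; rewrite h //; exact: eqJ_refl.
Qed.

(* The face to be avoided next is pulled back through the word built so far. *)
Lemma interior_faces (fs : seq ('I_d * bool)) : exists (K : nat) (W : Sigma N) (rho : R),
  0 < rho /\ forall y, (forall l, (l < K)%N -> y l = W l) ->
    forall f, f \in fs -> rho <= `|coding a t y f.1 - f.2%:R|.
Proof.
elim: fs => [|[c b] fs [K [W [rho [rho0 IH]]]]].
  by exists 0%N, (fun=> si0 S), 1; split.
have [r0 r00 face] := face_escape S.
pose A := al W K c; pose B := bt W K c.
(* A prefix that reverses the orientation of the axis exchanges its two faces. *)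
pose u : R := (if 0 < A then b else ~~ b)%:R.
have [k hk] : exists k, forall z, 0 <= z <= 1 -> r0 <= `|a k c * z + t k c - u|.
  by apply: face; rewrite /u; case: (if _ then _ else _); [right|left].
exists K.+1, (fun l => if (l < K)%N then W l else k), (Num.min rho (`|A| * r0)).
have A0 : A != 0 by exact: al_neq0.
split; first by rewrite lt_min rho0 mulr_gt0 // normr_gt0.
move=> y hy f; rewrite inE => /orP[/eqP -> /=|ff]; last first.
  rewrite ge_min IH // => l lK; rewrite hy ?lK //; exact: ltnW.
rewrite ge_min; apply/orP; right.
have [eA eB] := @eq_prefix y W K c (fun l lK => ltac:(by rewrite hy ?lK // ltnW)).
rewrite (coding_shift y K) eA eB -/A -/B.
have := hk (coding a t (shiftS K.+1 y) c) (coding_unit _ _).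
have -> : a k c * coding a t (shiftS K.+1 y) c + t k c = coding a t (shiftS K y) c.
  rewrite (coding_shift (shiftS K y) 1) btS alS /bt /al !big_ord0 add0r !mul1r.
  rewrite /shiftS addn0 hy // ltnn addrC; congr (_ + _ * _).
  by rewrite (_ : (fun l => y (K + (1 + l))%N) = (fun l => y (K.+1 + l)%N)) //; apply/funext => l; rewrite addnA addn1.
set z := coding a t _ c => hz.
(* The prefix maps the unit interval into itself, so the face lies beyond the image of [u] and is at
   least as far from [B + A * z] as that image. *)
apply: (@le_trans _ _ (`|A| * `|z - u|)); first by rewrite ler_pM2l // normr_gt0.
have z01 := coding_unit (shiftS K y) c; rewrite -/z in z01.
have /andP[] : 0 <= B + A * z <= 1 by exact: affine_unit.
have /andP[B0 B1] : 0 <= B <= 1 by exact: bt_unit.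
have /andP[] : 0 <= B + A * 1 <= 1 by apply: affine_unit; rewrite ler01 lexx.
rewrite -normrM /u; move/andP: z01 => [z0 z1].
have := A0; rewrite neq_lt => /orP[] Al h1 h2 h3 h4; rewrite ?Al ?(lt_gtF Al).
- case: (b) => /=; rewrite ?subr0.
  + by rewrite (ler0_norm (_ : A * z <= 0)) ?(ler0_norm (_ : B + A * z - 1 <= 0)); nra.
  + by rewrite (ger0_norm (_ : 0 <= A * (z - 1))) ?(ger0_norm (_ : 0 <= B + A * z)); nra.
- case: (b) => /=; rewrite ?subr0.
  + by rewrite (ler0_norm (_ : A * (z - 1) <= 0)) ?(ler0_norm (_ : B + A * z - 1 <= 0)); nra.
  + by rewrite (ger0_norm (_ : 0 <= A * z)) ?(ger0_norm (_ : 0 <= B + A * z)); nra.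
Qed.

(** Face avoidance is applied to all pairs of an axis and a side. Placed right after a cutoff, [W]
    keeps the coded point at relative distance [rho] from the faces of its cuboid. *)
Lemma interior_word : exists (K : nat) (W : Sigma N) (rho : R),
  0 < rho /\ forall y, (forall l, (l < K)%N -> y l = W l) ->
    forall c, rho <= coding a t y c <= 1 - rho.
Proof.
have [K [W [rho [rho0 h]]]] := interior_faces (enum {: 'I_d * bool}).
exists K, W, rho; split=> // y hy c.
have := h y hy (c, false) (mem_enum _ _); have := h y hy (c, true) (mem_enum _ _).
have /andP[c0 c1] := coding_unit y c.
rewrite /= subr0 (ger0_norm c0) ler0_norm; lra.
Qed.
End Geometry.


(** * Measure of approximate cubes and balls *)

Section EuclideanDistance.
Variables (R : realType) (d : nat).
Implicit Types x y : 'I_d -> R.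

Lemma eucl_coord x y c : `|x c - y c| <= eucl_dist x y.
Proof.
rewrite /eucl_dist -sqrtr_sqr ler_sqrt; last by apply: sumr_ge0 => i _; exact: sqr_ge0.
by rewrite (bigD1 c) //= lerDl sumr_ge0 // => i _; exact: sqr_ge0.
Qed.

Lemma eucl_le_sum x y : eucl_dist x y <= \sum_c `|x c - y c|.
Proof.
have s0 : 0 <= \sum_c `|x c - y c| by apply: sumr_ge0.
rewrite /eucl_dist -[leRHS](ger0_norm s0) -sqrtr_sqr ler_sqrt ?sqr_ge0 //.
rewrite expr2 mulr_suml ler_sum // => c _.
rewrite -real_normK ?num_real // expr2 ler_wpM2l // (bigD1 c) //= lerDl sumr_ge0 //.
Qed.

Lemma eucl_le x y r : (forall c, `|x c - y c| <= r / d%:R) -> (0 < d)%N -> eucl_dist x y <= r.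
Proof.
move=> h d0; apply: (le_trans (eucl_le_sum x y)).
apply: (@le_trans _ _ (\sum_(c < d) r / d%:R)); first by apply: ler_sum => c _; exact: h.
by rewrite sumr_const card_ord -[_ *+ d]mulr_natr divfK // pnatr_eq0 -lt0n.
Qed.

Lemma eucl_lt x y r : (forall c, `|x c - y c| < r / d%:R) -> (0 < d)%N -> eucl_dist x y < r.
Proof.
move=> h d0; apply: (le_lt_trans (eucl_le_sum x y)).
apply: (@lt_le_trans _ _ (\sum_(c < d) r / d%:R)); last first.
  by rewrite sumr_const card_ord -[_ *+ d]mulr_natr divfK // pnatr_eq0 -lt0n.
rewrite [ltLHS](bigD1 (Ordinal d0)) //= [ltRHS](bigD1 (Ordinal d0)) //=; apply: ltr_leD; first exact: h.
by apply: ler_sum => c _; exact/ltW/h.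
Qed.

Lemma eucl_xx x r : 0 <= r -> eucl_dist x x <= r.
Proof.
by move=> r0; rewrite (le_trans (eucl_le_sum _ _)) // big1 // => c _; rewrite subrr normr0.
Qed.
End EuclideanDistance.

Lemma cvg_sum (R : realType) (U : Type) (F : set_system U) (FF : Filter F) (I : Type)
    (r : seq I) (Q : pred I) (f : I -> U -> R) (l : I -> R) :
  (forall i, f i x @[x --> F] --> l i) ->
  \sum_(i <- r | Q i) f i x @[x --> F] --> \sum_(i <- r | Q i) l i.
Proof.
move=> h; elim: r => [|i r IH].
  rewrite big_nil (_ : (fun x => _) = (fun=> 0)); first exact: cvg_cst.
  by apply/funext => x; rewrite big_nil.
rewrite big_cons (_ : (fun x => _) = (fun x => if Q i then f i x + \sum_(j <- r | Q j) f j x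
   else \sum_(j <- r | Q j) f j x)); last by apply/funext => x; rewrite big_cons.
by case: ifP => // _; apply: cvgD.
Qed.

Definition iid_law (R : realType) (N : nat) (mu : 'I_N -> R) (dm : measure_display)
  (T : measurableType dm) (P : probability T R) (X : T -> Sigma N) :=
  forall k (w : 'I_k -> 'I_N), measurable (X @^-1` cyl w) /\
      P (X @^-1` cyl w) = (\prod_(j < k) mu (w j))%:E.

Section Probability.
Variables (R : realType) (d N : nat) (S : sponge R d N).
Variables (dm : measure_display) (T : measurableType dm) (P : probability T R).
Variables (X : T -> Sigma N).
Hypothesis XP : iid_law (smu S) P X.
Local Notation a := (sa S).
Local Notation t := (st S).
Local Notation mu := (smu S).
Implicit Types (x y : Sigma N) (c : 'I_d) (M : 'I_d -> nat).

Definition word H x : {ffun 'I_H -> 'I_N} := [ffun l : 'I_H => x l].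

Lemma prefix_event H (Q : pred {ffun 'I_H -> 'I_N}) :
  measurable [set w | Q (word H (X w))] /\
  P [set w | Q (word H (X w))] = (\sum_(v | Q v) \prod_l mu (v l))%:E.
Proof.
have -> : [set w | Q (word H (X w))] =
    \bigcup_(v in [set` Q]) (X @^-1` cyl (v : 'I_H -> 'I_N)).
  apply/seteqP; split=> [w /= Qw|w [v /= Qv] Xv].
  - by exists (word H (X w)) => // l; rewrite ffunE.
  - by rewrite (_ : word H (X w) = v) //; apply/ffunP => l; rewrite ffunE Xv.
have mc v : [set` Q] v -> measurable (X @^-1` cyl (v : 'I_H -> 'I_N)).
  by move=> _; have [] := XP (v : 'I_H -> 'I_N).
split; first exact: fin_bigcup_measurable.
rewrite measure_fin_bigcup //; last first.
  move=> v v' _ _ [w [/= vw v'w]]; apply/ffunP => l; by rewrite -vw -v'w.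
rewrite -(@bigfs _ _ _ _ (index_enum {ffun 'I_H -> 'I_N})) ?index_enum_uniq //; last by move=> v _; rewrite mem_index_enum.
rewrite -sumEFin; apply: eq_bigr => v _.
by have [_ h] := XP (v : 'I_H -> 'I_N); exact: h.
Qed.

Lemma class_event M x H : (forall c, M c <= H)%N ->
  measurable [set w | eqM S M x (X w)] /\ P [set w | eqM S M x (X w)] = (mass S M x H)%:E.
Proof.
move=> MH.
pose Q (l : 'I_H) j := eqJ S (Jm M l) (x l) j.
have -> : [set w | eqM S M x (X w)] = [set w | (word H (X w)) \in family Q].
  apply/seteqP; split=> [w /= h|w /= /familyP h l].
  - by apply/familyP => l; rewrite unfold_in /Q ffunE; exact: h.
  - have [lH|Hl] := ltnP l H; first by have := h (Ordinal lH); rewrite unfold_in /Q ffunE.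
    apply/eqJP => c; rewrite inE => lM.
    by have := leq_trans lM (MH c); rewrite ltnNge Hl.
have [m ->] := prefix_event (mem (family Q)); split=> //; congr _%:E.
by rewrite /mass /muJ (bigA_distr_big_dep Q (fun _ j => mu j)); apply: eq_bigl.
Qed.

Lemma prefix_measurable H (f : {ffun 'I_H -> 'I_N} -> R) :
  measurable_fun setT (fun w => f (word H (X w))).
Proof.
move=> _ Y mY; rewrite setTI.
have [m _] := prefix_event (fun v => f v \in Y).
rewrite (_ : _ @^-1` _ = [set w | f (word H (X w)) \in Y]) //.
by apply/seteqP; split=> w /=; rewrite inE.
Qed.

Lemma bt_word x k c : bt S x k c = bt S (fun l => if insub l is Some j then word k x j else si0 S) k c.
Proof.
have := @eq_prefix _ _ _ S x (fun l => if insub l is Some j then word k x j else si0 S) k c.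
by case=> // l lk; rewrite insubT ffunE.
Qed.

(** Only cylinder events are known to be measurable. The partial sums [bt] depend on finitely many
    letters, and the coordinates of [coding] are their limits. *)
Lemma ball_measurable z (r : R) : 0 <= r ->
  measurable ((coding a t \o X) @^-1` cballE z r).
Proof.
move=> r0.
pose f w := \sum_(c < d) (z c - coding a t (X w) c) ^+ 2.
have mf : measurable_fun setT f.
  apply: (@measurable_fun_cvg _ _ _ _
    (fun k w => \sum_(c < d) (z c - bt S (X w) k c) ^+ 2)).
  - move=> k; under eq_fun do under eq_bigr do rewrite bt_word.
    exact: (@prefix_measurable k (fun v => \sum_(c < d)
      (z c - bt S (fun l => if insub l is Some j then v j else si0 S) k c) ^+ 2)).
  - move=> w _; apply: cvg_sum => c.
    have h : z c - bt S (X w) k c @[k --> \oo] --> z c - coding a t (X w) c.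
      by apply: cvgB; [exact: cvg_cst | exact: coding_cvg].
    by under eq_fun do rewrite expr2; rewrite expr2; apply: cvgM.
have := mf measurableT _ (measurable_itv `]-oo, r ^+ 2]%R).
rewrite setTI; congr measurable; apply/seteqP; split=> w /=; rewrite in_itv /= /cballE /= /eucl_dist -/(f w).
- move=> h; rewrite -[leRHS](ger0_norm r0) -sqrtr_sqr ler_sqrt ?sqr_ge0 //.
- move=> h; have f0 : 0 <= f w by apply: sumr_ge0 => c _; exact: sqr_ge0.
  by rewrite -(sqr_sqrtr f0) ler_sqr // nnegrE.
Qed.

Definition nub (z : 'I_d -> R) (r : R) : R :=
  fine (P ((coding a t \o X) @^-1` cballE z r)).

Lemma nubE z r : 0 <= r -> P ((coding a t \o X) @^-1` cballE z r) = (nub z r)%:E.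
Proof.
move=> r0; rewrite /nub fineK // ge0_fin_numE //.
by rewrite (le_lt_trans (probability_le1 P (ball_measurable z r0))) // ltry.
Qed.

Lemma nub_ge0 z r : 0 <= nub z r.
Proof. exact: fine_ge0. Qed.

Lemma nub_le1 z r : 0 <= r -> nub z r <= 1.
Proof. by move=> r0; rewrite -lee_fin -nubE // probability_le1 //; exact: ball_measurable. Qed.

Lemma nub_ge_mass M x H z r : 0 <= r -> (forall c, M c <= H)%N ->
  (forall y, eqM S M x y -> cballE z r (coding a t y)) -> mass S M x H <= nub z r.
Proof.
move=> r0 MH h; rewrite -lee_fin -nubE //; have [m <-] := class_event x MH.
by apply: le_measure; rewrite ?inE //; [exact: ball_measurable|move=> w; exact: h].
Qed.

Lemma nub_le_mass M x H z r : 0 <= r -> (forall c, M c <= H)%N ->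
  (forall y, cballE z r (coding a t y) -> eqM S M x y) -> nub z r <= mass S M x H.
Proof.
move=> r0 MH h; rewrite -lee_fin -nubE //; have [m <-] := class_event x MH.
by apply: le_measure; rewrite ?inE //; [exact: ball_measurable|move=> w; exact: h].
Qed.

Lemma nub_le_sum (I : finType) (Q : pred I) (Mi : I -> 'I_d -> nat) (xi : I -> Sigma N) H z r :
  0 <= r -> (forall i c, Mi i c <= H)%N ->
  (forall y, cballE z r (coding a t y) -> exists2 i, Q i & eqM S (Mi i) (xi i) y) ->
  nub z r <= \sum_(i | Q i) mass S (Mi i) (xi i) H.
Proof.
move=> r0 MH h; rewrite -lee_fin -nubE // -sumEFin.
pose F i := [set w | eqM S (Mi i) (xi i) (X w)].
have mF i : measurable (F i) by have [] := class_event (xi i) (MH i).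
apply: (@le_trans _ _ (P (\big[setU/set0]_(i | Q i) F i))).
  apply: le_measure; rewrite ?inE //; [exact: ball_measurable|exact: bigsetU_measurable|].
  by move=> w /h[i Qi e]; rewrite (bigD1 i) //=; left.
have -> : (\sum_(i | Q i) (mass S (Mi i) (xi i) H)%:E = \sum_(i | Q i) P (F i))%E.
  by apply: eq_bigr => i _; have [_ ->] := class_event (xi i) (MH i).
elim: (index_enum I) => [|i s IH]; first by rewrite !big_nil measure0.
rewrite !big_cons; case: ifP => // _.
apply: (le_trans (measureU2 _ _ _)) => //; first exact: bigsetU_measurable.
by rewrite leeD2l.
Qed.

Lemma nub_mono z r r' : 0 <= r -> r <= r' -> nub z r <= nub z r'.
Proof.
move=> r0 rr; rewrite -lee_fin -!nubE ?(le_trans r0) //.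
apply: le_measure; rewrite ?inE; [exact: ball_measurable|exact/ball_measurable/(le_trans r0)|].
by move=> w /= /le_trans; apply.
Qed.
End Probability.


(** * Approximate cubes *)

Section SortingPermutation.
Variables (d : nat).
Implicit Types (f : 'I_d -> nat) (s : {perm 'I_d}).

Definition descending f s := forall k1 k2 : 'I_d, (k2 : nat) = k1.+1 ->
  (f (s k2) <= f (s k1))%N /\ (f (s k2) = f (s k1) -> (s k1 < s k2)%N).

Lemma descending_ex f : exists s, descending f s.
Proof.
pose r (c c' : 'I_d) := (f c' < f c)%N || ((f c == f c') && (c <= c')%N).
have r_tot : total r.
  move=> c c'; rewrite /r; case: (ltngtP (f c) (f c')) => //= _.
  exact: leq_total.
have r_tr : transitive r.
  move=> y x z; rewrite /r => /orP[h1|/andP[/eqP e1 l1]] /orP[h2|/andP[/eqP e2 l2]].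
  - by rewrite (ltn_trans h2 h1).
  - by rewrite -e2 h1.
  - by rewrite e1 h2.
  - by rewrite e1 e2 eqxx (leq_trans l1 l2) orbT.
pose q := sort r (enum 'I_d).
have szq : size q = d by rewrite size_sort size_enum_ord.
have uq : uniq q by rewrite sort_uniq enum_uniq.
have sq : sorted r q by exact: sort_sorted.
pose g (k : 'I_d) : 'I_d := nth k q k.
have ginj : injective g.
  move=> k k' /eqP; rewrite /g (set_nth_default k') ?szq //.
  by rewrite nth_uniq ?szq // => /eqP/val_inj.
exists (perm ginj) => k1 k2 k12; rewrite !permE.
have h : r (g k1) (g k2).
  rewrite /g (set_nth_default k1 k2) ?szq // k12.
  apply: (sorted_ltn_nth r_tr k1 sq); rewrite ?inE ?szq //.
  by rewrite -k12.
split.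
  by move: h; rewrite /r => /orP[/ltnW //|/andP[/eqP ->]].
move=> e; move: h; rewrite /r e ltnn eqxx /= leq_eqVlt => /orP[/eqP/val_inj/ginj e'|//].
by move: k12; rewrite e' => /n_Sn.
Qed.

Lemma descending_le f s : (forall k1 k2 : 'I_d, (k2 : nat) = k1.+1 -> (f (s k2) <= f (s k1))%N) ->
  forall k1 k2 : 'I_d, (k1 <= k2)%N -> (f (s k2) <= f (s k1))%N.
Proof.
move=> h k1 [m md] /=; elim: m md => [|m IH] md.
  by rewrite leqn0 => /eqP e; rewrite (_ : Ordinal md = k1) //; exact/val_inj.
rewrite leq_eqVlt => /orP[/eqP e|km]; first by rewrite (_ : Ordinal md = k1) //; exact/val_inj.
by apply: leq_trans (IH (ltnW md) km); exact: h.
Qed.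

(** When cutoffs decrease along [s], the coordinates still prescribed at a level form an initial
    segment of the ordering. This is what makes the SPPC applicable at every level. *)
Lemma Jm_Eset f s l :
  (forall k1 k2 : 'I_d, (k2 : nat) = k1.+1 -> (f (s k2) <= f (s k1))%N) ->
  exists2 n, (n <= d)%N & Jm f l = Eset s n.
Proof.
move=> /descending_le h.
exists (\max_(k : 'I_d | (l < f (s k))%N) k.+1)%N; first by apply/bigmax_leqP => k _; exact: ltn_ord.
apply/setP => c; rewrite -(permKV s c) in_Eset inE; set k := (s^-1)%g c.
apply/idP/idP => [lk|].
  exact: (@leq_bigmax_cond _ (fun k : 'I_d => (l < f (s k))%N) (fun k => k.+1) k).
have [[k0 k0P]|nk] := pselect (exists k, (l < f (s k))%N).
  have [k' k'P ->] := @eq_bigmax_cond _ (fun k : 'I_d => (l < f (s k))%N) (fun k => k.+1) (ltac:(by apply/card_gt0P; exists k0)).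
  by rewrite ltnS => /h; exact: leq_trans k'P.
by rewrite big1 // => k' lk'; case: nk; exists k'.
Qed.
End SortingPermutation.

Section Cutoffs.
Variables (R : realType) (d N : nat) (S : sponge R d N).
Local Notation a := (sa S).
Local Notation t := (st S).
Local Notation mu := (smu S).
Implicit Types (x y : Sigma N) (c : 'I_d) (M : 'I_d -> nat) (delta : R) (i j : 'I_N) (J : {set 'I_d}).

(* A bound for every [L_delta(x, c)]. *)
Definition Hb delta : nat := (Num.truncn (ln delta / ln (lmax S))).+1.

Lemma ln_lmax_lt0 : ln (lmax S) < 0.
Proof. by rewrite ln_lt0 // lmax_gt0 lmax_lt1. Qed.

Lemma lmax_Hb delta : 0 < delta -> lmax S ^+ Hb delta <= delta.
Proof.
move=> d0; rewrite -ler_ln ?posrE ?exprn_gt0 ?lmax_gt0 // lnXn ?lmax_gt0 //.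
rewrite -mulr_natr mulrC -ler_ndivrMr ?ln_lmax_lt0 //.
exact/ltW/truncnS_gt.
Qed.

Lemma ls_lt x k k' c : (k < k')%N -> ls S x k' c < ls S x k c.
Proof.
move=> kk; rewrite -(subnKC kk) addSnnS ls_add gtr_pMr ?ls_gt0 //.
rewrite lsS mulrC (le_lt_trans (ler_piMr _ _)) ?lam_lt1 ?(ltW (lam_gt0 _ _ _)) //.
by rewrite (le_trans (ls_le _ _ _ _)) // exprn_ile1 // ltW ?lmax_lt1 ?lmax_gt0.
Qed.

Lemma Lprop_ex x delta c : 0 < delta < 1 -> exists L, Lprop a x delta c L.
Proof.
move=> /andP[d0 d1].
have ex : exists k, ls S x k c <= delta.
  by exists (Hb delta); rewrite (le_trans (ls_le _ _ _ _)) ?lmax_Hb.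
case: (ex_minnP ex) => L Ld Lm; exists L.
have L0 : (0 < L)%N.
  by case: L Ld {Lm} => //; rewrite /ls big_ord0 leNgt d1.
split=> //; apply/andP; split=> //.
rewrite ltNge; apply/negP => /Lm; by rewrite leqNgt ltn_predL L0.
Qed.

Lemma Lprop_uniq x delta c L L' : Lprop a x delta c L -> Lprop a x delta c L' -> L = L'.
Proof.
suff wl n m : Lprop a x delta c n -> Lprop a x delta c m -> (n <= m)%N.
  by move=> h h'; apply/eqP; rewrite eqn_leq !wl.
move=> [n0 /andP[_ h]] [m0 /andP[h' _]]; rewrite leqNgt; apply/negP => mn.
have := lt_le_trans h (le_refl _); rewrite ltNge => /negP; apply.
apply: le_trans h'; have [->//|mn'] := eqVneq m n.-1.
by rewrite ltW // ls_lt // ltn_neqAle mn' -ltnS prednK.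
Qed.

(* [L_delta(x, c)]. *)
Definition Lf delta x c : nat := xget 0%N [set L | Lprop a x delta c L].

Lemma LfP delta x c : 0 < delta < 1 -> Lprop a x delta c (Lf delta x c).
Proof. by move=> /(Lprop_ex x c)[L h]; rewrite /Lf; case: xgetP => // /(_ L). Qed.

Lemma Lf_le_Hb delta x c : 0 < delta < 1 -> (Lf delta x c <= Hb delta)%N.
Proof.
move=> d01; have [L0 /andP[_ h]] := LfP x c d01.
have /andP[d0 d1] := d01.
have := lt_le_trans h (ls_le S x _ c).
rewrite -ltr_ln ?posrE ?exprn_gt0 ?lmax_gt0 // lnXn ?lmax_gt0 // -mulr_natr mulrC.
rewrite -ltr_ndivlMr ?ln_lmax_lt0 // => /ltW h'.
rewrite -(prednK L0) /Hb ltnS truncn_ge_nat //.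
exact: le_trans h'.
Qed.

Lemma ls_Lf delta x c : 0 < delta < 1 ->
  lmin S * delta <= ls S x (Lf delta x c) c <= delta.
Proof.
move=> d01; have [L0 /andP[h1 h2]] := LfP x c d01; rewrite h1 andbT.
rewrite -(prednK L0) lsS mulrC ler_pM ?lam_ge ?(ltW (lmin_gt0 S)) ?(ltW h2) //.
by case/andP: d01 => /ltW.
Qed.

Lemma eqM_ls M x y c k : eqM S M x y -> (k <= M c)%N -> ls S x k c = ls S y k c.
Proof.
move=> xy kM; rewrite -!norm_al; congr `|_|.
by have [] := @prefix_eq _ _ _ S M x y c k (fun l _ => xy l) kM.
Qed.

Lemma eqM_Lf delta x y : 0 < delta < 1 -> eqM S (Lf delta x) x y -> Lf delta y = Lf delta x.
Proof.
move=> d01 xy; apply/funext => c; apply: (@Lprop_uniq y delta c); first exact: LfP.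
have [L0 h] := LfP x c d01; split=> //; move: h.
by rewrite -!/(ls S _ _ _) !(eqM_ls xy) // leq_pred.
Qed.

Lemma Aset_Lf delta x : 0 < delta < 1 -> exists2 s, Aset a s & descending (Lf delta x) s.
Proof.
move=> d01; have [s sP] := descending_ex (Lf delta x); exists s => //.
exists x, delta; split=> //; exists (Lf delta x); split=> // c; exact: LfP.
Qed.

Lemma goodM_Lf delta x : 0 < delta < 1 -> goodM S (Lf delta x).
Proof.
move=> d01 l; have [s As sP] := Aset_Lf x d01.
have [n nd ->] := @Jm_Eset d (Lf delta x) s l (fun k1 k2 e => (sP k1 k2 e).1).
have [->|n0] := posnP n; last by apply: sepJ_Eset; rewrite ?n0.
rewrite (_ : Eset s 0 = finset.set0); first exact: sepJ0.
by apply/setP => c; rewrite -(permKV s c) in_Eset inE.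
Qed.

Definition rep J i : 'I_N := [arg min_(k < i | eqJ S J i k) (k : nat)].

Lemma repP J i : eqJ S J i (rep J i) /\ forall k, eqJ S J i k -> (rep J i <= k)%N.
Proof. by rewrite /rep; case: arg_minnP; rewrite ?eqJ_refl. Qed.

Lemma eq_rep J i j : eqJ S J i j -> rep J i = rep J j.
Proof.
move=> ij; have [h1 h2] := repP J i; have [h3 h4] := repP J j.
apply/val_inj/eqP; rewrite eqn_leq /= h2 ?h4 //; first by rewrite -(eqJ_left _ ij).
by rewrite (eqJ_left _ ij).
Qed.

Definition ext H (v : {ffun 'I_H -> 'I_N}) : Sigma N :=
  fun l => if insub l is Some k then v k else si0 S.

Lemma extE H (v : {ffun 'I_H -> 'I_N}) l (lH : (l < H)%N) : ext v l = v (Ordinal lH).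
Proof. by rewrite /ext insubT. Qed.

(* A canonical word for the approximate cube of [x]. *)
Definition canw delta x : {ffun 'I_(Hb delta) -> 'I_N} :=
  [ffun l : 'I_(Hb delta) => rep (Jm (Lf delta x) l) (x l)].

Lemma canw_eqM delta x : 0 < delta < 1 -> eqM S (Lf delta x) x (ext (canw delta x)).
Proof.
move=> d01 l; have [lH|Hl] := ltnP l (Hb delta).
  by rewrite (extE _ lH) ffunE; have [] := repP (Jm (Lf delta x) l) (x l).
apply/eqJP => c; rewrite inE => lM.
by have := leq_trans lM (Lf_le_Hb x c d01); rewrite ltnNge Hl.
Qed.

Lemma canw_Lf delta x : 0 < delta < 1 -> Lf delta (ext (canw delta x)) = Lf delta x.
Proof. by move=> d01; apply: eqM_Lf => //; exact: canw_eqM. Qed.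

Lemma canw_eq delta x y : 0 < delta < 1 -> eqM S (Lf delta x) x y -> canw delta x = canw delta y.
Proof.
move=> d01 xy; apply/ffunP => l; rewrite !ffunE (eqM_Lf d01 xy); exact: eq_rep.
Qed.

(** The fixed points of [canw] form a finite index set containing exactly one word for each
    approximate cube of size [delta]. *)
Definition iscan delta v := canw delta (ext v) == v.

Lemma iscan_canw delta x : 0 < delta < 1 -> iscan (canw delta x).
Proof. by move=> d01; rewrite /iscan -(canw_eq d01 (canw_eqM x d01)). Qed.

(* The measure of the approximate cube of size [delta] around [x]. *)
Definition mm delta x : R := mass S (Lf delta x) x (Hb delta).

Lemma mm_gt0 delta x : 0 < mm delta x.
Proof. exact: mass_gt0. Qed.

Lemma mm_canw delta x : 0 < delta < 1 -> mm delta (ext (canw delta x)) = mm delta x.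
Proof.
by move=> d01; rewrite /mm canw_Lf // -(eq_mass _ (canw_eqM x d01)).
Qed.

Lemma iscan_neq delta v v' : 0 < delta < 1 -> iscan (delta := delta) v -> iscan (delta := delta) v' ->
  v != v' -> ~ eqM S (Lf delta (ext v)) (ext v) (ext v').
Proof.
by move=> d01 /eqP cv /eqP cv' vv /(canw_eq d01) e; move: vv; rewrite -cv -cv' e eqxx.
Qed.

Definition Zt delta (q : R) : R := \sum_(v | iscan (delta := delta) v) mm delta (ext v) `^ q.

Definition ctr delta x c : R := bt S x (Lf delta x c) c + al S x (Lf delta x c) c / 2.

(** Otherwise the centre of the cuboid of [y] would lie in the open interval spanned by the cuboid
    of [x] on the axis where the two words separate. *)
Lemma ctr_sep delta x y : 0 < delta < 1 -> ~ eqM S (Lf delta x) x y ->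
  exists c, lmin S * delta / 2 <= `|ctr delta x c - ctr delta y c|.
Proof.
move=> d01 nxy; have [c [l [lM e] h]] := separation (goodM_Lf x d01) nxy.
(* The cutoffs of [y] may differ from those of [x], but the two words have the same size along [c]
   at level [l], and this size still exceeds [delta]. *)
have lM' : (l < Lf delta y c)%N.
  have [L0 /andP[_ h1]] := LfP x c d01; have [L0' /andP[h2' _]] := LfP y c d01.
  rewrite ltnNge; apply/negP => yl.
  have : delta < ls S y l c.
    have -> : ls S y l c = ls S x l c by rewrite -!norm_al e.
    apply: (lt_le_trans h1); have [->//|ll] := eqVneq l (Lf delta x c).-1.
    by rewrite ltW // ls_lt // ltn_neqAle ll -ltnS prednK.
  rewrite ltNge => /negP; apply; apply: le_trans h2'.
  by move: yl; rewrite leq_eqVlt => /orP[/eqP ->//|yl]; rewrite ltW // ls_lt.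
exists c; rewrite leNgt; apply/negP => lt.
have /andP[ls1 _] := ls_Lf x c d01.
set L := Lf delta x c in lM lt ls1; set L' := Lf delta y c in lM' lt.
have A0 := al_neq0 S x L c.
(* The position of the centre of [y] relative to the cuboid of [x]; the centre of [x] has position
   1/2. *)
pose u := (ctr delta y c - bt S x L c) / al S x L c.
have u01 : 0 < u < 1.
  have : `|u - 1 / 2| < 1 / 2.
    have -> : u - 1 / 2 = - (ctr delta x c - ctr delta y c) / al S x L c.
      by rewrite /u /ctr -/L; field.
    rewrite normrM normrN normfV norm_al ltr_pdivrMr ?ls_gt0 //.
    by apply: (lt_le_trans lt); lra.
  rewrite ltr_norml; lra.
have half01 : 0 <= (1 / 2 : R) <= 1 by lra.
set m := (L - l.+1)%N; set m' := (L' - l.+1)%N.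
have eL : L = (l.+1 + m)%N by rewrite subnKC.
have eL' : L' = (l.+1 + m')%N by rewrite subnKC.
have /h : 0 < bt S (shiftS l.+1 x) m c + al S (shiftS l.+1 x) m c * u < 1 by exact: affine_open.
move=> /(_ (bt S (shiftS l.+1 y) m' c + al S (shiftS l.+1 y) m' c * (1 / 2))).
case; first exact: affine_unit.
rewrite !mulrDr !addrA !mulrA -!bt_add -!al_add -eL -eL'.
by rewrite /u /ctr -/L'; field.
Qed.

Lemma ctr_close delta x y c : 0 < delta < 1 -> eqM S (Lf delta x) x y ->
  `|coding a t y c - ctr delta x c| <= delta.
Proof.
move=> d01 xy; rewrite (coding_shift S y (Lf delta x c)).
have [<- <-] := @prefix_eq _ _ _ S (Lf delta x) x y c (Lf delta x c) (fun l _ => xy l) (leqnn _).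
have /andP[_ h] := ls_Lf x c d01.
set z := coding a t _ c; have : 0 <= z <= 1 by exact: coding_unit.
move=> /andP[z0 z1]; rewrite /ctr.
have -> : bt S x (Lf delta x c) c + al S x (Lf delta x c) c * z
   - (bt S x (Lf delta x c) c + al S x (Lf delta x c) c / 2) =
   al S x (Lf delta x c) c * (z - 1 / 2) by field.
rewrite normrM norm_al; apply: le_trans h.
rewrite ler_piMr ?(ltW (ls_gt0 _ _ _ _)) // ler_norml; lra.
Qed.
End Cutoffs.

(* Rounding the points to a grid of mesh [eta] is injective. *)
Lemma packing (R : realType) (d : nat) (I : finType) (A : pred I) (p : I -> 'I_d -> R)
    (z : 'I_d -> R) (eta rho : R) : 0 < eta ->
  (forall i c, A i -> `|p i c - z c| <= rho) ->
  (forall i j, A i -> A j -> i != j -> exists c, eta <= `|p i c - p j c|) ->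
  (#|A| <= (Num.truncn (2 * rho / eta)).+1 ^ d)%N.
Proof.
move=> eta0 near sep; set K := Num.truncn _.
pose g i c := Num.truncn ((p i c - z c + rho) / eta).
have g0 i c : A i -> 0 <= (p i c - z c + rho) / eta.
  by move=> Ai; rewrite divr_ge0 ?(ltW eta0) //; have := near i c Ai; rewrite ler_norml; lra.
have gK i c : A i -> (g i c < K.+1)%N.
  move=> Ai; rewrite ltnS le_truncn // ler_pM2r ?invr_gt0 //.
  have := near i c Ai; rewrite ler_norml; lra.
pose f i : {ffun 'I_d -> 'I_K.+1} := [ffun c => inord (g i c)].
have finj : {in A &, injective f}.
  move=> i j Ai Aj fij; apply/eqP; apply: contraT => ij.
  have [c] := sep i j Ai Aj ij.
  have : g i c = g j c.
    have := congr1 (fun h : {ffun 'I_d -> 'I_K.+1} => val (h c)) fij.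
    by rewrite /= !ffunE !inordK // gK.
  rewrite /g => e; have := truncn_itv (g0 i c Ai); have := truncn_itv (g0 j c Aj).
  rewrite -e -natr1; set n := (Num.truncn _)%:R => /andP[h1 h2] /andP[h3 h4].
  rewrite leNgt => /negP[]; rewrite ltr_norml; move: h1 h2 h3 h4.
  rewrite !ler_pdivlMr // !ltr_pdivrMr // => *; nra.
rewrite -(card_in_image finj) (leq_trans (max_card _)) // card_ffun !card_ord //.
Qed.


(** Comparing with [C] times the largest term treats [q < 1] and [q > 1] alike. *)
Lemma powR_sum_le (R : realType) (I : finType) (V : pred I) (m : I -> R) (C : nat) (q : R) (i0 : I) :
  V i0 -> (#|V| <= C)%N -> (forall i, 0 <= m i) -> 0 <= q ->
  (\sum_(i | V i) m i) `^ q <= C%:R `^ q * \sum_(i | V i) m i `^ q.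
Proof.
move=> Vi0 VC m0 q0.
have [i1 Vi1 max1] : exists2 i1, V i1 & forall i, V i -> m i <= m i1.
  by case: (@arg_maxP _ _ _ i0 V m Vi0) => i1 Vi1 h; exists i1.
apply: (@le_trans _ _ ((C%:R * m i1) `^ q)).
  apply: ge0_ler_powR => //; rewrite ?nnegrE ?mulr_ge0 ?sumr_ge0 //.
  apply: (@le_trans _ _ (\sum_(i | V i) m i1)); first exact: ler_sum.
  by rewrite sumr_const -[_ *+ #|_|]mulr_natl ler_wpM2r // ler_nat.
rewrite powRM // ler_wpM2l ?powR_ge0 // (bigD1 i1) //= lerDl sumr_ge0 // => i _.
exact: powR_ge0.
Qed.

Lemma ler_npowR (R : realType) (q x y : R) : q <= 0 -> 0 < x -> x <= y -> y `^ q <= x `^ q.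
Proof.
move=> q0 x0 xy; have y0 := lt_le_trans x0 xy.
have : x `^ (- q) <= y `^ (- q) by apply: ge0_ler_powR; rewrite ?nnegrE ?oppr_ge0 // ltW.
by rewrite !powRN lef_pV2 ?posrE ?powR_gt0.
Qed.

(** * Upper bound for the moment sums *)

Section UpperBound.
Variables (R : realType) (d N : nat) (S : sponge R d N).
Variables (dm : measure_display) (T : measurableType dm) (P : probability T R).
Variables (X : T -> Sigma N).
Hypothesis XP : iid_law (smu S) P X.
Local Notation a := (sa S).
Local Notation t := (st S).
Local Notation mu := (smu S).
Local Notation nub := (nub S P X).
Implicit Types (x y : Sigma N) (c : 'I_d) (delta q : R).

Definition nuX : set ('I_d -> R) -> \bar R := fun A => P ((coding a t \o X) @^-1` A).

Lemma d_gt0 : (0 < d)%N.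
Proof. exact: leq_ltn_trans (leq0n _) (ltn_ord (sc0 S)). Qed.

Lemma dR_ge1 : 1 <= d%:R :> R.
Proof. by rewrite ler1n d_gt0. Qed.

Lemma msupp_coding z r : msupp nuX z -> 0 < r -> exists y, cballE z r (coding a t y).
Proof.
move=> sz r0; have := sz r r0; rewrite /nuX => h.
have [[w wP]|nw] := pselect (exists w, cballE z r (coding a t (X w))); first by exists (X w).
move: h; rewrite (_ : _ @^-1` _ = set0) ?measure0 ?ltxx //.
by apply/seteqP; split=> // w wP; case: nw; exists w.
Qed.

Lemma msupp_nub z r : msupp nuX z -> 0 < r -> 0 < nub z r.
Proof. by move=> sz r0; have := sz r r0; rewrite /nuX nubE ?ltW // lte_fin. Qed.

Definition ball_family delta k (xs : 'I_k -> 'I_d -> R) :=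
  (forall j, msupp nuX (xs j)) /\
  (forall j1 j2, j1 != j2 -> cballE (xs j1) delta `&` cballE (xs j2) delta = set0).

(* Bounds from [packing]: how many approximate cubes of size [fine_scale delta] meet a ball of radius
   [delta], and how many disjoint balls of radius [delta] meet such a cube. *)
Definition cubes_per_ball : nat := ((Num.truncn (16 * d%:R / lmin S)).+1 ^ d)%N.
Definition balls_per_cube : nat := ((Num.truncn (4 * d%:R : R)).+1 ^ d)%N.
Definition CT q : R := cubes_per_ball%:R `^ q * balls_per_cube%:R + 1.
Definition fine_scale delta : R := delta / (2 * d%:R).

Lemma fin01 delta : 0 < delta < 1 -> 0 < fine_scale delta < 1.
Proof.
have d1 := dR_ge1; move=> /andP[d0 dl1]; rewrite /fine_scale divr_gt0 ?mulr_gt0 ?(lt_le_trans _ d1) //=.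
rewrite ltr_pdivrMr ?mulr_gt0 ?(lt_le_trans _ d1) //; lra.
Qed.

Lemma fin_le delta : 0 < delta -> 2 * fine_scale delta <= delta / d%:R.
Proof.
move=> d0; have d1 := dR_ge1; rewrite /fine_scale le_eqVlt; apply/orP; left; apply/eqP.
by field; rewrite gt_eqF ?(lt_le_trans _ d1).
Qed.

Lemma divd_le delta : 0 < delta -> delta / d%:R <= delta.
Proof.
move=> d0; have d1 := dR_ge1.
by rewrite ler_pdivrMr ?(lt_le_trans _ d1) // ler_peMr // ltW.
Qed.

(** Each ball is covered by boundedly many approximate cubes, and each cube meets boundedly many of
    the disjoint balls; double counting gives the constant. *)
Lemma T_sum_le_pos delta k (xs : 'I_k -> 'I_d -> R) q : 0 < delta < 1 -> 0 <= q ->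
  ball_family delta xs ->
  \sum_j nub (xs j) delta `^ q <= cubes_per_ball%:R `^ q * balls_per_cube%:R * Zt S (fine_scale delta) q.
Proof.
move=> d01 q0 [sxs dis]; have f01 := fin01 d01; have /andP[d0 d1] := d01.
have dR1 := dR_ge1; have dR0 : 0 < d%:R :> R by exact: lt_le_trans dR1.
have /andP[f0 f1] := f01; have fle := fin_le d0; have dle := divd_le d0.
pose V j v := @iscan R d N S (fine_scale delta) v && `[< exists2 y, cballE (xs j) delta (coding a t y) &
    eqM S (Lf S (fine_scale delta) (ext S v)) (ext S v) y >].
have Vnear j v c : V j v -> `|ctr S (fine_scale delta) (ext S v) c - xs j c| <= 2 * delta.
  move=> /andP[_ /asboolP[y yb ey]].
  have h1 := ctr_close c f01 ey; have h2 := le_trans (eucl_coord (xs j) (coding a t y) c) yb.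
  move: h1 h2; rewrite !ler_norml => *; lra.
have Vcov j y : cballE (xs j) delta (coding a t y) -> V j (canw S (fine_scale delta) y).
  move=> yb; rewrite /V iscan_canw //=; apply/asboolP; exists y => //.
  rewrite canw_Lf // => l; rewrite eqJ_sym; exact: canw_eqM.
have Vcard j : (#|V j| <= cubes_per_ball)%N.
  have := @packing R d _ (V j) (fun v => ctr S (fine_scale delta) (ext S v)) (xs j)
    (lmin S * fine_scale delta / 2) (2 * delta).
  rewrite (_ : 2 * (2 * delta) / (lmin S * fine_scale delta / 2) = 16 * d%:R / lmin S); last first.
    by rewrite /fine_scale; field; rewrite !gt_eqF // ?(lmin_gt0 S).
  apply; first by rewrite divr_gt0 // mulr_gt0 // (lmin_gt0 S).
  - by move=> v c; exact: Vnear.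
  - move=> v v' /andP[cv _] /andP[cv' _] vv'; apply: ctr_sep => //; exact: iscan_neq.
(* Centres of disjoint balls are more than [delta] apart, hence differ by at least [delta / d] in
   some coordinate. *)
have Jcard v : (#|[pred j | V j v]| <= balls_per_cube)%N.
  have := @packing R d _ [pred j | V j v] xs (ctr S (fine_scale delta) (ext S v)) (delta / d%:R) (2 * delta).
  rewrite (_ : 2 * (2 * delta) / (delta / d%:R) = 4 * d%:R); last by field; rewrite !gt_eqF.
  apply; first by rewrite divr_gt0.
  - by move=> j c /= Vj; rewrite distrC; exact: Vnear.
  - move=> j j' _ _ jj'; apply: contrapT => nc.
    have : (cballE (xs j) delta `&` cballE (xs j') delta) (xs j').
      split; last by apply: eucl_xx; exact: ltW.
      apply: ltW; apply: eucl_lt; last exact: d_gt0.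
      by move=> c; rewrite ltNge; apply/negP => h; apply: nc; exists c.
    by rewrite dis.
have step j : nub (xs j) delta `^ q <= cubes_per_ball%:R `^ q * \sum_(v | V j v) mm S (fine_scale delta) (ext S v) `^ q.
  have [y yb] := msupp_coding (sxs j) d0.
  apply: le_trans (@powR_sum_le _ _ (V j) (fun v => mm S (fine_scale delta) (ext S v)) cubes_per_ball q
    (canw S (fine_scale delta) y) (Vcov j y yb) (Vcard j) (fun v => ltW (mm_gt0 _ _ _)) q0).
  apply: ge0_ler_powR; rewrite ?nnegrE ?nub_ge0 //.
    by apply: sumr_ge0 => v _; exact/ltW/mm_gt0.
  apply: nub_le_sum => //; first exact: ltW.
    by move=> v c; exact: Lf_le_Hb.
  move=> y' y'b; exists (canw S (fine_scale delta) y'); first exact: Vcov.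
  by rewrite canw_Lf // => l; rewrite eqJ_sym; exact: canw_eqM.
apply: (@le_trans _ _ (\sum_j cubes_per_ball%:R `^ q * \sum_(v | V j v) mm S (fine_scale delta) (ext S v) `^ q)).
  exact: ler_sum.
rewrite -mulr_sumr -mulrA ler_wpM2l ?powR_ge0 //.
rewrite (exchange_big_dep (fun v => @iscan R d N S (fine_scale delta) v)) /=; last by move=> j v _ /andP[].
rewrite /Zt mulr_sumr; apply: ler_sum => v cv.
by rewrite sumr_const -[_ *+ #|_|]mulr_natl ler_wpM2r ?powR_ge0 // ler_nat; exact: Jcard.
Qed.

(** For [q <= 0] small measures dominate. The scale [fine_scale] is so fine that every ball contains
    a whole approximate cube, and disjoint balls contain different cubes. *)
Lemma T_sum_le_neg delta k (xs : 'I_k -> 'I_d -> R) q : 0 < delta < 1 -> q <= 0 ->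
  ball_family delta xs ->
  \sum_j nub (xs j) delta `^ q <= Zt S (fine_scale delta) q.
Proof.
move=> d01 q0 [sxs dis]; have f01 := fin01 d01; have /andP[d0 d1] := d01.
have /andP[f0 f1] := f01; have fle := fin_le d0.
have [y yP] := choice (fun j => msupp_coding (sxs j) f0).
pose v j := canw S (fine_scale delta) (y j).
have cl j y' : eqM S (Lf S (fine_scale delta) (y j)) (y j) y' -> cballE (xs j) delta (coding a t y').
  move=> e; apply: eucl_le; last exact: d_gt0.
  move=> c; apply: le_trans fle.
  have h1 := le_trans (eucl_coord (xs j) (coding a t (y j)) c) (yP j).
  have h2 := coding_close c e; have /andP[_ h3] := ls_Lf S (y j) c f01.
  move: h1 (le_trans h2 h3); rewrite !ler_norml => *; lra.
have vinj : injective v.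
  move=> j j' vv; apply/eqP; apply: contraT => jj'.
  have : (cballE (xs j) delta `&` cballE (xs j') delta) (coding a t (y j')).
    split; apply: cl; last by move=> l; exact: eqJ_refl.
    move=> l; apply: eqJ_trans (canw_eqM S (y j) f01 l) _.
    rewrite -(canw_Lf S (y j) f01) -/(v j) vv canw_Lf // eqJ_sym.
    exact: (canw_eqM S (y j') f01 l).
  by rewrite dis.
apply: (@le_trans _ _ (\sum_j mm S (fine_scale delta) (ext S (v j)) `^ q)).
  apply: ler_sum => j _; apply: ler_npowR => //; first exact: mm_gt0.
  rewrite mm_canw //; apply: nub_ge_mass => //; first exact: ltW.
    by move=> c; exact: Lf_le_Hb.
  exact: cl.
rewrite (_ : \sum_j _ = \sum_(j in [set: 'I_k]%SET) mm S (fine_scale delta) (ext S (v j)) `^ q); last first.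
  by apply: eq_bigl => j; rewrite inE.
rewrite -(big_imset (fun w => mm S (fine_scale delta) (ext S w) `^ q) (h := v)) /=; last first.
  by move=> ? ? _ _; exact: vinj.
rewrite /Zt [leRHS](bigID (fun w => w \in [set v j | j in [set: 'I_k]%SET]%SET)) /=.
apply: ler_wpDr; first by apply: sumr_ge0 => w _; exact: powR_ge0.
rewrite le_eqVlt; apply/orP; left; apply/eqP; apply: eq_bigl => w.
by apply/idP/idP => [/imsetP[j _ ->]|/andP[]//]; rewrite iscan_canw // imset_f ?inE.
Qed.

Lemma CT_ge1 q : 1 <= CT q.
Proof. by rewrite /CT lerDr mulr_ge0 ?powR_ge0. Qed.

Lemma Zt_ge0 delta q : 0 <= Zt S delta q.
Proof. by apply: sumr_ge0 => v _; exact: powR_ge0. Qed.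

Lemma T_sum_le delta k (xs : 'I_k -> 'I_d -> R) q : 0 < delta < 1 ->
  ball_family delta xs ->
  \sum_j nub (xs j) delta `^ q <= CT q * Zt S (fine_scale delta) q.
Proof.
move=> d01 bf; have Z0 := Zt_ge0 (fine_scale delta) q.
have [q0|q0] := leP 0 q.
  apply: le_trans (T_sum_le_pos d01 q0 bf) _; rewrite ler_wpM2r //.
  by rewrite /CT lerDl.
(* The summand 1 of [CT] covers this case, where the comparison constant is 1. *)
apply: le_trans (T_sum_le_neg d01 (ltW q0) bf) _; rewrite ler_peMl //; exact: CT_ge1.
Qed.

Lemma Tdelta_ub delta q : 0 < delta < 1 -> Tdelta nuX q delta <= CT q * Zt S (fine_scale delta) q.
Proof.
move=> d01; apply: ge_sup.
  by exists (\sum_(j < 0) 0); exists 0%N, (fun _ _ => 0); split; [case|split; [case|rewrite !big_ord0]].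
by move=> z [k [xs [h1 [h2 ->]]]]; exact: T_sum_le.
Qed.

Lemma Tdelta_lb delta q k (xs : 'I_k -> 'I_d -> R) : 0 < delta < 1 -> ball_family delta xs ->
  \sum_j nub (xs j) delta `^ q <= Tdelta nuX q delta.
Proof.
move=> d01 [h1 h2]; apply: ub_le_sup; last by exists k, xs.
exists (CT q * Zt S (fine_scale delta) q).
by move=> z [k' [xs' [h3 [h4 ->]]]]; exact: T_sum_le.
Qed.
End UpperBound.


Ltac clear_lra := clear; repeat match goal with H := _ |- _ => clearbody H end; intros; lra.

Lemma prod_block (R : realType) (m K r : nat) (G : nat -> R) :
  \prod_(l < m * (K + r)) G l =
  \prod_(l < m) ((\prod_(j < K) G (l * (K + r) + j)%N) *
                 \prod_(k < r) G (l * (K + r) + (K + k))%N).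
Proof.
elim: m => [|m IH]; first by rewrite !big_ord0.
by rewrite big_ord_recr /= -IH mulSnr !big_split_ord.
Qed.

Lemma powR_prod (R : realType) (I : finType) (m : I -> R) (q : R) : (forall i, 0 <= m i) ->
  \prod_i (m i `^ q) = (\prod_i m i) `^ q.
Proof.
move=> m0; have [//] : \prod_i (m i `^ q) = (\prod_i m i) `^ q /\ 0 <= \prod_i m i.
elim/big_rec2 : _ => [|i x y _ [-> y0]]; first by rewrite powR1.
by rewrite powRM // mulr_ge0.
Qed.

(** * Lower bound for the moment sums *)

Section LowerBound.
Variables (R : realType) (d N : nat) (S : sponge R d N).
Variables (dm : measure_display) (T : measurableType dm) (P : probability T R).
Variables (X : T -> Sigma N).
Hypothesis XP : iid_law (smu S) P X.
Local Notation a := (sa S).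
Local Notation t := (st S).
Local Notation mu := (smu S).
Local Notation nub := (nub S P X).
Local Notation nuX := (nuX S P X).
Implicit Types (x y : Sigma N) (c : 'I_d) (delta q : R).

Lemma mass_widen M x H E : (forall c, M c <= H)%N -> mass S M x (H + E) = mass S M x H.
Proof.
move=> MH; rewrite /mass big_split_ord /= [X in _ * X]big1 ?mulr1 // => l _.
rewrite (_ : Jm M _ = finset.set0) ?muJ0 //; apply/setP => c; rewrite !inE.
by apply/negbTE; rewrite -leqNgt (leq_trans (MH c)) // leq_addr.
Qed.

Lemma coding_msupp x : msupp nuX (coding a t x).
Proof.
move=> r r0; rewrite /nuX nubE ?ltW // lte_fin.
pose e := Num.min (r / d%:R) (1 / 2).
have dR0 : 0 < d%:R :> R by exact: lt_le_trans (dR_ge1 S).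
have e01 : 0 < e < 1.
  rewrite lt_min gt_min divr_gt0 //= (_ : 1 / 2 < 1 :> R) ?orbT ?andbT; lra.
apply: lt_le_trans (mm_gt0 S e x) _; apply: nub_ge_mass => //; first exact: ltW.
  by move=> c; exact: Lf_le_Hb.
move=> y xy; apply: eucl_le; last exact: (d_gt0 S).
move=> c; apply: le_trans (coding_close c xy) _.
have /andP[_ h] := ls_Lf S x c e01; apply: (le_trans h); by rewrite ge_min lexx.
Qed.

Lemma Tdelta_lb_fin delta q (I : finType) (A : pred I) (p : I -> 'I_d -> R) : 0 < delta < 1 ->
  (forall i, A i -> msupp nuX (p i)) ->
  (forall i j, A i -> A j -> i != j -> cballE (p i) delta `&` cballE (p j) delta = set0) ->
  \sum_(i | A i) nub (p i) delta `^ q <= Tdelta nuX q delta.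
Proof.
move=> d01 sA dA.
have -> : \sum_(i | A i) nub (p i) delta `^ q =
    \sum_(j < #|A|) nub (p (enum_val j)) delta `^ q.
  by rewrite -(@big_enum_val _ _ _ _ A (fun i => nub (p i) delta `^ q)); apply: eq_bigl.
apply: Tdelta_lb => //; split=> [j|j1 j2 j12]; first by apply: sA; exact: (enum_valP j).
apply: dA; try exact: enum_valP.
by apply: contra_neq j12; exact: enum_val_inj.
Qed.

Section Interleaving.
Variables (K : nat) (W : Sigma N) (rho : R).
Hypothesis rho_gt0 : 0 < rho.
Hypothesis WP : forall y, (forall l, (l < K)%N -> y l = W l) ->
  forall c, rho <= coding a t y c <= 1 - rho.
Variables (delta0 : R) (M : 'I_d -> nat) (H : nat) (U : pred {ffun 'I_H -> 'I_N}).
Hypothesis delta0_01 : 0 < delta0 < 1.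
Hypothesis MH : forall c, (M c <= H)%N.
Hypothesis ULf : forall u, U u -> Lf S delta0 (ext S u) = M.
Hypothesis Uneq : forall u u', U u -> U u' -> u != u' -> ~ eqM S M (ext S u) (ext S u').
Variable r : nat.
Hypothesis r_gt0 : (0 < r)%N.
Local Notation h := (K + r)%N.
Implicit Types V : {ffun 'I_r -> {ffun 'I_H -> 'I_N}}.

(* Block number [l], of length [K + r], is the interior word followed by the [l]-th letters of the [r]
   words. With all cutoffs multiplied by [K + r], every cutoff is followed by the interior word, so
   that the coded point lies deep inside its cuboid, and the levels of the [r] words are aligned. *)
Definition inter (V : {ffun 'I_r -> {ffun 'I_H -> 'I_N}}) : Sigma N := fun l =>
  if (l %% h < K)%N then W (l %% h)%N else
  if insub (l %% h - K)%N is Some k then ext S (V k) (l %/ h)%N else si0 S.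

Definition Mh c : nat := (M c * h)%N.

Lemma h_gt0 : (0 < h)%N.
Proof. by rewrite addn_gt0 r_gt0 orbT. Qed.

Lemma inter_W V l j : (j < K)%N -> inter V (l * h + j)%N = W j.
Proof.
move=> jK; have jh : (j < h)%N by rewrite ltn_addr.
by rewrite /inter modnMDl modn_small // jK.
Qed.

Lemma inter_V V l (k : 'I_r) : inter V (l * h + (K + k))%N = ext S (V k) l.
Proof.
have kh : (K + k < h)%N by rewrite ltn_add2l.
rewrite /inter modnMDl modn_small // ltnNge leq_addr /= addKn valK.
by rewrite divnMDl ?h_gt0 // divn_small // addn0.
Qed.

Lemma Jm_Mh l : Jm Mh l = Jm M (l %/ h)%N.
Proof. by apply/setP => c; rewrite !inE /Mh ltn_divLR // h_gt0. Qed.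

Lemma Jm_Mh_block l j : (j < h)%N -> Jm Mh (l * h + j)%N = Jm M l.
Proof. by move=> jh; rewrite Jm_Mh divnMDl ?h_gt0 // divn_small // addn0. Qed.

Lemma ls_inter V c : ls S (inter V) (Mh c) c =
  ls S W K c ^+ M c * \prod_k ls S (ext S (V k)) (M c) c.
Proof.
rewrite /ls /Mh (prod_block (M c) K r (fun l => lam a (inter V l) c)) big_split /=; congr (_ * _).
  rewrite -[X in _ ^+ X]card_ord -prodr_const; apply: eq_bigr => l _.
  by apply: eq_bigr => j _; rewrite inter_W.
rewrite exchange_big; apply: eq_bigr => k _; apply: eq_bigr => l _.
by rewrite inter_V.
Qed.

Lemma mass_inter V : mass S Mh (inter V) (H * h) =
  (\prod_(l < H) \prod_(j < K) muJ S (Jm M l) (W j)) * \prod_k mass S M (ext S (V k)) H.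
Proof.
rewrite /mass (prod_block H K r (fun l => muJ S (Jm Mh l) (inter V l))) big_split /=; congr (_ * _).
  apply: eq_bigr => l _; apply: eq_bigr => j _.
  by rewrite inter_W // Jm_Mh_block // ltn_addr.
rewrite exchange_big; apply: eq_bigr => k _; apply: eq_bigr => l _.
by rewrite inter_V Jm_Mh_block // ltn_add2l.
Qed.

Lemma mass_inter_bounds V :
  mmin S ^+ (K * H) * \prod_k mass S M (ext S (V k)) H <= mass S Mh (inter V) (H * h)
  <= \prod_k mass S M (ext S (V k)) H.
Proof.
have P0 : 0 <= \prod_k mass S M (ext S (V k)) H.
  by apply: prodr_ge0 => k _; exact/ltW/mass_gt0.
rewrite mass_inter; apply/andP; split.
- rewrite ler_wpM2r // mulnC exprM exprAC -[X in _ ^+ X]card_ord -prodr_const.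
  apply: ler_prod => l _; rewrite exprn_ge0 ?(ltW (mmin_gt0 S)) //=.
  rewrite -[X in _ ^+ X]card_ord -prodr_const.
  by apply: ler_prod => j _; rewrite (ltW (mmin_gt0 S)) muJ_ge.
- rewrite ler_piMl //; apply: prodr_ile1 => l _.
  rewrite prodr_ge0 /= => [|j _]; last exact/ltW/muJ_gt0.
  by apply: prodr_ile1 => j _; rewrite muJ_le1 (ltW (muJ_gt0 _ _ _)).
Qed.

Definition Uf : pred {ffun 'I_r -> {ffun 'I_H -> 'I_N}} := mem (ffun_on U).

Lemma UfP V k : Uf V -> U (V k).
Proof. by move=> /ffun_onP/(_ k). Qed.

Lemma goodMh V : Uf V -> goodM S Mh.
Proof.
move=> /UfP-/(_ (Ordinal r_gt0)) Uu l; rewrite Jm_Mh -(ULf Uu); exact: goodM_Lf.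
Qed.

Lemma inter_neq V V' : Uf V -> Uf V' -> V != V' -> ~ eqM S Mh (inter V) (inter V').
Proof.
move=> UV UV' VV' e; have [k Vk] : exists k, V k != V' k.
  apply/existsP; apply: contraT; rewrite negb_exists => /forallP hk; case/negP: VV'.
  by apply/eqP/ffunP => k; apply/eqP; rewrite -[_ == _]negbK.
apply: (Uneq (UfP k UV) (UfP k UV') Vk) => l.
by have := e (l * h + (K + k))%N; rewrite !inter_V Jm_Mh_block // ltn_add2l.
Qed.

Lemma ls_inter_bounds V c : Uf V ->
  lmin S ^+ (K * H) * (lmin S * delta0) ^+ r <= ls S (inter V) (Mh c) c <= delta0 ^+ r.
Proof.
move=> UV; have /andP[d0 d1] := delta0_01; have l0 := lmin_gt0 S.
have b k : lmin S * delta0 <= ls S (ext S (V k)) (M c) c <= delta0.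
  by have := ls_Lf S (ext S (V k)) c delta0_01; rewrite (ULf (UfP k UV)).
have P0 : 0 <= \prod_k ls S (ext S (V k)) (M c) c.
  by apply: prodr_ge0 => k _; exact/ltW/ls_gt0.
rewrite ls_inter; apply/andP; split.
- apply: ler_pM; rewrite ?exprn_ge0 ?mulr_ge0 ?(ltW l0) ?(ltW d0) //.
  + rewrite exprM; apply: (@le_trans _ _ ((lmin S ^+ K) ^+ M c)).
      by rewrite ler_wiXn2l ?exprn_ge0 ?exprn_ile1 ?(ltW l0) ?(ltW (lmin_lt1 S)).
    by rewrite lerXn2r ?nnegrE ?exprn_ge0 ?(ltW l0) ?(ltW (ls_gt0 _ _ _ _)) ?ls_ge.
  + rewrite -[X in _ ^+ X <= _](card_ord r) -prodr_const; apply: ler_prod => k _.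
    by rewrite mulr_ge0 ?(ltW l0) ?(ltW d0) //; have /andP[] := b k.
- apply: (@le_trans _ _ (\prod_k ls S (ext S (V k)) (M c) c)).
    rewrite ler_piMl // exprn_ile1 ?(ltW (ls_gt0 _ _ _ _)) //.
    by rewrite (le_trans (ls_le _ _ _ _)) // exprn_ile1 // ltW ?lmax_lt1 ?lmax_gt0.
  rewrite -[X in _ <= _ ^+ X](card_ord r) -prodr_const; apply: ler_prod => k _.
  by rewrite (ltW (ls_gt0 _ _ _ _)); have /andP[] := b k.
Qed.

Variable delta : R.
Hypothesis delta_01 : 0 < delta < 1.
Hypothesis delta_small : delta < rho * (lmin S ^+ (K * H) * (lmin S * delta0) ^+ r).

Lemma ball_in_cuboid V p : Uf V -> cballE (coding a t (inter V)) delta p ->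
  forall c, exists2 u, 0 < u < 1 & p c = bt S (inter V) (Mh c) c + al S (inter V) (Mh c) c * u.
Proof.
move=> UV pb c; set x := inter V; set A := al S x (Mh c) c; set B := bt S x (Mh c) c.
have A0 : A != 0 by exact: al_neq0.
exists ((p c - B) / A); last by rewrite mulrC divfK // addrC subrK.
have /andP[ls1 _] := ls_inter_bounds c UV.
have cE := coding_shift S x (Mh c) c; rewrite -/A -/B in cE.
(* The cutoff [Mh c] is a multiple of the block length, so the remaining sequence begins with
   [W]. *)
have /andP[z0 z1] : rho <= coding a t (shiftS (Mh c) x) c <= 1 - rho.
  by apply: WP => l lK; rewrite /shiftS /x /Mh inter_W.
set z := coding a t (shiftS _ _) c in cE z0 z1.
have : `|(p c - B) / A - z| < rho.
  have -> : (p c - B) / A - z = - (coding a t x c - p c) / A by rewrite cE; field.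
  rewrite normrM normrN normfV norm_al ltr_pdivrMr ?ls_gt0 //.
  apply: (le_lt_trans (eucl_coord _ _ _)); apply: (le_lt_trans pb).
  apply: (lt_le_trans delta_small); rewrite ler_pM2l //.
rewrite ltr_norml; lra.
Qed.

Lemma nub_inter_le V : Uf V -> nub (coding a t (inter V)) delta <= \prod_k mass S M (ext S (V k)) H.
Proof.
move=> UV; have /andP[_ h2] := mass_inter_bounds V; apply: le_trans h2.
have /andP[d0 _] := delta_01.
apply: nub_le_mass => //; first exact: ltW.
  by move=> c; rewrite /Mh leq_mul2r MH orbT.
move=> y yb; apply: contrapT => ne.
apply: (cuboids_disjoint (goodMh UV) ne (ball_in_cuboid UV yb)) => c.
exact: coding_in_cuboid.
Qed.

(** Prescribing [E] more letters on every coordinate shrinks the cuboid until it fits into the ball;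
    [mass_ext] bounds the loss of measure. *)
Lemma nub_inter_ge V E : Uf V -> lmax S ^+ E * delta0 ^+ r <= delta / d%:R ->
  mmin S ^+ (d * E + K * H) * \prod_k mass S M (ext S (V k)) H <= nub (coding a t (inter V)) delta.
Proof.
move=> UV Esm; have /andP[h1 _] := mass_inter_bounds V; have /andP[d0 _] := delta_01.
have m0 := mmin_gt0 S.
pose M' c := (Mh c + E)%N.
have MhH c : (Mh c <= H * h)%N by rewrite /Mh leq_mul2r MH orbT.
have M'H c : (M' c <= H * h + E)%N by rewrite leq_add2r.
have /andP[h3 _] := @mass_ext R d N S Mh M' (inter V) (H * h + E) E
  (fun c => ltac:(by rewrite leq_addr leqnn)) M'H.
rewrite exprD -mulrA; apply: (@le_trans _ _ (mass S M' (inter V) (H * h + E))).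
  apply: le_trans h3; rewrite mass_widen // ler_wpM2l // exprn_ge0 // ltW //.
apply: nub_ge_mass => //; first exact: ltW.
move=> y xy; apply: eucl_le; last exact: (d_gt0 S).
move=> c; apply: (le_trans (coding_close c xy)); apply: le_trans Esm.
rewrite /M' ls_add mulrC ler_pM ?(ltW (ls_gt0 _ _ _ _)) ?ls_le //.
by have /andP[] := ls_inter_bounds c UV.
Qed.

(** The [r]-th power of the sum expands into a sum over all [r]-tuples of words, and each tuple
    provides one centre. The balls are disjoint because they stay in distinct open cuboids. The
    lower bound on their measure serves [q >= 0], the upper bound [q < 0]. *)
Lemma Tdelta_inter q E : lmax S ^+ E * delta0 ^+ r <= delta / d%:R ->
  (mmin S ^+ (d * E + K * H)) `^ `|q| * (\sum_(u | U u) mass S M (ext S u) H `^ q) ^+ r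
  <= Tdelta nuX q delta.
Proof.
move=> Esm; have /andP[d0 _] := delta_01; have m0 := mmin_gt0 S.
apply: (@le_trans _ _ (\sum_(V | Uf V) nub (coding a t (inter V)) delta `^ q)); last first.
  apply: Tdelta_lb_fin => // [V _|V V' UV UV' VV']; first exact: coding_msupp.
  apply/seteqP; split=> // p [pV pV'].
  apply: (cuboids_disjoint (goodMh UV) (inter_neq UV UV' VV') (ball_in_cuboid UV pV)) => c.
  have [u /andP[u0 u1] ->] := ball_in_cuboid UV' pV' c; exists u => //; by rewrite !ltW.
have -> : (\sum_(u | U u) mass S M (ext S u) H `^ q) ^+ r =
    \sum_(V | Uf V) \prod_k (mass S M (ext S (V k)) H `^ q).
  rewrite -[X in _ ^+ X](card_ord r) -prodr_const bigA_distr_big /=; exact: eq_bigl.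
rewrite mulr_sumr; apply: ler_sum => V UV.
rewrite powR_prod => [|k]; last exact/ltW/mass_gt0.
set Pm := \prod_k _.
have Pm0 : 0 < Pm by apply: prodr_gt0 => k _; exact: mass_gt0.
set A := mmin S ^+ _.
have A0 : 0 < A by rewrite exprn_gt0.
have A1 : A <= 1 by rewrite exprn_ile1 ?mmin_le1 // ltW.
have [q0|q0] := leP 0 q.
  rewrite (ger0_norm q0) -powRM ?(ltW A0) ?(ltW Pm0) //; apply: ge0_ler_powR => //.
  - by rewrite nnegrE mulr_ge0 // ltW.
  - by rewrite nnegrE nub_ge0.
  - exact: nub_inter_ge.
apply: (@le_trans _ _ (Pm `^ q)).
  rewrite ler_piMl ?powR_ge0 //.
  have := ger_powR (ltac:(by rewrite A0 A1) : 0 < A <= 1) (normr_ge0 q).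
  by rewrite powRr0.
apply: ler_npowR; [exact: ltW| |exact: nub_inter_le].
by apply: msupp_nub => //; exact: coding_msupp.
Qed.
End Interleaving.

(** A cube of size between [lmin S * delta0] and [delta0] has a logarithmic rounding error of at
    most [- ln (lmin S)]. Compensating it takes that quantity divided by [- ln (lmax S)] extra
    letters on each of the [d] coordinates, each at a cost of [- ln (mmin S)]. *)
Definition Cg : R := ln (mmin S) * ln (lmin S) / - ln (lmax S) * d%:R.

(* The number [r] of interleaved words is chosen as a function of [s]; [Cg] accounts for the
   accumulated rounding errors in the sizes of [r] cubes. *)
Lemma Tdelta_growth q delta0 M H (U : pred {ffun 'I_H -> 'I_N}) :
  0 < delta0 < 1 -> (forall c, M c <= H)%N ->
  (forall u, U u -> Lf S delta0 (ext S u) = M) ->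
  (forall u u', U u -> U u' -> u != u' -> ~ eqM S M (ext S u) (ext S u')) ->
  (exists u, U u) ->
  exists c6 s2 : R, forall s, s2 <= s ->
    s * ((ln (\sum_(u | U u) mass S M (ext S u) H `^ q) - `|q| * Cg) /
         (- ln delta0 - ln (lmin S))) - c6 <= ln (Tdelta nuX q (expR (- s))).
Proof.
move=> d01 MH ULf Uneq [u0 Uu0]; have /andP[d0 d1] := d01.
have [K [W [rho [rho0 WP]]]] := interior_word S.
set Z := \sum_(u | U u) _.
have Z0 : 0 < Z.
  rewrite /Z (bigD1 u0) //= ltr_pwDl ?powR_gt0 ?mass_gt0 // sumr_ge0 // => u _; exact: powR_ge0.
have rho1 : rho < 1.
  by have := WP W (fun l _ => erefl) (sc0 S) => /andP[]; have := rho0; lra.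
have lrho : ln rho < 0 by rewrite ln_lt0 // rho0 rho1.
set kl := - ln (lmin S); have kl0 : 0 < kl by rewrite oppr_gt0 ln_lt0 // (lmin_gt0 S) lmin_lt1.
set ll := - ln (lmax S); have ll0 : 0 < ll by rewrite oppr_gt0 (ln_lmax_lt0 S).
set ms := - ln (mmin S); have ms0 : 0 <= ms by rewrite oppr_ge0 ln_le0 // mmin_le1.
set sd := - ln delta0; have sd0 : 0 < sd by rewrite oppr_gt0 ln_lt0.
set D := sd + kl.
have D0 : 0 < D by rewrite addr_gt0.
have dR1 := dR_ge1 S; have dR0 : 0 < d%:R :> R by exact: lt_le_trans dR1.
pose ld : R := ln d%:R; have ld0 : 0 <= ld by exact: ln_ge0.
(* In logarithms the smallness condition on the radius reads [r * D < s + lk + 1]; the unit of slack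
   gives the strict inequality when [r] is the integer part of [(s + lk) / D]. *)
pose lk := ln rho - (K * H)%:R * kl - 1.
have KH0 : 0 <= (K * H)%:R * kl by rewrite mulr_ge0 // ltW.
have lk0 : lk < 0 by rewrite /lk; lra.
set G := ln Z - `|q| * Cg.
pose c5 := `|q| * ms * (d%:R * ((D - lk + ld) / ll + 1) + (K * H)%:R).
exists (c5 + `|G| * (1 - lk / D)), (D - lk) => s sD.
have s0 : 0 < s by apply: lt_le_trans sD; lra.
pose r := Num.truncn ((s + lk) / D).
have slD : 1 <= (s + lk) / D by rewrite ler_pdivlMr // mul1r; lra.
have /andP[r1 r2] := truncn_itv (le_trans ler01 slD).
rewrite -/r -natr1 in r1 r2.
have r_gt0 : (0 < r)%N by rewrite truncn_gt0.
have rD1 : r%:R * D <= s + lk by rewrite -ler_pdivlMr.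
have rD2 : s + lk < (r%:R + 1) * D by rewrite -ltr_pdivrMr.
pose Ev := (r%:R * kl + D - lk + ld) / ll.
have Ev0 : 0 <= Ev.
  have : 0 <= r%:R * kl by rewrite mulr_ge0 // ltW.
  move=> rk; rewrite /Ev divr_ge0 ?(ltW ll0) //.
  by move: rk D0 lk0 ld0; clear_lra.
pose E := (Num.truncn Ev).+1.
have E1 : Ev <= E%:R by exact/ltW/truncnS_gt.
have E2 : E%:R <= Ev + 1 by rewrite /E -natr1 lerD2r truncn_le.
have l0 := lmin_gt0 S; have lx0 := lmax_gt0 S.
have e01 : 0 < expR (- s) < 1 by rewrite expR_gt0 expR_lt1 oppr_lt0.
have small : expR (- s) < rho * (lmin S ^+ (K * H) * (lmin S * delta0) ^+ r).
  have p1 : 0 < lmin S ^+ (K * H) by rewrite exprn_gt0.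
  have p2 : 0 < (lmin S * delta0) ^+ r by rewrite exprn_gt0 // mulr_gt0.
  rewrite -ltr_ln ?posrE ?expR_gt0 ?mulr_gt0 // expRK lnM ?posrE ?mulr_gt0 //.
  rewrite lnM ?posrE // !lnXn ?mulr_gt0 // lnM ?posrE //.
  rewrite -[_ *+ (K * H)]mulr_natl -[_ *+ r]mulr_natl.
  have -> : ln (lmin S) + ln delta0 = - D by rewrite /D /sd /kl; ring.
  have -> : ln (lmin S) = - kl by rewrite /kl opprK.
  by move: rD1; rewrite /lk; clear_lra.
have Esm : lmax S ^+ E * delta0 ^+ r <= expR (- s) / d%:R.
  rewrite -ler_ln ?posrE ?mulr_gt0 ?exprn_gt0 ?expR_gt0 ?invr_gt0 //.
  rewrite lnM ?posrE ?exprn_gt0 // ln_div ?posrE ?expR_gt0 // expRK !lnXn //.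
  rewrite -[_ *+ E]mulr_natl -[_ *+ r]mulr_natl -/ld.
  have -> : ln delta0 = - sd by rewrite /sd opprK.
  have -> : ln (lmax S) = - ll by rewrite /ll opprK.
  have : Ev * ll <= E%:R * ll by rewrite ler_pM2r.
  rewrite /Ev divfK ?gt_eqF //; move: rD2; rewrite /D mulrDl mul1r mulrDr; clear_lra.
have := @Tdelta_inter K W rho rho0 WP delta0 M H U d01 MH ULf Uneq r r_gt0 (expR (- s)) e01 small q E Esm.
rewrite -/Z; set A := mmin S ^+ _.
have A0 : 0 < A by rewrite exprn_gt0 // (mmin_gt0 S).
have pA : 0 < A `^ `|q| by exact: powR_gt0.
have pZ : 0 < Z ^+ r by exact: exprn_gt0.
have lhs0 : 0 < A `^ `|q| * Z ^+ r by exact: mulr_gt0.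
move=> le; have := le; rewrite -ler_ln ?posrE ?(lt_le_trans lhs0) //.
apply: le_trans; rewrite lnM ?posrE // ln_powR /A !lnXn ?(mmin_gt0 S) //.
rewrite -[_ *+ (d * E + K * H)]mulr_natl -[_ *+ r]mulr_natl.
have -> : ln (mmin S) = - ms by rewrite /ms opprK.
rewrite natrD natrM.
have qm0 : 0 <= `|q| * ms by rewrite mulr_ge0.
have CgE : Cg = ms * kl / ll * d%:R by rewrite /Cg /ms /kl /ll mulrNN.
have b1 : `|q| * ms * (d%:R * E%:R + (K * H)%:R) <= c5 + r%:R * (`|q| * Cg).
  apply: (@le_trans _ _ (`|q| * ms * (d%:R * (Ev + 1) + (K * H)%:R))).
    by rewrite ler_wpM2l // lerD2r ler_wpM2l // ltW.
  rewrite le_eqVlt; apply/orP; left; apply/eqP.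
  by rewrite /c5 CgE /Ev; field; rewrite gt_eqF.
have b2 : `|r%:R - s / D| <= 1 - lk / D.
  rewrite ler_norml; apply/andP; split.
    rewrite lerBrDr.
    have -> : - (1 - lk / D) + s / D = (s + lk) / D - 1 by field; rewrite gt_eqF.
    by rewrite lerBlDr ltW.
  have -> : r%:R - s / D = r%:R - (s + lk) / D + lk / D by field; rewrite gt_eqF.
  have : lk / D <= 0 by rewrite ler_pdivrMr // mul0r ltW.
  by move: r1; clear_lra.
have b3 : - (`|G| * (1 - lk / D)) <= G * (r%:R - s / D).
  have : `|G * (r%:R - s / D)| <= `|G| * (1 - lk / D) by rewrite normrM ler_wpM2l.
  by rewrite ler_norml => /andP[].
have -> : s * (G / D) = G * (s / D) by field; rewrite gt_eqF.
rewrite mulrBr in b3.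
have -> : `|q| * ((d%:R * E%:R + (K * H)%:R) * - ms) = - (`|q| * ms * (d%:R * E%:R + (K * H)%:R)) by ring.
have -> : r%:R * ln Z = G * r%:R + r%:R * (`|q| * Cg) by rewrite /G; ring.
by move: b1 b3; clear_lra.
Qed.
End LowerBound.


(** * Existence of the [L^q] spectrum *)

Section GrowthRate.
Variable R : realType.
Implicit Types (g : R -> R) (tau : R).

Definition rate g tau := forall e, 0 < e -> exists s2, forall s, s2 <= s -> `|g s / s - tau| <= e.

Lemma rate_ge g tau b c s2 : rate g tau -> (forall s, s2 <= s -> s * b - c <= g s) -> b <= tau.
Proof.
move=> rg h; rewrite leNgt; apply/negP => lt.
pose e := (b - tau) / 3.
have e0 : 0 < e by rewrite divr_gt0 // subr_gt0.
have [s3 h3] := rg e e0.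
pose s := Num.max s2 (Num.max s3 (Num.max 1 (`|c| / e))).
have s_2 : s2 <= s by rewrite le_max lexx.
have s_3 : s3 <= s by rewrite !le_max lexx ?orbT.
have s_1 : 1 <= s by rewrite !le_max lexx ?orbT.
have s_c : `|c| / e <= s by rewrite !le_max lexx ?orbT.
have s0 : 0 < s by exact: lt_le_trans s_1.
have := h s s_2; have := h3 s s_3.
rewrite ler_norml => /andP[_]; rewrite lerBlDr ler_pdivrMr // => h4 h5.
rewrite ler_pdivrMr // in s_c.
have := ler_norm c; have be : b = tau + 3 * e by rewrite /e; field.
rewrite be in h5; clear - h4 h5 s_c s0 e0; nra.
Qed.

Lemma rate_opp g tau : rate g tau -> rate (fun s => - g s) (- tau).
Proof.
move=> rg e e0; have [s2 h] := rg e e0; exists s2 => s /h.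
by rewrite mulNr -opprD normrN.
Qed.

Lemma rate_le g tau b c s2 : rate g tau -> (forall s, s2 <= s -> g s <= s * b + c) -> tau <= b.
Proof.
move=> /rate_opp rg h; rewrite -lerN2; apply: (rate_ge rg (c := c) (s2 := s2)) => s /h.
by rewrite mulrN -opprD lerN2.
Qed.

(* Fekete-type lemma: the limit is the supremum of [(g s - C sqrt s) / (s + C')]. *)
Lemma rate_ex g (C C' : R) : 0 <= C -> 0 <= C' ->
  (forall s1, 1 <= s1 -> exists c s2, forall s, s2 <= s ->
     s * ((g s1 - C * Num.sqrt s1) / (s1 + C')) - c <= g s) ->
  (forall s, 1 <= s -> g s <= C * s) -> exists tau, rate g tau.
Proof.
move=> C0 C'0 low up.
pose B s := (g s - C * Num.sqrt s) / (s + C').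
pose E := [set B s | s in [set s | 1 <= s]].
have Eub : ubound E C.
  move=> _ [s /= s1 <-]; have s0 : 0 < s by exact: lt_le_trans s1.
  rewrite /B ler_pdivrMr ?ltr_pwDl //.
  have := up s s1; have := mulr_ge0 C0 (sqrtr_ge0 s); have := mulr_ge0 C0 C'0.
  rewrite mulrDr; lra.
have Ene : E !=set0 by exists (B 1), 1 => /=.
have Esup : has_sup E by split=> //; exists C.
pose tau := sup E; exists tau => e e0.
have [_ [s1 /= s11 <-] hB] := @sup_adherent _ E (e / 2) (ltac:(by rewrite divr_gt0)) Esup.
have [c [s2 h]] := low s1 s11.
pose s3 := Num.max s2 (Num.max 1 (Num.max (2 * `|c| / e) (Num.max (2 * (`|tau| * C') / e) ((2 * C / e) ^+ 2)))).
exists s3 => s; rewrite /s3 !ge_max => /and5P[s_2 s_1 s_c s_t s_C].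
have s0 : 0 < s by exact: lt_le_trans s_1.
rewrite ler_norml; apply/andP; split.
- rewrite lerBrDr ler_pdivlMr //.
  have := h s s_2; rewrite -/(B s1).
  rewrite ler_pdivrMr // in s_c.
  have := ler_norm c; rewrite -/tau in hB; move: hB s_c s0; clear; nra.
- rewrite lerBlDr ler_pdivrMr //.
  have Bs : B s <= tau by apply: ub_le_sup; [exists C|exists s].
  have sC : 0 < s + C' by rewrite ltr_pwDl.
  rewrite /B ler_pdivrMr // in Bs.
  rewrite ler_pdivrMr // in s_t.
  have r0 : 0 < Num.sqrt s by rewrite sqrtr_gt0.
  have rr : Num.sqrt s * Num.sqrt s = s by rewrite -expr2 sqr_sqrtr // ltW.
  have rC : C * 2 <= e * Num.sqrt s.
    have : 2 * C / e <= Num.sqrt s.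
      rewrite -[leLHS]ger0_norm ?divr_ge0 ?mulr_ge0 ?(ltW e0) // -sqrtr_sqr.
      by rewrite ler_sqrt // ltW.
    by rewrite ler_pdivrMr //; lra.
  have t1 : tau * C' <= `|tau| * C' by rewrite ler_wpM2r // ler_norm.
  have rC' : C * 2 * Num.sqrt s <= e * s.
    by rewrite -[X in _ <= e * X]rr mulrA ler_wpM2r // ltW.
  move: Bs s_t t1 rC'; clear; lra.
Qed.

Lemma rate_cvg g tau : rate g tau ->
  g (- ln x) / - ln x @[x --> 0^'+] --> tau.
Proof.
move=> rg; apply/cvgrPdist_le => e e0; have [s2 h] := rg e e0.
near=> x; rewrite distrC; apply: h.
have x0 : 0 < x by near: x; exact: nbhs_right_gt.
rewrite lerNr -[leRHS]expRK ler_ln ?posrE ?expR_gt0 //.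
near: x; apply: nbhs_right_le; exact: expR_gt0.
Unshelve. all: by end_near. Qed.
End GrowthRate.

Definition l2d (R : realType) (d : nat) : R := ln (2 * d%:R).
Definition ll (R : realType) (d N : nat) (S : sponge R d N) : R := - ln (lmax S).
Definition kl (R : realType) (d N : nat) (S : sponge R d N) : R := - ln (lmin S).

Section Spectrum.
Variables (R : realType) (d N : nat) (S : sponge R d N).
Variables (dm : measure_display) (T : measurableType dm) (P : probability T R).
Variables (X : T -> Sigma N).
Hypothesis XP : iid_law (smu S) P X.
Local Notation a := (sa S).
Local Notation t := (st S).
Local Notation mu := (smu S).
Local Notation nub := (nub S P X).
Local Notation nuX := (nuX S P X).
Implicit Types (x y : Sigma N) (c : 'I_d) (delta q s : R).

Definition lnT q s : R := ln (Tdelta nuX q (expR (- s))).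
Local Notation l2d := (l2d R d).
Local Notation ll := (ll S).
Local Notation kl := (kl S).

Lemma ll_gt0 : 0 < ll.
Proof. by rewrite oppr_gt0 (ln_lmax_lt0 S). Qed.

Lemma kl_gt0 : 0 < kl.
Proof. by rewrite oppr_gt0 ln_lt0 // (lmin_gt0 S) lmin_lt1. Qed.

Lemma l2d_ge0 : 0 <= l2d.
Proof. by apply: ln_ge0; have := dR_ge1 S; lra. Qed.

Lemma fin_expR s : fine_scale d (expR (- s)) = expR (- (s + l2d)).
Proof.
have d1 := dR_ge1 S; have d0 : 0 < 2 * d%:R :> R by rewrite mulr_gt0 // (lt_le_trans _ d1).
by rewrite /fine_scale opprD expRD [expR (- l2d)]expRN /l2d lnK.
Qed.

Lemma exp01 s : 0 < s -> 0 < expR (- s) < 1.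
Proof. by move=> s0; rewrite expR_gt0 expR_lt1 oppr_lt0. Qed.

Lemma Hb_le s : 0 < s -> (Hb S (expR (- s)))%:R <= s / ll + 1.
Proof.
move=> s0; rewrite /Hb expRK -natr1 lerD2r.
have -> : - s / ln (lmax S) = s / ll by rewrite /ll invrN mulrN mulNr.
by rewrite truncn_le divr_ge0 // ltW // ll_gt0.
Qed.

Lemma Tdelta_gt0 q delta : 0 < delta < 1 -> 0 < Tdelta nuX q delta.
Proof.
move=> d01; have /andP[d0 _] := d01.
pose z := coding a t (fun=> si0 S).
have zs : msupp nuX z by exact: coding_msupp.
have := @Tdelta_lb_fin _ _ _ S _ _ P X XP delta q unit predT (fun=> z) d01 (fun _ _ => zs).
rewrite big_const card_unit /= addr0 => h; apply: lt_le_trans (h _).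
  by apply: powR_gt0; exact: msupp_nub.
by move=> [] [].
Qed.

Lemma powR_expR (m q : R) : 0 < m -> m `^ q = expR (q * ln m).
Proof. by move=> m0; rewrite /powR gt_eqF. Qed.

Lemma Zt_le delta q B : (forall x, q * ln (mm S delta x) <= B) ->
  Zt S delta q <= N%:R ^+ Hb S delta * expR B.
Proof.
move=> h; apply: (@le_trans _ _ (\sum_(v : {ffun 'I_(Hb S delta) -> 'I_N}) expR B)).
  rewrite /Zt [leRHS](bigID (@iscan _ _ _ S delta)) /= ler_wpDr //.
    by apply: sumr_ge0 => v _; exact: expR_ge0.
  by apply: ler_sum => v _; rewrite powR_expR ?mm_gt0 // ler_expR.
by rewrite sumr_const card_ffun !card_ord -[_ *+ _]mulr_natl natrX.
Qed.

Lemma N_ge1 : 1 <= N%:R :> R.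
Proof. by rewrite ler1n (leq_ltn_trans (leq0n _) (ltn_ord (si0 S))). Qed.

Lemma lnT_le q s B : 0 < s -> (forall x, q * ln (mm S (expR (- (s + l2d))) x) <= B) ->
  lnT q s <= ln (CT S q) + (Hb S (expR (- (s + l2d))))%:R * ln N%:R + B.
Proof.
move=> s0 h; have e01 := exp01 s0.
have := Tdelta_ub XP q e01; rewrite fin_expR => le.
have C1 := CT_ge1 S q; have C0 : 0 < CT S q by exact: lt_le_trans C1.
have N1 := N_ge1; have N0 : 0 < N%:R :> R by exact: lt_le_trans N1.
have : Tdelta nuX q (expR (- s)) <= CT S q * (N%:R ^+ Hb S (expR (- (s + l2d))) * expR B).
  by apply: (le_trans le); rewrite ler_wpM2l ?(ltW C0) //; exact: Zt_le.
rewrite -ler_ln ?posrE ?(Tdelta_gt0 q e01) ?mulr_gt0 ?exprn_gt0 ?expR_gt0 //.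
rewrite lnM ?posrE ?mulr_gt0 ?exprn_gt0 ?expR_gt0 //.
by rewrite lnM ?posrE ?exprn_gt0 ?expR_gt0 // expRK lnXn // -[_ *+ _]mulr_natl addrA.
Qed.

(** Interleaving requires common cutoffs. There are at most [(Hb S delta).+1 ^ d] families of
    cutoffs, and the logarithm of this number is absorbed by the square root in [rate_ex]. *)
Lemma Zt_pigeonhole delta q : 0 < delta < 1 ->
  exists (M : 'I_d -> nat) (U : pred {ffun 'I_(Hb S delta) -> 'I_N}),
  [/\ forall c, (M c <= Hb S delta)%N, forall u, U u -> Lf S delta (ext S u) = M,
    forall u u', U u -> U u' -> u != u' -> ~ eqM S M (ext S u) (ext S u'),
    exists u, U u &
    Zt S delta q <= (Hb S delta).+1%:R ^+ d * \sum_(u | U u) mass S M (ext S u) (Hb S delta) `^ q].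
Proof.
move=> d01; set H := Hb S delta.
pose Mv (v : {ffun 'I_H -> 'I_N}) : {ffun 'I_d -> 'I_H.+1} :=
  [ffun c => inord (Lf S delta (ext S v) c)].
have MvE v c : Mv v c = Lf S delta (ext S v) c :> nat.
  by rewrite ffunE inordK // ltnS Lf_le_Hb.
pose Um Mf v := @iscan _ _ _ S delta v && (Mv v == Mf).
pose Z Mf := \sum_(v | Um Mf v) mm S delta (ext S v) `^ q.
have ZtE : Zt S delta q = \sum_Mf Z Mf by rewrite /Zt (partition_big Mv xpredT).
pose v0 := canw S delta (fun=> si0 S); pose Mf0 := Mv v0.
case: (@arg_maxP _ _ _ Mf0 xpredT Z isT) => Mf _ Mmax.
have Zle : Zt S delta q <= H.+1%:R ^+ d * Z Mf.
  rewrite ZtE; apply: (@le_trans _ _ (\sum_(Mf' : {ffun 'I_d -> 'I_H.+1}) Z Mf)).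
    by apply: ler_sum => Mf' _; exact: Mmax.
  by rewrite sumr_const card_ffun !card_ord -[_ *+ _]mulr_natl natrX.
have UL u : Um Mf u -> Lf S delta (ext S u) = (fun c => Mf c : nat).
  by move=> /andP[_ /eqP <-]; apply/funext => c; rewrite MvE.
exists (fun c => Mf c : nat), (Um Mf); split=> //.
- by move=> c; rewrite -ltnS.
- move=> u u' Uu Uu' uu'; rewrite -(UL u Uu).
  case/andP: Uu => cu _; case/andP: Uu' => cu' _; exact: iscan_neq.
- have [u Uu|U0] := pickP (Um Mf); first by exists u.
  have Z0 : Z Mf = 0 by rewrite /Z big_pred0.
  have : 0 < Z Mf0.
    rewrite /Z (bigD1 v0) /=; last by rewrite /Um iscan_canw /=.
    rewrite ltr_pwDl ?powR_gt0 ?mm_gt0 // sumr_ge0 // => v _; exact: powR_ge0.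
  have : Z Mf0 <= Z Mf := Mmax Mf0 isT.
  by rewrite Z0 leNgt => /negP.
- apply: (le_trans Zle); rewrite ler_wpM2l ?exprn_ge0 //.
  by apply: ler_sum => u Uu; rewrite /mm (UL u Uu).
Qed.

Lemma ln_le_sqrt s : 0 < s -> ln s <= 2 * Num.sqrt s.
Proof.
move=> s0; have r0 : 0 < Num.sqrt s by rewrite sqrtr_gt0.
rewrite -{1}(sqr_sqrtr (ltW s0)) lnXn // -[_ *+ 2]mulr_natl ler_pM2l //.
exact/ltW/ln_sublinear.
Qed.

Lemma sqrt_ge1 s : 1 <= s -> 1 <= Num.sqrt s.
Proof. by move=> s1; rewrite -[leLHS]sqrtr1 ler_sqrt // (le_trans ler01). Qed.

Lemma mm_ge s x : 0 < s -> - (ln (mm S (expR (- s)) x)) <= - ln (mmin S) * (s / ll + 1).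
Proof.
move=> s0; have m0 := mmin_gt0 S.
have h : mmin S ^+ Hb S (expR (- s)) <= mm S (expR (- s)) x by exact: mass_ge.
rewrite -ler_ln ?posrE ?exprn_gt0 ?mm_gt0 // lnXn // -[_ *+ _]mulr_natl in h.
apply: (@le_trans _ _ (- ln (mmin S) * (Hb S (expR (- s)))%:R)).
  by rewrite mulrC mulrN lerN2.
by rewrite ler_wpM2l ?Hb_le // oppr_ge0 ln_le0 // mmin_le1.
Qed.

Ltac xp_lra := clear - XP; repeat match goal with H := _ |- _ => clearbody H end; intros; lra.

Lemma rate_lnT q : exists tau, rate (lnT q) tau.
Proof.
have ll0 := ll_gt0; have l20 := l2d_ge0; have kl0 := kl_gt0; have N1 := N_ge1.
have lN0 : 0 <= ln N%:R :> R by exact: ln_ge0.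
have ms0 : 0 <= - ln (mmin S) by rewrite oppr_ge0 ln_le0 // mmin_le1.
have lC0 : 0 <= ln (CT S q) by apply: ln_ge0; exact: CT_ge1.
pose ch := (1 + l2d) / ll + 2.
have ch1 : 1 <= ch.
  have : 0 <= (1 + l2d) / ll by rewrite divr_ge0 ?(ltW ll0) // addr_ge0.
  by rewrite /ch; xp_lra.
have lch0 : 0 <= ln ch by exact: ln_ge0.
have Hch s : 1 <= s -> (Hb S (expR (- (s + l2d)))).+1%:R <= ch * s.
  move=> s1; rewrite -natr1.
  have sl0 : 0 < s + l2d by rewrite ltr_pwDl // (lt_le_trans _ s1).
  have := Hb_le sl0.
  have : (s + l2d) / ll <= (s + l2d * s) / ll.
    by rewrite ler_pM2r ?invr_gt0 // lerD2l ler_peMr.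
  have -> : (s + l2d * s) / ll = (1 + l2d) / ll * s by field; rewrite gt_eqF.
  rewrite /ch mulrDl; move: s1; xp_lra.
pose Cq := `|q| * Cg S.
have Cg0 : 0 <= Cg S.
  rewrite /Cg mulr_ge0 // mulr_ge0 ?invr_ge0 ?(ltW ll0) //.
  by rewrite -mulrNN mulr_ge0 // (ltW kl0).
have Cq0 : 0 <= Cq by rewrite mulr_ge0.
pose C1 := ln (CT S q) + d%:R * (ln ch + 2) + Cq.
pose C2 := ln (CT S q) + ch * ln N%:R + `|q| * (- ln (mmin S) * ch).
have ch0 : 0 <= ch by exact: le_trans ch1.
have C10 : 0 <= C1.
  by apply: addr_ge0 => //; apply: addr_ge0 => //; apply: mulr_ge0 => //; exact: addr_ge0.
have C20 : 0 <= C2.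
  apply: addr_ge0; first by apply: addr_ge0 => //; exact: mulr_ge0.
  by apply: mulr_ge0 => //; exact: mulr_ge0.
(* The shift [l2d + kl] comes from passing to the scale [fine_scale] and from rounding one cube.
   [C1] pays for the comparison of balls with cubes, the pigeonhole factor and [Cg]; [C2] bounds the
   linear growth. *)
apply: (@rate_ex _ (lnT q) (C1 + C2) (l2d + kl)).
- exact: addr_ge0 C10 C20.
- exact: addr_ge0 l20 (ltW kl0).
- move=> s1 s11; have s10 : 0 < s1 by exact: lt_le_trans s11.
  have sl0 : 0 < s1 + l2d by rewrite ltr_pwDl.
  have f01 := exp01 sl0.
  have [M [U [MH UL Un [u0 Uu0] Zle]]] := Zt_pigeonhole q f01.
  have [c6 [s2 h]] := Tdelta_growth XP q f01 MH UL Un (ex_intro _ u0 Uu0).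
  exists c6, (Num.max s2 0) => s; rewrite ge_max => /andP[s2s s0].
  apply: le_trans (h s s2s); rewrite lerD2r ler_wpM2l //.
  have -> : - ln (expR (- (s1 + l2d))) - ln (lmin S) = s1 + (l2d + kl).
    by rewrite expRK opprK -addrA.
  have DD : 0 < s1 + (l2d + kl) by exact: ltr_pwDl s10 (addr_ge0 l20 (ltW kl0)).
  rewrite ler_pM2r ?invr_gt0 //.
  set Z := \sum_(u | U u) _ in Zle *.
  have Z0 : 0 < Z.
    by rewrite /Z (bigD1 u0) //= ltr_pwDl ?powR_gt0 ?mass_gt0 // sumr_ge0 // => u _; exact: powR_ge0.
  have r1 := sqrt_ge1 s11; have lnr := ln_le_sqrt s10; have hch := Hch s1 s11.
  set r := Num.sqrt s1 in r1 lnr *.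
  set H := Hb S _ in Zle hch.
  have lH : d%:R * ln H.+1%:R <= d%:R * (ln ch + 2) * r.
    rewrite -mulrA ler_wpM2l //.
    apply: (@le_trans _ _ (ln (ch * s1))); first by rewrite ler_ln ?posrE ?mulr_gt0 // (lt_le_trans _ ch1).
    rewrite lnM ?posrE ?(lt_le_trans _ ch1) // mulrDl lerD // ler_peMr //.
  have le1 : lnT q s1 <= ln (CT S q) + (d%:R * ln H.+1%:R + ln Z).
    have C0 : 0 < CT S q by exact: lt_le_trans (CT_ge1 S q).
    have : Tdelta nuX q (expR (- s1)) <= CT S q * (H.+1%:R ^+ d * Z).
      by apply: (le_trans (Tdelta_ub XP q (exp01 s10))); rewrite fin_expR ler_wpM2l ?(ltW C0).
    have p1 : 0 < H.+1%:R ^+ d * Z by rewrite mulr_gt0 // exprn_gt0.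
    rewrite -ler_ln ?posrE ?(Tdelta_gt0 q (exp01 s10)) ?mulr_gt0 // lnM ?posrE //.
    by rewrite lnM ?posrE ?exprn_gt0 // lnXn // -[_ *+ d]mulr_natl.
  have b1 : ln (CT S q) <= ln (CT S q) * r by rewrite ler_peMr.
  have b2 : Cq <= Cq * r by rewrite ler_peMr.
  have b3 : 0 <= C2 * r by rewrite mulr_ge0 // (le_trans ler01).
  rewrite mulrDl {1}/C1 2!mulrDl -/Cq.
  move: le1 lH b1 b2 b3; xp_lra.
- move=> s s1; have s0 : 0 < s by exact: lt_le_trans s1.
  have sl0 : 0 < s + l2d by rewrite ltr_pwDl.
  have hch := Hch s s1; rewrite -natr1 in hch.
  set H := Hb S _ in hch.
  have h1 : (s + l2d) / ll + 1 <= ch * s.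
    have : (s + l2d) / ll <= (s + l2d * s) / ll.
      by rewrite ler_pM2r ?invr_gt0 // lerD2l ler_peMr.
    have -> : (s + l2d * s) / ll = (1 + l2d) / ll * s by field; rewrite gt_eqF.
    rewrite /ch mulrDl; move: s1; xp_lra.
  have := @lnT_le q s (`|q| * (- ln (mmin S) * (ch * s))) s0.
  move=> /(_ _)/le_trans; apply.
    move=> x; apply: (@le_trans _ _ (`|q| * - ln (mm S (expR (- (s + l2d))) x))).
      have : ln (mm S (expR (- (s + l2d))) x) <= 0 by apply: ln_le0; exact: mass_le1.
      have := ler_norm (- q); rewrite normrN; clear - XP; set w := ln _; clearbody w; nra.
    rewrite ler_wpM2l // (le_trans (mm_ge x sl0)) // ler_wpM2l //.
  rewrite -/H.
  have b1 : ln (CT S q) <= ln (CT S q) * s by rewrite ler_peMr.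
  have b2 : H%:R * ln N%:R <= ch * ln N%:R * s.
    by rewrite mulrAC ler_wpM2r // (le_trans _ hch) // lerDl.
  have b3 : 0 <= C1 * s by rewrite mulr_ge0 // (le_trans ler01).
  have -> : (C1 + C2) * s = C1 * s + (ln (CT S q) * s + ch * ln N%:R * s +
      `|q| * (- ln (mmin S) * (ch * s))) by rewrite /C2; ring.
  move: b1 b2 b3; xp_lra.
Qed.

(** Interleaving copies of one single word: the measure of any one approximate cube already bounds
    the spectrum from below. *)
Lemma lnT_ge_mm q tau delta0 x : rate (lnT q) tau -> 0 < delta0 < 1 ->
  (q * ln (mm S delta0 x) - `|q| * Cg S) / (- ln delta0 + kl) <= tau.
Proof.
move=> rg d01; pose u := canw S delta0 x.
have [||||c [s2]] := @Tdelta_growth _ _ _ S _ _ P X XP q delta0 (Lf S delta0 (ext S u)) (Hb S delta0) (pred1 u) d01.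
- by move=> c; exact: Lf_le_Hb.
- by move=> v /eqP ->.
- by move=> v v' /eqP -> /eqP ->; rewrite eqxx.
- by exists u => /=.
rewrite big_pred1_eq ln_powR -/(mm S delta0 (ext S u)) mm_canw //.
exact: rate_ge.
Qed.

(** There are at most [N ^ Hb] canonical words, and [Hb] is at most [s / ll + 1]; this is the
    resulting growth rate, independent of [q]. *)
Definition CN : R := ln N%:R / ll.

Lemma lnT_le_mm q tau s1 b : rate (lnT q) tau ->
  (forall s x, s1 <= s -> q * ln (mm S (expR (- s)) x) <= s * b) -> tau <= CN + b.
Proof.
move=> rg h; have ll0 := ll_gt0; have l20 := l2d_ge0.
have lN0 : 0 <= ln N%:R :> R by apply: ln_ge0; exact: N_ge1.
apply: (rate_le rg (s2 := Num.max s1 1)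
  (c := ln (CT S q) + (l2d / ll + 1) * ln N%:R + l2d * b)) => s.
rewrite ge_max => /andP[ss1 s11]; have s0 : 0 < s by exact: lt_le_trans s11.
have sl0 : 0 < s + l2d by rewrite ltr_pwDl.
have := @lnT_le q s ((s + l2d) * b) s0 (fun x => h _ x (ler_wpDr l20 ss1)).
move/le_trans; apply.
have : (Hb S (expR (- (s + l2d))))%:R * ln N%:R <= ((s + l2d) / ll + 1) * ln N%:R.
  by rewrite ler_wpM2r // Hb_le.
have -> : ((s + l2d) / ll + 1) * ln N%:R = s * CN + (l2d / ll + 1) * ln N%:R.
  by rewrite /CN; field; rewrite gt_eqF.
rewrite mulrDr [(s + l2d) * b]mulrDl; xp_lra.
Qed.
End Spectrum.


Lemma ln_prod (R : realType) (I : Type) (r : seq I) (Q : pred I) (F : I -> R) :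
  (forall i, 0 < F i) -> ln (\prod_(i <- r | Q i) F i) = \sum_(i <- r | Q i) ln (F i).
Proof.
move=> F0; elim: r => [|i r IH]; first by rewrite !big_nil ln1.
rewrite !big_cons; case: ifP => // _; rewrite lnM ?posrE ?IH //.
by apply: prodr_gt0.
Qed.

(** * The variational problem as a linear program *)

Section SortedWord.
Variables (d N : nat) (p0 : 'I_d * 'I_N) (cnt : 'I_d * 'I_N -> nat).

Definition above (k : nat) (p : 'I_d * 'I_N) := (k <= p.1)%N.

Definition lev_ge (p q : 'I_d * 'I_N) := (q.1 <= p.1)%N.

(** A pair of level [k] is a letter to be prescribed on the first [k + 1] axes of the ordering.
    Decreasing levels make the pairs relevant to one axis a prefix, whose length is the cutoff on
    that axis. *)
Definition wseq : seq ('I_d * 'I_N) :=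
  sort lev_ge (flatten [seq nseq (cnt p) p | p <- enum {: 'I_d * 'I_N}]).

Lemma wseq_sorted : sorted lev_ge wseq.
Proof. by apply: sort_sorted => p q; exact: leq_total. Qed.

Lemma wseq_sum (R : realType) (Q : pred ('I_d * 'I_N)) (F : 'I_d * 'I_N -> R) :
  \sum_(p <- wseq | Q p) F p = \sum_(p | Q p) (cnt p)%:R * F p.
Proof.
rewrite (perm_big _ (permEl (perm_sort _ _))) /= big_flatten big_map /= [RHS]big_mkcond /=.
rewrite -[RHS]big_enum /=; apply: eq_bigr => p _.
rewrite big_nseq_cond; case: ifP => // _.
by rewrite iter_addr_0 mulr_natl.
Qed.

Lemma count_sorted (B : seq ('I_d * 'I_N)) (k : nat) l : sorted lev_ge B -> (l < size B)%N ->
  (l < count (above k) B)%N = (k <= (nth p0 B l).1)%N.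
Proof.
have tr : transitive lev_ge by move=> q p r; rewrite /lev_ge => h1 h2; exact: leq_trans h2 h1.
elim: B l => [//|p B IH] l sB lB.
have sB' : sorted lev_ge B by exact: path_sorted sB.
have [kp|pk] := leqP k p.1.
  case: l lB => [|l] lB /=; rewrite /above kp //= add1n ltnS; exact: IH.
have aB : all (fun r : 'I_d * 'I_N => r.1 < k)%N (p :: B).
  rewrite /= pk /=; apply: sub_all (order_path_min tr sB) => r; rewrite /lev_ge => rp.
  exact: leq_ltn_trans rp pk.
have -> : count (above k) (p :: B) = 0%N.
  apply/eqP; rewrite -leqn0 leqNgt -has_count -all_predC.
  by apply: sub_all aB => r /=; rewrite /above -ltnNge.
by rewrite ltn0 leqNgt (allP aB) ?mem_nth.
Qed.

Lemma sum_prefix (R : realType) (B : seq ('I_d * 'I_N)) (k : nat) (F : 'I_d * 'I_N -> R) :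
  sorted lev_ge B ->
  \sum_(l < count (above k) B) F (nth p0 B l) = \sum_(p <- B | above k p) F p.
Proof.
move=> sB; rewrite (big_nth p0) -(big_mkord xpredT (fun l => F (nth p0 B l))).
rewrite (big_nat_widen _ _ (size B)) ?count_size // [LHS]big_nat_cond [RHS]big_nat_cond /=.
apply: eq_bigl => l; case lB: (l < size B)%N => //=.
by rewrite count_sorted // andbC.
Qed.
End SortedWord.

Section Weights.
Variables (R : realType) (d N : nat) (S : sponge R d N).
Local Notation a := (sa S).
Local Notation t := (st S).
Local Notation mu := (smu S).
Implicit Types (x y : Sigma N) (c k m : 'I_d) (i j : 'I_N) (w : 'I_d -> 'I_N -> R).
Implicit Types (s : {perm 'I_d}).

(* [w k i] stands for [C_{k+1} p_{sigma_{k+1}}(i)]: this turns [Q^sigma] into a polytope with one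
   linear constraint [wcon] per coordinate, and [S_sigma] into the linear functional [wS]. *)
Definition wS s w : R := \sum_k \sum_i w k i * - ln (muJ S (Eset s k.+1) i).
Definition wcon s w k : R := \sum_(m : 'I_d | (k <= m)%N) \sum_i w m i * - ln (lam a i (s k)).
Definition isW s w := (forall k i, 0 <= w k i) /\ (forall k, wcon s w k = 1).

Lemma ln_lam_bounds i c : ll S <= - ln (lam a i c) <= kl S.
Proof.
rewrite /ll /kl !lerN2 !ler_ln ?posrE ?lam_le ?lam_ge ?lam_gt0 ?lmax_gt0 //; exact: (lmin_gt0 S).
Qed.

Lemma ln_muJ_bounds J i : 0 <= - ln (muJ S J i) <= - ln (mmin S).
Proof.
rewrite oppr_ge0 ln_le0 ?muJ_le1 //= lerN2 ler_ln ?posrE ?muJ_gt0 ?muJ_ge //; exact: (mmin_gt0 S).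
Qed.

Lemma ln_ls x (n : nat) c : - ln (ls S x n c) = \sum_(l < n) - ln (lam a (x l) c).
Proof. by rewrite /ls ln_prod ?sumrN // => l; exact: lam_gt0. Qed.

Lemma ln_mass M x H : - ln (mass S M x H) = \sum_(l < H) - ln (muJ S (Jm M l) (x l)).
Proof. by rewrite /mass ln_prod ?sumrN // => l; exact: muJ_gt0. Qed.

Lemma floor_sum (I : finType) (Q : pred I) (v G : I -> R) (K : R) :
  0 <= K -> (forall o, 0 <= v o) -> (forall o, 0 <= G o <= K) ->
  \sum_(o | Q o) v o * G o - #|I|%:R * K <= \sum_(o | Q o) (Num.truncn (v o))%:R * G o
  <= \sum_(o | Q o) v o * G o.
Proof.
move=> K0 v0 GK; apply/andP; split; last first.
  apply: ler_sum => o _; have /andP[G0 _] := GK o.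
  by rewrite ler_wpM2r // truncn_le.
rewrite lerBlDr; apply: (@le_trans _ _ (\sum_(o | Q o) ((Num.truncn (v o))%:R * G o + K))).
  apply: ler_sum => o _; have /andP[G0 GK'] := GK o.
  have := truncnS_gt (v o); rewrite -natr1 => h.
  apply: (@le_trans _ _ (((Num.truncn (v o))%:R + 1) * G o)).
    by rewrite ler_wpM2r // ltW.
  by rewrite mulrDl mul1r lerD2l.
by rewrite big_split /= lerD2l sumr_const -[_ *+ #|_|]mulr_natl ler_wpM2r // ler_nat max_card.
Qed.

(* A word with [w k i * s0] letters [i] at level [k], the levels decreasing, has cutoffs at bounded
   distance from [L_delta]. The permutation need not belong to [Aset]. *)
Lemma weights_realized s w : isW s w -> exists C : R, forall s0 : R, 0 < s0 ->
  exists x, `|ln (mm S (expR (- s0)) x) + s0 * wS s w| <= C.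
Proof.
move=> [w0 wc].
have ll0 := ll_gt0 S; have kl0 := kl_gt0 S.
have ms0 : 0 <= - ln (mmin S) by rewrite oppr_ge0 ln_le0 // mmin_le1.
pose C' := #|{: 'I_d * 'I_N}|%:R * kl S.
have C'0 : 0 <= C' by rewrite mulr_ge0 // ltW.
(* Rounding the letter counts down leaves the size at the cutoffs between [delta] and
   [expR C' * delta], and [L_delta] is reached when the size is still at least [lmin S * delta]; so
   at most [E] letters lie in between. *)
pose E := Num.truncn ((C' + kl S) / ll S).
exists (#|{: 'I_d * 'I_N}|%:R * - ln (mmin S) + (d * E)%:R * - ln (mmin S)) => s0 s00.
have e01 := exp01 s00.
pose v (p : 'I_d * 'I_N) := w p.1 p.2 * s0.
have v0 p : 0 <= v p by rewrite mulr_ge0 // ltW.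
pose p0 := (sc0 S, si0 S).
pose B := wseq (fun p => Num.truncn (v p)).
have sB : sorted (@lev_ge d N) B by exact: wseq_sorted.
pose x : Sigma N := fun l => (nth p0 B l).2.
pose M c := count (above ((s^-1)%g c)) B.
have Ms k : M (s k) = count (above k) B by rewrite /M permK.
exists x; set delta := expR _ in e01 *.
have lsM k : s0 - C' <= - ln (ls S x (M (s k)) (s k)) <= s0.
  rewrite ln_ls Ms (sum_prefix p0 k (fun p => - ln (lam a p.2 (s k)))) // wseq_sum.
  have := @floor_sum _ (above k) v (fun p => - ln (lam a p.2 (s k))) (kl S) (ltW kl0) v0.
  have -> : \sum_(p : 'I_d * 'I_N | above k p) v p * - ln (lam a p.2 (s k)) = s0.
    rewrite -[RHS]mulr1 -(wc k) /wcon pair_big /= mulr_sumr.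
    by apply: eq_big => [p|p _]; [rewrite andbT | rewrite /v; ring].
  apply => p; have /andP[h1 h2] := ln_lam_bounds p.2 (s k).
  by rewrite h2 (le_trans (ltW ll0) h1).
have MB c : (M c <= size B)%N by exact: count_size.
have JE l : (l < size B)%N -> Jm M l = Eset s (nth p0 B l).1.+1.
  move=> lB; apply/setP => c; rewrite -(permKV s c) in_Eset inE Ms ltnS.
  exact: count_sorted.
pose H := (Hb S delta + size B)%N.
have lnME : - ln (mass S M x H) = \sum_(p <- B) - ln (muJ S (Eset s p.1.+1) p.2).
  rewrite ln_mass /H addnC big_split_ord /= [X in _ + X]big1 ?addr0 => [|l _]; last first.
    rewrite (_ : Jm M _ = finset.set0) ?muJ0 ?ln1 ?oppr0 //; apply/setP => c; rewrite !inE.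
    by apply/negbTE; rewrite -leqNgt (leq_trans (MB c)) // leq_addr.
  rewrite (big_nth p0) big_mkord; apply: eq_bigr => l _; by rewrite JE.
have massB : s0 * wS s w - #|{: 'I_d * 'I_N}|%:R * - ln (mmin S) <= - ln (mass S M x H) <= s0 * wS s w.
  rewrite lnME wseq_sum.
  have <- : \sum_(p : 'I_d * 'I_N) v p * - ln (muJ S (Eset s p.1.+1) p.2) = s0 * wS s w.
    rewrite /wS pair_big /= mulr_sumr.
    by apply: eq_big => [p|p _] //; rewrite /v; ring.
  exact: (@floor_sum _ xpredT v (fun p => - ln (muJ S (Eset s p.1.+1) p.2)) (- ln (mmin S)) ms0 v0
    (fun p => ln_muJ_bounds _ _)).
have ML c : (M c <= Lf S delta x c <= M c + E)%N.
  have := lsM ((s^-1)%g c); rewrite permKV => /andP[lM1 lM2].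
  have /andP[lL1 lL2] := ls_Lf S x c e01.
  have le1 : (M c <= Lf S delta x c)%N.
    rewrite leqNgt; apply/negP => /(ls_lt S x c) h.
    have := lt_le_trans h lL2; rewrite -ltr_ln ?posrE ?ls_gt0 ?expR_gt0 // expRK.
    by rewrite ltrNr ltNge lM2.
  rewrite le1 /=; set n := (Lf S delta x c - M c)%N.
  have LE : Lf S delta x c = (M c + n)%N by rewrite subnKC.
  rewrite LE leq_add2l /E truncn_ge_nat ?divr_ge0 ?addr_ge0 ?(ltW ll0) ?(ltW kl0) //.
  rewrite ler_pdivlMr //.
  have : lmin S * delta <= ls S x (M c) c * lmax S ^+ n.
    by apply: (le_trans lL1); rewrite LE ls_add ler_wpM2l ?(ltW (ls_gt0 _ _ _ _)) // ls_le.
  have lm0 := lmin_gt0 S; have lx0 := lmax_gt0 S.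
  rewrite -ler_ln ?posrE ?mulr_gt0 ?expR_gt0 ?ls_gt0 ?exprn_gt0 //.
  rewrite !lnM ?posrE ?expR_gt0 ?ls_gt0 ?exprn_gt0 // expRK lnXn // -[_ *+ n]mulr_natl.
  have -> : ln (lmin S) = - kl S by rewrite opprK.
  have -> : ln (lmax S) = - ll S by rewrite opprK.
  by move: lM1; clear; set u := ln _; set u' := _ * ll S; rewrite mulrN -/u'; lra.
have LH c : (Lf S delta x c <= H)%N by rewrite /H (leq_trans (Lf_le_Hb S x c e01)) // leq_addr.
have := @mass_ext R d N S M (Lf S delta x) x H E ML LH.
have -> : mass S (Lf S delta x) x H = mm S delta x.
  by rewrite /H mass_widen // => c; exact: Lf_le_Hb.
have m0 := mmin_gt0 S; have M0 := mass_gt0 S M x H; have mm0 := mm_gt0 S delta x.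
have mE0 : 0 < mmin S ^+ (d * E) by rewrite exprn_gt0.
move=> /andP[g1 g2].
have h2 : ln (mm S delta x) <= ln (mass S M x H) by rewrite ler_ln ?posrE.
have h1 : (d * E)%:R * ln (mmin S) + ln (mass S M x H) <= ln (mm S delta x).
  by rewrite mulr_natl -lnXn // -lnM ?posrE // ler_ln ?posrE // mulr_gt0.
have dE0 : 0 <= (d * E)%:R * - ln (mmin S) by rewrite mulr_ge0.
have I0 : 0 <= #|{: 'I_d * 'I_N}|%:R * - ln (mmin S) by rewrite mulr_ge0.
rewrite ler_norml; move: massB h1 h2 dE0 I0; rewrite !mulrN; clear.
set u1 := _ * ln (mmin S); set u2 := _ * ln (mmin S); set u3 := s0 * _; set u4 := ln _; set u5 := ln _.
clearbody u1 u2 u3 u4 u5; move=> /andP[*]; apply/andP; split; lra.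
Qed.
End Weights.


(** * Letter frequencies of approximate cubes and their limits *)

Lemma ultra_bounded_cvg (R : realType) (U : set_system nat) (UU : UltraFilter U)
    (u : nat -> R) (b : R) : (forall n, 0 <= u n <= b) -> exists l : R, u n @[n --> U] --> l.
Proof.
move=> ub; have FU : ProperFilter U by exact: ultra_proper.
have [|l [_ cl]] := @segment_compact R 0 b (u @ U) _.
  change (U (u @^-1` `[0, b]%classic)); apply: filterS filterT => n _.
  by rewrite /= in_itv /= ub.
exists l => A nA; have [//|nUA] := in_ultra_setVsetC (u @^-1` A) UU.
by have [z []] := cl (~` A) A nUA nA.
Qed.

Section EmpiricalWeights.
Variables (R : realType) (d N : nat) (S : sponge R d N).
Local Notation a := (sa S).
Local Notation t := (st S).
Local Notation mu := (smu S).
Implicit Types (x y : Sigma N) (c k m : 'I_d) (i j : 'I_N) (w : 'I_d -> 'I_N -> R).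
Implicit Types (s : {perm 'I_d}) (J : {set 'I_d}).

Lemma Eset_inj s k m : Eset s k.+1 = Eset s m.+1 -> k = m.
Proof.
move=> e; apply/val_inj/eqP; rewrite eqn_leq /= -ltnS -(in_Eset s) -e in_Eset ltnSn /=.
by rewrite -ltnS -(in_Eset s) e in_Eset ltnSn.
Qed.

Lemma Eset_neq0 s k : Eset s k.+1 != finset.set0.
Proof. by apply/set0Pn; exists (s k); rewrite in_Eset. Qed.

Variables (s : {perm 'I_d}) (s0 : R) (x : Sigma N).
Hypothesis s0_gt0 : 0 < s0.
Let delta := expR (- s0).
Let L := Lf S delta x.
Hypothesis Ldesc : forall k1 k2 : 'I_d, (k2 : nat) = k1.+1 -> (L (s k2) <= L (s k1))%N.
Let H := Hb S delta.

(* Letter frequencies of the approximate cube of [x], level by level. *)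
Definition emp k i : R :=
  (\sum_(l < H) ((Jm L l == Eset s k.+1) && (rep S (Eset s k.+1) (x l) == i))%:R) / s0.

Lemma delta01 : 0 < delta < 1.
Proof. exact: exp01. Qed.

Lemma emp_ge0 k i : 0 <= emp k i.
Proof. by rewrite divr_ge0 ?(ltW s0_gt0) // sumr_ge0. Qed.

Lemma emp_Iset k i : ~~ Iset a t s k.+1 i -> emp k i = 0.
Proof.
move=> nI; rewrite /emp big1 ?mul0r // => l _.
case: (boolP (_ && _)) => // /andP[_ /eqP e]; case/negP: nI.
apply/asboolP => j /overlapE ji; rewrite -e.
have [h1 h2] := repP S (Eset s k.+1) (x l); apply: h2.
by rewrite (eqJ_left _ h1) e eqJ_sym.
Qed.

(** Every level [l] is counted for exactly one [k], because [Jm L l] is an initial segment of the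
    ordering; only levels beyond all cutoffs are lost. *)
Lemma emp_sum (F : {set 'I_d} -> 'I_N -> R) :
  \sum_k \sum_i emp k i * F (Eset s k.+1) i =
  (\sum_(l < H) if Jm L l == finset.set0 then 0 else F (Jm L l) (rep S (Jm L l) (x l))) / s0.
Proof.
transitivity (\sum_(k < d) (\sum_(l < H) (Jm L l == Eset s k.+1)%:R *
    F (Eset s k.+1) (rep S (Eset s k.+1) (x l))) / s0).
  apply: eq_bigr => k _; rewrite mulr_suml.
  transitivity (\sum_i \sum_(l < H) ((Jm L l == Eset s k.+1) && (rep S (Eset s k.+1) (x l) == i))%:R
      * F (Eset s k.+1) i / s0).
    by apply: eq_bigr => i _; rewrite /emp !mulr_suml; apply: eq_bigr => l _; rewrite mulrAC.
  rewrite exchange_big /=; apply: eq_bigr => l _; rewrite -mulr_suml; congr (_ / _).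
  set r := rep _ _ _; rewrite (bigD1 r) //= eqxx andbT big1 ?addr0 // => i /negbTE ir.
  by rewrite [r == i]eq_sym ir andbF mul0r.
rewrite -mulr_suml exchange_big /=; congr (_ / _); apply: eq_bigr => l _.
have [n nd ->] := @Jm_Eset d L s l Ldesc.
case: n nd => [|n] nd.
  have E0 : Eset s 0 = finset.set0.
    by apply/setP => c; rewrite -(permKV s c) in_Eset inE.
  rewrite E0 eqxx big1 // => k _; rewrite eq_sym (negbTE (Eset_neq0 s k)) mul0r //.
pose k0 := Ordinal nd.
rewrite -[n]/(k0 : nat) (negbTE (Eset_neq0 s k0)) (bigD1 k0) //= eqxx mul1r big1 ?addr0 // => k kk0.
by case: eqP => [e|_]; [rewrite (@Eset_inj s k0 k e) eqxx in kk0 | rewrite mul0r].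
Qed.

Lemma emp_wS : wS S s emp = - ln (mm S delta x) / s0.
Proof.
rewrite /wS (emp_sum (fun J i => - ln (muJ S J i))) ln_mass; congr (_ / _).
apply: eq_bigr => l _; case: eqP => [->|_]; first by rewrite muJ0 ln1 oppr0.
by have [h _] := repP S (Jm L l) (x l); rewrite -(eq_muJ h).
Qed.

(** The constraint of index [k] measures the logarithmic size of the cube along [s k], which is [s0]
    up to the rounding error [kl S]. *)
Lemma emp_wcon k : 1 <= wcon S s emp k <= 1 + kl S / s0.
Proof.
have -> : wcon S s emp k = - ln (ls S x (L (s k)) (s k)) / s0.
  rewrite /wcon big_mkcond /=.
  transitivity (\sum_m \sum_i emp m i *
    (if s k \in Eset s m.+1 then - ln (lam a i (s k)) else 0)).
    apply: eq_bigr => m _; rewrite in_Eset ltnS; case: ifP => // _.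
    by rewrite big1 // => i _; rewrite mulr0.
  rewrite (emp_sum (fun J i => if s k \in J then - ln (lam a i (s k)) else 0)) ln_ls.
  congr (_ / _).
  have LH : (L (s k) <= H)%N by exact: Lf_le_Hb delta01.
  rewrite (big_ord_widen H (fun l => - ln (lam a (x l) (s k))) LH) [RHS]big_mkcond /=.
  apply: eq_bigr => l _; case: eqP => [J0|_].
    have : s k \notin Jm L l by rewrite J0 inE.
    by rewrite inE => /negbTE ->.
  rewrite inE; case: ifP => // sl; rewrite /lam.
  by have [/eqJP/(_ (s k)) h _] := repP S (Jm L l) (x l); have [<- _] := h (ltac:(by rewrite inE)).
have /andP[h1 h2] := ls_Lf S x (s k) delta01.
have lm0 := lmin_gt0 S; have l0 := ls_gt0 S x (L (s k)) (s k).
have {}h2 : ln (ls S x (L (s k)) (s k)) <= - s0.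
  by rewrite -[leRHS]expRK ler_ln ?posrE ?expR_gt0.
have {}h1 : - kl S - s0 <= ln (ls S x (L (s k)) (s k)).
  have -> : - kl S - s0 = ln (lmin S * delta) by rewrite lnM ?posrE ?expR_gt0 // expRK /kl opprK.
  by rewrite ler_ln ?posrE ?mulr_gt0 ?expR_gt0.
rewrite ler_pdivlMr // mul1r lerNr h2 /= ler_pdivrMr // mulrDl mul1r divfK ?gt_eqF //.
by rewrite lerNl opprD addrC.
Qed.

Lemma emp_le k i : emp k i <= (1 + kl S / s0) / ll S.
Proof.
have ll0 := ll_gt0 S; rewrite ler_pdivlMr //.
have /andP[_ h] := emp_wcon k; apply: le_trans h.
have nn m j : 0 <= emp m j * - ln (lam a j (s k)).
  rewrite mulr_ge0 ?emp_ge0 //; have /andP[h _] := ln_lam_bounds S j (s k).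
  exact: le_trans (ltW ll0) h.
rewrite /wcon (bigD1 k) //= (bigD1 i) //= -addrA.
apply: (@le_trans _ _ (emp k i * - ln (lam a i (s k)))).
  by rewrite ler_wpM2l ?emp_ge0 //; have /andP[] := ln_lam_bounds S i (s k).
by rewrite lerDl addr_ge0 ?sumr_ge0 // => m _; apply: sumr_ge0.
Qed.
End EmpiricalWeights.

Section LimitWeights.
Variables (R : realType) (d N : nat) (S : sponge R d N).
Local Notation a := (sa S).
Local Notation t := (st S).
Implicit Types (x y : Sigma N) (k m : 'I_d) (i j : 'I_N).

(** Produces a point of some polytope from cubes at scales tending to 0; [e] will be 1 for the
    minimum and -1 for the maximum. Membership in [Aset] and support in [Iset] are included so that
    the limit comes from a point of [Qset]. *)
Lemma limit_weights (e b : R) :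
  (forall s1 : R, exists (s0 : R) x, s1 <= s0 /\ e * - ln (mm S (expR (- s0)) x) <= s0 * b) ->
  exists (s : {perm 'I_d}) (w : 'I_d -> 'I_N -> R),
    [/\ Aset a s, isW S s w, forall k i, ~~ Iset a t s k.+1 i -> w k i = 0 & e * wS S s w <= b].
Proof.
move=> h.
have [s [As hs]] : exists s, Aset a s /\ forall s1 : R, exists (s0 : R) x,
    [/\ s1 <= s0, descending (Lf S (expR (- s0)) x) s & e * - ln (mm S (expR (- s0)) x) <= s0 * b].
  apply: contrapT => nex.
  have {}nex (s : {perm 'I_d}) : exists s1 : R, Aset a s -> forall (s0 : R) x, s1 <= s0 ->
      descending (Lf S (expR (- s0)) x) s -> ~ (e * - ln (mm S (expR (- s0)) x) <= s0 * b).
    apply: contrapT => n1; apply: nex; exists s; split.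
      by apply: contrapT => nA; apply: n1; exists 0 => /nA.
    move=> s1; apply: contrapT => n2; apply: n1; exists s1 => _ s0 x h1 h2 h3.
    by apply: n2; exists s0, x.
  have [f fP] := choice nex.
  (* If each ordering in [Aset] failed beyond some threshold, a cube beyond the largest of these
     finitely many thresholds would have no ordering left. *)
  have [s0 [x [s0f hx]]] := h (Num.max 1 (\big[Num.max/0]_s f s)).
  have s00 : 0 < s0 by apply: lt_le_trans s0f; rewrite lt_max ltr01.
  have [s As sP] := Aset_Lf S x (exp01 s00).
  apply: (fP s As s0 x) => //; apply: le_trans s0f.
  by rewrite le_max le_bigmax orbT.
have {hs}hs (n : nat) : exists p : R * Sigma N, [/\ n.+1%:R <= p.1,
    descending (Lf S (expR (- p.1)) p.2) s & e * - ln (mm S (expR (- p.1)) p.2) <= p.1 * b].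
  by have [s0 [x hx]] := hs n.+1%:R; exists (s0, x).
have [f fP] := choice hs.
have f1 n : 1 <= (f n).1 by have [h1 _ _] := fP n; apply: le_trans h1; rewrite ler1n.
have f0 n : 0 < (f n).1 by exact: lt_le_trans (f1 n).
have fd n (k1 k2 : 'I_d) : (k2 : nat) = k1.+1 ->
    (Lf S (expR (- (f n).1)) (f n).2 (s k2) <= Lf S (expR (- (f n).1)) (f n).2 (s k1))%N.
  by have [_ h1 _] := fP n; move=> /h1[].
pose W n k i := emp S s (f n).1 (f n).2 k i.
(* Along one ultrafilter all frequencies converge at once, without successive extractions of
   subsequences. *)
have [U [UU oU]] := ultraFilterLemma eventually_filter.
have FU : ProperFilter U by exact: ultra_proper.
have kl0 := kl_gt0 S; have ll0 := ll_gt0 S.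
have lim k i : exists l : R, W n k i @[n --> U] --> l.
  apply: (@ultra_bounded_cvg _ _ UU _ ((1 + kl S) / ll S)) => n.
  rewrite emp_ge0 //=; apply: le_trans (emp_le (f0 n) (fd n) k i) _.
  rewrite ler_pM2r ?invr_gt0 // lerD2l ler_pdivrMr // ler_peMr //; exact: ltW.
have [w wP] : exists w : 'I_d -> 'I_N -> R, forall k i, W n k i @[n --> U] --> w k i.
  have [w0 w0P] := choice (fun p : 'I_d * 'I_N => lim p.1 p.2).
  by exists (fun k i => w0 (k, i)) => k i; exact: (w0P (k, i)).
have lin (G : 'I_d -> 'I_N -> R) (Q : pred 'I_d) :
    \sum_(k | Q k) \sum_i W n k i * G k i @[n --> U] --> \sum_(k | Q k) \sum_i w k i * G k i.
  apply: cvg_sum => k; apply: cvg_sum => i; apply: cvgM => //; exact: cvg_cst.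
exists s, w; split=> //.
- split=> [k i|k].
    rewrite -(cvg_lim (@Rhausdorff R) (wP k i)).
    apply: limr_ge; first by apply/cvg_ex; exists (w k i).
    by apply: filterS filterT => n _; exact: emp_ge0.
  have c1 : wcon S s (W n) k @[n --> U] --> wcon S s w k.
    exact: (lin (fun _ i => - ln (lam a i (s k))) (fun m => (k <= m)%N)).
  have c2 : wcon S s (W n) k @[n --> \oo] --> (1 : R).
    apply: (@squeeze_cvgr _ _ _ _ (fun=> 1) (fun n => 1 + kl S * n.+1%:R^-1)).
    - apply: nearW => n; have /andP[h1 h2] := emp_wcon (f0 n) (fd n) k.
      rewrite h1 /= (le_trans h2) // lerD2l ler_pM2l // lef_pV2 ?posrE //.
      by have [] := fP n.
    - exact: cvg_cst.
    - rewrite -[X in _ --> X]addr0 -[X in _ --> _ + X](mulr0 (kl S)).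
      apply: cvgD; first exact: cvg_cst.
      apply: cvgM; first exact: cvg_cst.
      exact: cvg_harmonic.
  apply: (cvg_unique (@Rhausdorff R) c1) => A nA; apply: oU; exact: c2.
- move=> k i nI; apply: (cvg_unique (@Rhausdorff R) (wP k i)).
  rewrite (_ : (fun n => W n k i) = (fun=> 0)); first exact: cvg_cst.
  by apply/funext => n; exact: emp_Iset.
- have c1 : e * wS S s (W n) @[n --> U] --> e * wS S s w.
    apply: cvgM; first exact: cvg_cst.
    exact: (lin (fun k i => - ln (muJ S (Eset s k.+1) i)) xpredT).
  rewrite -(cvg_lim (@Rhausdorff R) c1).
  apply: limr_le; first by apply/cvg_ex; exists (e * wS S s w).
  apply: filterS filterT => n _; rewrite (emp_wS (fd n)) mulrA ler_pdivrMr //.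
  by have [_ _] := fP n; rewrite [b * _]mulrC.
Qed.
End LimitWeights.


(** * Change of variables, duality and the Lalley-Gatzouras case *)

Section Variational.
Variables (R : realType) (d N : nat) (S : sponge R d N).
Local Notation a := (sa S).
Local Notation t := (st S).
Local Notation mu := (smu S).
Implicit Types (k m : 'I_d) (i j : 'I_N) (w : 'I_d -> 'I_N -> R) (p : nat -> 'I_N -> R).
Variable s : {perm 'I_d}.

Lemma lamSE i k : lamS a s i k.+1 = lam a i (s k).
Proof. by rewrite /lamS /sigc /= valK. Qed.

Lemma Iset_rep n i : Iset a t s n (rep S (Eset s n) i).
Proof.
apply/asboolP => j /overlapE; have [h1 h2] := repP S (Eset s n) i => ji.
by apply: h2; rewrite (eqJ_left _ h1) eqJ_sym.
Qed.

Lemma munE n i : Iset a t s n i -> mun a t mu s n i = muJ S (Eset s n) i.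
Proof.
move=> /asboolP Ii; apply: eq_bigl => j; rewrite /Prep.
case: arg_minnP => [|k /asboolP/overlapE kj kmin]; first exact/asboolP/overlapE/eqJ_refl.
apply/eqP/idP => [<- //|ij]; apply/val_inj/eqP; rewrite eqn_leq kmin /=; last exact/asboolP/overlapE.
apply: Ii; apply/overlapE; apply: eqJ_trans kj _; by rewrite eqJ_sym.
Qed.

Lemma chiE p k m : Pvalid a t s p ->
  chi a t s p k.+1 m.+1 = \sum_i p m.+1 i * - ln (lam a i (s k)).
Proof.
move=> pv; have [_ [p0 _]] := pv m.+1 (ltn_ord m).
rewrite /chi big_mkcond /= -sumrN; apply: eq_bigr => i _.
by case: ifP => [_|/negbT /p0 ->]; [rewrite lamSE mulrN | rewrite mul0r oppr0].
Qed.

Lemma chi_gt0 p k : Pvalid a t s p -> 0 < chi a t s p k.+1 k.+1.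
Proof.
move=> pv; have [pp [p0 p1]] := pv k.+1 (ltn_ord k).
rewrite chiE //; apply: (lt_le_trans (ll_gt0 S)).
have p1' : \sum_i p k.+1 i = 1.
  by rewrite -[RHS]p1 [RHS]big_mkcond; apply: eq_bigr => i _; case: ifP => // /negbT/p0.
rewrite -[leLHS]mul1r -p1' mulr_suml; apply: ler_sum => i _.
by rewrite ler_wpM2l //; have /andP[] := ln_lam_bounds S i (s k).
Qed.

Lemma Caux_fuel p f f' n : (n <= d)%N -> (d < n + f)%N -> (d < n + f')%N ->
  Caux a t s p f n = Caux a t s p f' n.
Proof.
elim: f f' n => [|f IH] f' n nd; first by rewrite addn0 ltnNge nd.
case: f' => [_|f']; first by rewrite addn0 ltnNge nd.
move=> h h' /=; congr ((1 - _) / _); apply: eq_big_nat => m /andP[nm md].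
by congr (_ * _); apply: IH; rewrite ?ltnS // in md *; lia.
Qed.

Lemma sum_nat_ord (F : nat -> R) (n : nat) :
  \sum_(n.+1 <= m < d.+1) F m = \sum_(m < d | (n <= m)%N) F m.+1.
Proof. by rewrite big_add1 /= big_geq_mkord. Qed.

Lemma CnE p k : Cn a t s p k.+1 =
  (1 - \sum_(m < d | (k < m)%N) Cn a t s p m.+1 * chi a t s p k.+1 m.+1) / chi a t s p k.+1 k.+1.
Proof.
rewrite {1}/Cn -(sum_nat_ord (fun m : nat => Cn a t s p m * chi a t s p k.+1 m)) /=.
congr ((1 - _) / _); apply: eq_big_nat => m /andP[km md]; congr (_ * _).
by apply: Caux_fuel; rewrite ?ltnS // in md *; lia.
Qed.

Lemma big_ge_recl (F : 'I_d -> R) k :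
  \sum_(m < d | (k <= m)%N) F m = F k + \sum_(m < d | (k < m)%N) F m.
Proof.
rewrite (bigD1 k) //=; congr (_ + _); apply: eq_bigl => m.
by rewrite [(k < m)%N]ltn_neqAle [k == m :> nat]eq_sym andbC.
Qed.

(** The recursion for the coefficients is back substitution in a triangular linear system with
    positive diagonal; this is the system itself, and [Cn_unique] is uniqueness of its solution. *)
Lemma Cn_sum p k : Pvalid a t s p ->
  \sum_(m < d | (k <= m)%N) Cn a t s p m.+1 * chi a t s p k.+1 m.+1 = 1.
Proof.
move=> pv; rewrite big_ge_recl CnE divfK ?subrK // gt_eqF //; exact: chi_gt0.
Qed.

Lemma downward_ind (Q : 'I_d -> Prop) :
  (forall k, (forall m, (k < m)%N -> Q m) -> Q k) -> forall k, Q k.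
Proof.
move=> h k; have [n] := ubnP (d - k); elim: n k => // n IH k; rewrite ltnS => dn.
apply: h => m km; apply: IH; apply: leq_trans dn.
by have := ltn_ord m; have := ltn_ord k; lia.
Qed.

Lemma Cn_unique p (u : 'I_d -> R) : Pvalid a t s p ->
  (forall k, \sum_(m < d | (k <= m)%N) u m * chi a t s p k.+1 m.+1 = 1) ->
  forall k, Cn a t s p k.+1 = u k.
Proof.
move=> pv hu; apply: downward_ind => k IH.
have := hu k; rewrite big_ge_recl CnE => e.
rewrite (eq_bigr (fun m => u m * chi a t s p k.+1 m.+1)) => [|m km]; last by rewrite IH.
by rewrite -e addrK mulfK // gt_eqF // chi_gt0.
Qed.

Lemma sum_prob_wcon p (u : 'I_d -> R) k : Pvalid a t s p ->
  wcon S s (fun m i => u m * p m.+1 i) k = \sum_(m < d | (k <= m)%N) u m * chi a t s p k.+1 m.+1.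
Proof.
move=> pv; apply: eq_bigr => m _; rewrite chiE // mulr_sumr.
by apply: eq_bigr => i _; rewrite mulrA.
Qed.

Lemma SsigE p : Pvalid a t s p ->
  Ssig a t mu s p = wS S s (fun m i => Cn a t s p m.+1 * p m.+1 i).
Proof.
move=> pv; rewrite /Ssig sum_nat_ord -sumrN; apply: eq_bigr => k _.
have [_ [p0 _]] := pv k.+1 (ltn_ord k).
rewrite big_mkcond mulr_sumr -sumrN; apply: eq_bigr => i _; case: ifP => [Ii|/negbT /p0 ->].
  by rewrite munE // mulrA mulrN.
by rewrite !mulr0 mul0r oppr0.
Qed.

Lemma Qset_weights p : Qset a t s p ->
  exists2 w, isW S s w & wS S s w = Ssig a t mu s p.
Proof.
move=> [pv C0]; exists (fun k i => Cn a t s p k.+1 * p k.+1 i); last by rewrite SsigE.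
split=> [k i|k]; last by rewrite sum_prob_wcon // Cn_sum.
have [pp _] := pv k.+1 (ltn_ord k).
by rewrite mulr_ge0 // C0 // ltn_ord.
Qed.

Lemma weights_Qset w : isW S s w -> (forall k i, ~~ Iset a t s k.+1 i -> w k i = 0) ->
  exists2 p, Qset a t s p & Ssig a t mu s p = wS S s w.
Proof.
move=> [w0 wc] wI.
pose u k := \sum_i w k i.
have u0 k : 0 <= u k by apply: sumr_ge0.
(* Where the total weight vanishes, any probability vector on [Iset] will do; a point mass at a
   class representative is taken. *)
pose pk k i := if u k == 0 then (i == rep S (Eset s k.+1) (si0 S))%:R else w k i / u k.
pose p (n : nat) i := if insub n.-1 is Some k then pk k i else 0.
have pE k i : p k.+1 i = pk k i by rewrite /p /= valK.
have wE k i : w k i = u k * p k.+1 i.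
  rewrite pE /pk; case: eqP => [uk|/eqP uk]; last by rewrite mulrC divfK.
  rewrite uk mul0r; have := uk; rewrite /u => /eqP; rewrite psumr_eq0 // => /allP/(_ i).
  by rewrite mem_index_enum => /(_ isT)/eqP.
have pv : Pvalid a t s p.
  move=> n /andP[n1 nd]; have nE : n = (Ordinal (ltac:(by rewrite prednK) : (n.-1 < d)%N)).+1 by rewrite /= prednK.
  move: nE; set k := Ordinal _ => ->.
  have pI i : ~~ Iset a t s k.+1 i -> p k.+1 i = 0.
    move=> nI; rewrite pE /pk; case: eqP => _; last by rewrite wI ?mul0r.
    case: eqP => // ie; move: nI; by rewrite ie Iset_rep.
  split; [|split] => //.
    by move=> i; rewrite pE /pk; case: eqP => _ //; rewrite divr_ge0.
  transitivity (\sum_i p k.+1 i).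
    rewrite big_mkcond; apply: eq_bigr => i _; by case: ifP => // /negbT/pI.
  under eq_bigr do rewrite pE /pk.
  case: eqP => [_|/eqP uk]; last by rewrite -mulr_suml divff.
  by rewrite (bigD1 (rep S (Eset s k.+1) (si0 S))) //= eqxx big1 ?addr0 // => i /negbTE ->.
have wE' : w = fun m i => u m * p m.+1 i by apply/funext => k; apply/funext => i; exact: wE.
have Cu : forall k, Cn a t s p k.+1 = u k.
  by apply: Cn_unique => // k; rewrite -sum_prob_wcon // -wE'.
exists p; first split=> //.
  move=> n /andP[n1 nd]; have nd' : (n.-1 < d)%N by rewrite prednK.
  by rewrite -(prednK n1) -[n.-1]/(Ordinal nd' : nat) Cu.
rewrite SsigE // [in RHS]wE'; congr wS.
by apply/funext => k; apply/funext => i; rewrite Cu.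
Qed.

(* Feasibility for the dual program; [e = 1] for the minimum, [e = -1] for the maximum. The increments
   of [Sund] and [Sbar] are feasible. *)
Definition dualok (e : R) (y : 'I_d -> R) := forall k i,
  e * (\sum_(m < d | (m <= k)%N) y m * - ln (lam a i (s m))) <= e * - ln (muJ S (Eset s k.+1) i).

Lemma dual_swap w (y : 'I_d -> R) :
  \sum_k \sum_i w k i * (\sum_(m < d | (m <= k)%N) y m * - ln (lam a i (s m))) =
  \sum_m y m * wcon S s w m.
Proof.
rewrite /wcon; under [RHS]eq_bigr do rewrite mulr_sumr.
rewrite [RHS](exchange_big_dep xpredT) //=; apply: eq_bigr => k _.
under [RHS]eq_bigr do rewrite mulr_sumr.
rewrite exchange_big /=; apply: eq_bigr => i _; rewrite mulr_sumr.
by apply: eq_bigr => m _; ring.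
Qed.

(** The constraint values [wcon S s w m] are not replaced by 1, so that the bound also applies to
    empirical weights, whose constraints hold only approximately. *)
Lemma weak_duality e w y : (forall k i, 0 <= w k i) -> dualok e y ->
  e * \sum_m y m * wcon S s w m <= e * wS S s w.
Proof.
move=> w0 dy; rewrite -dual_swap /wS !mulr_sumr; apply: ler_sum => k _.
rewrite !mulr_sumr; apply: ler_sum => i _.
by rewrite mulrCA [leRHS]mulrCA ler_wpM2l.
Qed.

(** Complementary slackness: weight sits only on dual constraints that are equalities. *)
Lemma tight_duality w (y : 'I_d -> R) : (forall k i, w k i != 0 ->
    \sum_(m < d | (m <= k)%N) y m * - ln (lam a i (s m)) = - ln (muJ S (Eset s k.+1) i)) ->
  \sum_m y m * wcon S s w m = wS S s w.
Proof.
move=> h; rewrite -dual_swap; apply: eq_bigr => k _; apply: eq_bigr => i _.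
by have [->|/h ->] := eqVneq (w k i) 0; rewrite ?mul0r.
Qed.

Section Extremal.
Variable ext : set R -> R.
Let Sv n := Saux a t mu ext s n n.

Lemma Saux_fuel f f' n : (n <= f)%N -> (n <= f')%N -> Saux a t mu ext s f n = Saux a t mu ext s f' n.
Proof.
have [b] := ubnP n; elim: b n f f' => // b IH [|n] [|f] [|f'] //; rewrite !ltnS => nb nf nf' /=.
rewrite (IH n f f') //; congr (_ + ext _).
congr (image _ _); apply/funext => i; congr (_ * (_ + _)).
apply: eq_big_nat => m /andP[m1 mn]; rewrite ltnS in mn.
by rewrite (IH m.-1 f f') ?(IH m f f') //; lia.
Qed.

(** Dual variables. [yval k i] is the value of the [k]-th variable that turns the constraint of
    letter [i] into an equality, the earlier ones being fixed; taking the extremum over [i] is the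
    greedy solution of a triangular dual program. *)
Definition yv (k : nat) : R := Sv k.+1 - Sv k.
Definition yval (k : nat) i : R := (ln (lamS a s i k.+1))^-1 *
  (ln (mun a t mu s k.+1 i) + \sum_(m < k) - yv m * ln (lamS a s i m.+1)).

Lemma yvE (k : nat) : yv k = ext [set yval k i | i in [set i | Iset a t s k.+1 i]].
Proof.
rewrite /yv {1}/Sv /= [X in X - _]addrC addrK; congr ext.
congr (image _ _); apply/funext => i; congr (_ * (_ + _)).
rewrite big_add1 /= big_mkord; apply: eq_bigr => m _.
by rewrite /yv opprB /Sv; congr ((_ - _) * _); apply: Saux_fuel => //; exact: ltnW.
Qed.

Lemma sum_yv : \sum_(k < d) yv k = Sv d.
Proof.
by rewrite -(big_mkord xpredT yv) telescope_sumr // subr0.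
Qed.

Lemma dual_yv e k i : Iset a t s k.+1 i -> e * yv k <= e * yval k i ->
  e * (\sum_(m < d | (m <= k)%N) yv m * - ln (lam a i (s m))) <= e * - ln (muJ S (Eset s k.+1) i).
Proof.
move=> Ii h.
have l0 : 0 < - ln (lam a i (s k)).
  by have /andP[h1 _] := ln_lam_bounds S i (s k); exact: lt_le_trans (ll_gt0 S) h1.
have -> : \sum_(m < d | (m <= k)%N) yv m * - ln (lam a i (s m)) =
    yv k * - ln (lam a i (s k)) + \sum_(m < k) - yv m * ln (lamS a s i m.+1).
  rewrite (bigD1 k) //=; congr (_ + _).
  rewrite (big_ord_widen d (fun m : nat => - yv m * ln (lamS a s i m.+1))) ?(ltnW (ltn_ord k)) //.
  apply: eq_big => [m|m _]; last by rewrite lamSE mulrN mulNr.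
  by rewrite andbC -ltn_neqAle.
have : e * yv k * - ln (lam a i (s k)) <= e * yval k i * - ln (lam a i (s k)).
  by rewrite ler_wpM2r // ltW.
rewrite /yval lamSE munE //; set r := \sum_(m < k) _.
have ln0 : ln (lam a i (s k)) != 0 by rewrite -oppr_eq0 gt_eqF.
have -> : e * ((ln (lam a i (s k)))^-1 * (ln (muJ S (Eset s k.+1) i) + r)) * - ln (lam a i (s k)) =
  e * - ln (muJ S (Eset s k.+1) i) - e * r by field.
by rewrite lerBrDr -mulrA -mulrDr.
Qed.

Lemma tight_yv k i : Iset a t s k.+1 i -> yv k = yval k i ->
  \sum_(m < d | (m <= k)%N) yv m * - ln (lam a i (s m)) = - ln (muJ S (Eset s k.+1) i).
Proof.
move=> Ii e; apply: le_anti.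
have := @dual_yv 1 k i Ii; have := @dual_yv (-1) k i Ii.
by rewrite e !mulN1r !mul1r !lerN2 => -> // ->.
Qed.

Lemma dualok_yv e : (forall k i, Iset a t s k.+1 i -> e * yv k <= e * yval k i) -> dualok e (fun k => yv k).
Proof.
move=> h k i; pose r := rep S (Eset s k.+1) i.
have [e1 _] := repP S (Eset s k.+1) i; have /eqJP e2 := e1.
rewrite (eq_muJ e1) (eq_bigr (fun m => yv m * - ln (lam a r (s m)))).
  by apply: dual_yv; rewrite ?Iset_rep // h // Iset_rep.
by move=> m mk; rewrite /lam; have [-> _] := e2 (s m) (ltac:(by rewrite in_Eset)).
Qed.
End Extremal.

Definition LGo := forall i n, (1 <= n < d)%N -> lamS a s i n.+1 <= lamS a s i n.

Lemma LG_lam i k k' : LGo -> (k' : nat) = k.+1 -> lam a i (s k') <= lam a i (s k).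
Proof.
move=> lg e; rewrite -!lamSE e; apply: lg.
by apply/andP; split=> //; rewrite -e; exact: ltn_ord.
Qed.

(** Along a Lalley-Gatzouras ordering exponents increase with the index, so the terms with [m > k]
    in the equation of index [k] sum to at most the left side of the next equation, which is 1. *)
Lemma LG_Cn p : LGo -> Pvalid a t s p -> forall k, 0 <= Cn a t s p k.+1.
Proof.
move=> lg pv; apply: downward_ind => k IH.
rewrite CnE divr_ge0 ?(ltW (chi_gt0 _ pv)) // subr_ge0.
have [kd|kd] := ltnP k.+1 d; last first.
  rewrite big1 ?ler01 // => m km.
  by have := ltn_ord m; rewrite ltnNge (leq_trans kd).
pose k' := Ordinal kd.
apply: (@le_trans _ _ (\sum_(m < d | (k' <= m)%N) Cn a t s p m.+1 * chi a t s p k'.+1 m.+1)); last by rewrite Cn_sum.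
apply: ler_sum => m km; rewrite ler_wpM2l ?IH // !chiE //.
have [pp _] := pv m.+1 (ltn_ord m).
apply: ler_sum => i _; rewrite ler_wpM2l // lerN2 ler_ln ?posrE ?lam_gt0 //.
exact: LG_lam.
Qed.

(** Point masses at the letters attaining the successive extrema put weight on tight constraints
    only. Such a choice yields admissible weights because [LG_Cn] makes the coefficients
    nonnegative. *)
Lemma LG_tight (ext : set R -> R) : LGo ->
  (forall k, exists2 i, Iset a t s k.+1 i & yv ext k = yval ext k i) ->
  exists2 w, isW S s w & wS S s w = Saux a t mu ext s d d.
Proof.
move=> lg hk; have hk' k : exists i, Iset a t s k.+1 i /\ yv ext k = yval ext k i.
  by have [i] := hk k; exists i.
have [g gP] := choice hk'.
pose p (n : nat) i : R := if insub n.-1 is Some k then (i == g k)%:R else 0.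
have pE k i : p k.+1 i = (i == g k)%:R by rewrite /p /= valK.
have pv : Pvalid a t s p.
  move=> n /andP[n1 nd]; have nd' : (n.-1 < d)%N by rewrite prednK.
  rewrite -(prednK n1) -[n.-1]/(Ordinal nd' : nat); set k := Ordinal nd'.
  split; first by move=> i; rewrite pE.
  split=> [i|].
    by rewrite pE; case: eqP => // -> ; have [-> _] := gP k.
  rewrite (bigD1 (g k)) /=; last by have [] := gP k.
  by rewrite (pE k) eqxx big1 ?addr0 // => i /andP[_ /negbTE ig]; rewrite (pE k) ig.
pose w k i := Cn a t s p k.+1 * p k.+1 i.
have wW : isW S s w.
  split=> [k i|k]; first by rewrite mulr_ge0 ?LG_Cn // pE.
  by rewrite sum_prob_wcon // Cn_sum.
exists w => //; rewrite -(@tight_duality w (fun k => yv ext k)).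
  under eq_bigr do rewrite wW.2 mulr1.
  exact: sum_yv.
move=> k i; rewrite /w pE; have [-> _|_] := eqVneq i (g k); last by rewrite mulr0 eqxx.
by have [h1 h2] := gP k; exact: tight_yv.
Qed.

Lemma LG_desc delta x : LGo -> 0 < delta < 1 -> forall k1 k2, (k2 : nat) = k1.+1 ->
  (Lf S delta x (s k2) <= Lf S delta x (s k1))%N.
Proof.
move=> lg d01 k1 k2 e; rewrite leqNgt; apply/negP => lt.
have [L0 /andP[_ h2]] := LfP S x (s k2) d01; have [L0' /andP[h1 _]] := LfP S x (s k1) d01.
have : ls S x (Lf S delta x (s k1)) (s k2) <= delta.
  apply: le_trans h1; apply: ler_prod => l _; rewrite (ltW (lam_gt0 _ _ _)) /=; exact: LG_lam.
rewrite leNgt => /negP; apply; apply: (lt_le_trans h2).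
have [->//|ne] := eqVneq (Lf S delta x (s k1)) (Lf S delta x (s k2)).-1.
by rewrite ltW // ls_lt // ltn_neqAle ne -ltnS prednK.
Qed.

(** The cutoffs of every word decrease along [s], so weak duality applies to the frequencies of each
    single cube, with no passage to the limit and without [s] being in [Aset]. *)
Lemma LG_mass e (y : 'I_d -> R) : LGo -> dualok e y ->
  exists C : R, forall (s0 : R) x, 0 < s0 ->
    s0 * (e * \sum_k y k) - C <= e * - ln (mm S (expR (- s0)) x).
Proof.
move=> lg dy; exists (\sum_k `|e * y k| * kl S) => s0 x s00.
have Ld := LG_desc x lg (exp01 s00).
have := @weak_duality e (emp S s s0 x) y (fun k i => emp_ge0 S s x s00 k i) dy.
rewrite (emp_wS Ld) [e * (_ / _)]mulrA ler_pdivlMr //; apply: le_trans.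
rewrite !mulr_sumr mulr_suml -sumrB; apply: ler_sum => k _.
have /andP[c1 c2] := emp_wcon s00 Ld k.
set c := wcon _ _ _ _ in c1 c2 *.
have : `|e * y k * ((c - 1) * s0)| <= `|e * y k| * kl S.
  rewrite normrM ler_wpM2l // ger0_norm ?mulr_ge0 ?subr_ge0 ?(ltW s00) //.
  by rewrite -ler_pdivlMr // lerBlDl.
rewrite ler_norml => /andP[h _].
have -> : e * (y k * c) * s0 = s0 * (e * y k) + e * y k * ((c - 1) * s0) by ring.
by rewrite lerD2l.
Qed.
End Variational.

Section FiniteExtrema.
Variables (R : realType) (I : finType) (Q : pred I) (f : I -> R).
Hypothesis Q0 : exists i, Q i.

Lemma inf_finite : exists2 i, Q i & inf [set f i | i in [set i | Q i]] = f i /\ forall j, Q j -> f i <= f j.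
Proof.
have [i0 Qi0] := Q0; case: (@arg_minP _ _ _ i0 Q f Qi0) => i Qi imin; exists i => //.
split=> //; apply: le_anti; apply/andP; split.
- by apply: ge_inf; [exists (f i) => _ [j Qj <-]; exact: imin | exists i].
- by apply: lb_le_inf; [exists (f i), i | move=> _ [j Qj <-]; exact: imin].
Qed.

Lemma sup_finite : exists2 i, Q i & sup [set f i | i in [set i | Q i]] = f i /\ forall j, Q j -> f j <= f i.
Proof.
have [i0 Qi0] := Q0; case: (@arg_maxP _ _ _ i0 Q f Qi0) => i Qi imax; exists i => //.
split=> //; apply: le_anti; apply/andP; split.
- by apply: ge_sup; [exists (f i), i | move=> _ [j Qj <-]; exact: imax].
- by apply: ub_le_sup; [exists (f i) => _ [j Qj <-]; exact: imax | exists i].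
Qed.
End FiniteExtrema.


Lemma rate_sub (R : realType) (g1 g2 : R -> R) t1 t2 : rate g1 t1 -> rate g2 t2 ->
  rate (fun s => g1 s - g2 s) (t1 - t2).
Proof.
move=> r1 r2 e e0; have e2 : 0 < e / 2 by rewrite divr_gt0.
have [s1 h1] := r1 _ e2; have [s2 h2] := r2 _ e2; exists (Num.max s1 s2) => s.
rewrite ge_max => /andP[/h1 {}h1 /h2 {}h2].
have -> : (g1 s - g2 s) / s - (t1 - t2) = (g1 s / s - t1) - (g2 s / s - t2) by rewrite mulrBl; ring.
apply: (le_trans (ler_normB _ _)); rewrite [leRHS](splitr e); exact: lerD.
Qed.

(** Arbitrarily large [s] suffice, which suits the lower box dimension: it controls balls only along
    a sequence of radii. *)
Lemma rate_le_freq (R : realType) (g : R -> R) tau b c : rate g tau ->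
  (forall s1, exists2 s, s1 <= s & g s <= s * b + c) -> tau <= b.
Proof.
move=> rg h; rewrite leNgt; apply/negP => lt.
pose e := (tau - b) / 3.
have e0 : 0 < e by rewrite divr_gt0 // subr_gt0.
have [s3 h3] := rg e e0.
have [s] := h (Num.max s3 (Num.max 1 (`|c| / e))).
rewrite !ge_max => /and3P[/h3 {}h3 s1 sc] h4.
have s0 : 0 < s by exact: lt_le_trans s1.
move: h3; rewrite ler_norml => /andP[+ _]; rewrite lerBrDr ler_pdivlMr // => h5.
rewrite ler_pdivrMr // in sc.
have := ler_norm c; have te : tau = b + 3 * e by rewrite /e; field.
rewrite te in h5; move: h4 h5 sc s0 e0; clear; nra.
Qed.

(** * Dimensions of the measure from the spectrum *)

Section Dimensions.
Variables (R : realType) (d N : nat) (S : sponge R d N).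
Variables (dm : measure_display) (T : measurableType dm) (P : probability T R).
Variables (X : T -> Sigma N).
Hypothesis XP : iid_law (smu S) P X.
Local Notation a := (sa S).
Local Notation t := (st S).
Local Notation mu := (smu S).
Local Notation nub := (nub S P X).
Local Notation nuX := (nuX S P X).
Local Notation lnT := (lnT S P X).
Local Notation CN := (CN S).
Implicit Types (x y : Sigma N) (q : R).
Variable Tf : R -> R.
Hypothesis TfP : forall q, rate (lnT q) (Tf q).

Lemma CN_ge0 : 0 <= CN.
Proof. by rewrite divr_ge0 ?(ltW (ll_gt0 S)) // ln_ge0 // (N_ge1 S). Qed.

(** A word realizing [w] at scale [expR (- s0)] has logarithmic measure [- s0 * wS S s w] up to a
    bounded error; this and the errors [kl] and [Cg] disappear as [s0] grows. *)
Lemma Tf_ge_weights q s w : isW S s w -> - q * wS S s w <= Tf q.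
Proof.
move=> wW; have [C hC] := weights_realized wW.
have C0 : 0 <= C by have [x h] := hC 1 ltr01; exact: le_trans h.
rewrite leNgt; apply/negP => lt.
have kl0 := kl_gt0 S.
pose g := - q * wS S s w - Tf q.
have g0 : 0 < g by rewrite subr_gt0.
pose B := `|kl S * Tf q| + `|q| * (C + Cg S) + 1.
pose s0 := Num.max 1 (B / g).
have s01 : 1 <= s0 by rewrite le_max lexx.
have s0B : B <= s0 * g by rewrite -ler_pdivrMr // le_max lexx orbT.
have s00 : 0 < s0 by exact: lt_le_trans s01.
have [x hx] := hC s0 s00.
have := lnT_ge_mm XP x (TfP q) (exp01 s00).
rewrite expRK opprK ler_pdivrMr ?addr_gt0 // => h.
set L := ln _ in hx h.
have b1 : - (`|q| * C) <= q * (L + s0 * wS S s w).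
  have : `|q * (L + s0 * wS S s w)| <= `|q| * C by rewrite normrM ler_wpM2l.
  by rewrite ler_norml => /andP[].
have b2 := ler_norm (kl S * Tf q).
move: s0B h b1 b2; rewrite /B /g; clear.
set u := wS _ _ _; set v := `|kl S * Tf q|; set z := `|q|; set y := Cg S; set k := kl S.
clearbody u v z y k L; move=> *; nra.
Qed.

Lemma Tf_le_mm q e g s1 : q = e * `|q| ->
  (forall s x, s1 <= s -> s * g <= e * - ln (mm S (expR (- s)) x)) -> Tf q <= CN - `|q| * g.
Proof.
move=> qe h; apply: (lnT_le_mm XP (s1 := s1) (TfP q)) => s x /(h s x) {}h.
rewrite {1}qe mulrN mulrCA -lerN2 opprK -[leRHS]mulNr -mulrN.
have : `|q| * (s * g) <= `|q| * (e * - ln (mm S (expR (- s)) x)) by rewrite ler_wpM2l.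
by move=> h'; apply: (le_trans h'); rewrite le_eqVlt; apply/orP; left; apply/eqP; ring.
Qed.

Lemma Tf_le_approx q v : (forall g, g < v -> Tf q <= CN - `|q| * g) -> Tf q <= CN - `|q| * v.
Proof.
move=> hg; rewrite leNgt; apply/negP => lt.
pose z := Tf q - (CN - `|q| * v).
have z0 : 0 < z by rewrite subr_gt0.
have q1 : 0 < `|q| + 1 by have := normr_ge0 q; lra.
have := hg (v - z / (`|q| + 1)); rewrite ltrBlDr ltrDl divr_gt0 // => /(_ isT).
have : `|q| * (z / (`|q| + 1)) < z.
  rewrite mulrCA gtr_pMr // ltr_pdivrMr // mul1r; lra.
rewrite mulrBr /z; lra.
Qed.

(* For [e = 1] this bounds [Tf q] for [q > 0] through the least weight sum, and for [e = -1] it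
   bounds [Tf q] for [q < 0] through the largest one. *)
Lemma Tf_le_weights q e v : q = e * `|q| ->
  (forall s w, Aset a s -> isW S s w -> (forall k i, ~~ Iset a t s (k : 'I_d).+1 i -> w k i = 0) ->
    v <= e * wS S s w) -> Tf q <= CN - `|q| * v.
Proof.
move=> qe h.
have hg g : g < v -> Tf q <= CN - `|q| * g.
  move=> gv.
  have [[s1 s1P]|ns] := pselect (exists s1, forall s x, s1 <= s -> s * g <= e * - ln (mm S (expR (- s)) x)).
    exact: Tf_le_mm s1P.
  have [s [w [As wW wI wg]]] : exists (s : {perm 'I_d}) (w : 'I_d -> 'I_N -> R),
    [/\ Aset a s, isW S s w, forall k i, ~~ Iset a t s (k : 'I_d).+1 i -> w k i = 0 & e * wS S s w <= g].
    apply: limit_weights => s1; apply: contrapT => n1; apply: ns; exists s1 => s x ss.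
    rewrite leNgt; apply/negP => lt; apply: n1; exists s, x; split=> //; exact: ltW.
  by have := le_trans (h s w As wW wI) wg; rewrite leNgt gv.
exact: Tf_le_approx.
Qed.

Lemma nub_powR_le_T z delta q : 0 < delta < 1 -> msupp nuX z ->
  nub z delta `^ q <= Tdelta nuX q delta.
Proof.
move=> d01 zs.
have := @Tdelta_lb_fin _ _ _ S _ _ P X XP delta q unit predT (fun=> z) d01 (fun _ _ => zs).
by rewrite big_const card_unit /= addr0; apply => [] [] [].
Qed.

Lemma T_scale q delta B : 0 < delta < 1 -> 0 < B ->
  (forall z, msupp nuX z -> nub z delta `^ q <= B `^ q) ->
  Tdelta nuX q delta <= Tdelta nuX 0 delta * B `^ q.
Proof.
move=> d01 B0 h; apply: ge_sup.
  by exists (\sum_(j < 0) 0); exists 0%N, (fun _ _ => 0); split; [case|split; [case|rewrite !big_ord0]].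
move=> _ [k [xs [h1 [h2 ->]]]].
apply: (@le_trans _ _ ((\sum_j nub (xs j) delta `^ 0) * B `^ q)); last first.
  by rewrite ler_wpM2r ?powR_ge0 //; apply: Tdelta_lb.
by rewrite mulr_suml; apply: ler_sum => j _; rewrite powRr0 mul1r; exact: h.
Qed.

Lemma lnT_scale q s b lc : 0 < s ->
  (forall z, msupp nuX z -> q * ln (nub z (expR (- s))) <= q * (lc - b * s)) ->
  lnT q s <= lnT 0 s + q * (lc - b * s).
Proof.
move=> s0 h; have e01 := exp01 s0.
have le : Tdelta nuX q (expR (- s)) <= Tdelta nuX 0 (expR (- s)) * expR (lc - b * s) `^ q.
  apply: T_scale => //; first exact: expR_gt0.
  move=> z zs; rewrite !powR_expR ?expR_gt0 //; last by apply: msupp_nub => //; exact: expR_gt0.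
  by rewrite expRK ler_expR; exact: h.
have p0 : 0 < expR (lc - b * s) `^ q by rewrite powR_gt0 // expR_gt0.
have t0 := Tdelta_gt0 XP 0 e01.
rewrite -ler_ln ?posrE ?mulr_gt0 ?(Tdelta_gt0 XP q e01) // in le.
by rewrite lnM ?posrE // ln_powR expRK in le.
Qed.

(** A uniform power bound on the balls factors out of the moment sum and leaves the packing number,
    whose rate is [Tf 0]. A large [q] makes this term negligible. *)
Lemma Tf_scale q b lc :
  (forall s1, exists2 s, s1 <= s & forall z, msupp nuX z ->
     q * ln (nub z (expR (- s))) <= q * (lc - b * s)) ->
  Tf q <= Tf 0 - q * b.
Proof.
move=> h; rewrite -lerBlDl.
apply: (rate_le_freq (c := q * lc) (rate_sub (TfP q) (TfP 0))) => s1.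
have [s] := h (Num.max 1 s1); rewrite ge_max => /andP[s11 s1s] hs; exists s => //.
have := @lnT_scale q s b lc (lt_le_trans ltr01 s11) hs.
rewrite -lerBlDl => /le_trans; apply.
by rewrite le_eqVlt; apply/orP; left; apply/eqP; ring.
Qed.

(** A single ball is an admissible family, so a bound on the spectrum is a bound on every ball. *)
Lemma nub_rate q b : Tf q < - q * b ->
  exists2 s2, 1 <= s2 & forall s z, s2 <= s -> msupp nuX z ->
    q * ln (nub z (expR (- s))) <= - q * b * s.
Proof.
move=> lt; have g0 : 0 < - q * b - Tf q by rewrite subr_gt0.
have [s2 h] := TfP q g0.
exists (Num.max 1 s2); first by rewrite le_max lexx.
move=> s z; rewrite ge_max => /andP[s1 ss2] zs.
have s0 : 0 < s by exact: lt_le_trans s1.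
have := h s ss2; rewrite ler_norml => /andP[_]; rewrite lerBlDr subrK ler_pdivrMr // => h'.
apply: le_trans h'; have e01 := exp01 s0.
have nu0 : 0 < nub z (expR (- s)) by apply: msupp_nub => //; exact: expR_gt0.
rewrite -ln_powR /lnT ler_ln ?posrE ?powR_gt0 ?Tdelta_gt0 //.
exact: nub_powR_le_T.
Qed.

Lemma nuX_nub z (delta : R) : 0 < delta -> nuX (cballE z delta) = (nub z delta)%:E.
Proof. by move=> d0; rewrite /nuX nubE // ltW. Qed.

Lemma powR_expRN (delta s : R) : 0 < delta -> delta `^ s = expR (- (s * - ln delta)).
Proof. by move=> d0; rewrite powR_expR // mulrN opprK. Qed.

Lemma expRNln (delta : R) : 0 < delta -> expR (- - ln delta) = delta.
Proof. by move=> d0; rewrite opprK lnK. Qed.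

Section FrostmanDimension.
Variable v : R.
Hypothesis Tlow : forall q, 0 < q -> - q * v <= Tf q.
Hypothesis Tup : forall q, 0 < q -> Tf q <= CN - q * v.

Lemma Tf_cvg_pinfty : Tf q / - q @[q --> +oo] --> v.
Proof.
have C0 := CN_ge0; apply/cvgrPdist_le => e e0; near=> q.
have q0 : 0 < q by near: q; exact: nbhs_pinfty_gt.
have qC : CN / e <= q by near: q; apply: nbhs_pinfty_ge; exact: num_real.
have h1 := Tlow q0; have h2 := Tup q0.
have -> : v - Tf q / - q = (q * v + Tf q) / q by field; rewrite gt_eqF.
rewrite normrM normfV (gtr0_norm q0) ler_pdivrMr //.
rewrite ler_pdivrMr // in qC.
rewrite ler_norml; move: h1 h2 qC C0; clear - XP; set w := q * v; rewrite mulNr -/w.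
clearbody w; move=> *; apply/andP; split; nra.
Unshelve. all: by end_near. Qed.

Lemma dimF_eq : dimF nuX = v%:E.
Proof.
have C0 := CN_ge0; apply/eqP; rewrite eq_le; apply/andP; split.
- apply: ge_ereal_sup => _ [s [s0 [C [C1 hC]]] <-]; rewrite lee_fin leNgt; apply/negP => vs.
  have Cp : 0 < C by exact: lt_le_trans C1.
  (* Large enough for [Tf 0 - q * s] to fall below [- q * v]. *)
  pose q := (`|Tf 0| + 1) / (s - v).
  have sv0 : 0 < s - v by rewrite subr_gt0.
  have q0 : 0 < q by rewrite divr_gt0 // ltr_wpDl.
  have : Tf q <= Tf 0 - q * s.
    apply: (@Tf_scale q s (ln C)) => s1; exists (Num.max 1 s1); first by rewrite le_max lexx orbT.
    set s' := Num.max 1 s1; have s'0 : 0 < s' by rewrite lt_max ltr01.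
    move=> z zs; have e0 := expR_gt0 (- s'); rewrite ler_pM2l //.
    have nu0 : 0 < nub z (expR (- s')) by apply: msupp_nub.
    have := hC z zs (expR (- s')) (exp01 s'0).
    rewrite nuX_nub // lee_fin -ler_ln ?posrE ?mulr_gt0 ?powR_gt0 // lnM ?posrE ?powR_gt0 //.
    by rewrite ln_powR expRK mulrN.
  have := Tlow q0; have qe : q * (s - v) = `|Tf 0| + 1 by rewrite divfK // gt_eqF.
  have := ler_norm (Tf 0); move: qe; clear - XP; move=> *; nra.
- apply/lee_addgt0Pr => e e0.
  (* If [v <= e], the exponent [v - e] may be negative, which [dimF] does not admit; the exponent 0
     serves instead. *)
  have [ve|ve] := leP v e.
    apply: (@le_trans _ _ (0%:E + e%:E)); first by rewrite -EFinD add0r lee_fin.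
    rewrite leeD2r //; apply: ereal_sup_ubound; exists 0 => //; split=> //.
    exists 1; split=> // z zs delta /andP[d0 d1]; rewrite nuX_nub // powRr0 mulr1 lee_fin.
    by apply: nub_le1 => //; exact: ltW.
  pose s := v - e; have s0 : 0 <= s by rewrite subr_ge0 ltW.
  (* Now [q * e] absorbs the constant [CN] of [Tup] with a margin of 1. *)
  pose q := (CN + 1) / e; have q0 : 0 < q by rewrite divr_gt0 // ltr_wpDl.
  have qe : q * e = CN + 1 by rewrite divfK // gt_eqF.
  have lt : Tf q < - q * s.
    apply: (le_lt_trans (Tup q0)).
    have -> : - q * s = (CN + 1) - q * v by rewrite -qe /s; ring.
    by rewrite ltrD2r ltrDl ltr01.
  have [s2 s21 h] := nub_rate lt.
  rewrite (_ : v = s + e); last by rewrite /s subrK.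
  rewrite EFinD leeD2r //; apply: ereal_sup_ubound; exists s => //; split=> //.
  have s20 : 0 <= s2 by exact: le_trans s21.
  have ss0 : 0 <= s * s2 by rewrite mulr_ge0.
  (* With this constant the bound is at least 1, hence trivial, for radii above [expR (- s2)]. *)
  exists (expR (s * s2)); split; first by rewrite -expR0 ler_expR.
  move=> z zs delta /andP[d0 d1]; rewrite nuX_nub // lee_fin powR_expRN // -expRD.
  have [dl|dl] := leP s2 (- ln delta).
    have := h _ z dl zs; rewrite expRNln //.
    rewrite -mulrA mulNr -mulrN ler_pM2l // => h'.
    have nu0 : 0 < nub z delta by apply: msupp_nub.
    rewrite -[leLHS]lnK ?posrE // ler_expR (le_trans h') // lerDr //.
  apply: (@le_trans _ _ 1); first by apply: nub_le1 => //; exact: ltW.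
  by rewrite -expR0 ler_expR subr_ge0 ler_wpM2l // ltW.
Qed.
End FrostmanDimension.

Section BoxDimension.
Variable v : R.
Hypothesis v_ge0 : 0 <= v.
Hypothesis Tlow : forall q, q < 0 -> - q * v <= Tf q.
Hypothesis Tup : forall q, q < 0 -> Tf q <= CN - q * v.

Lemma Tf_cvg_ninfty : Tf q / - q @[q --> -oo] --> v.
Proof.
have C0 := CN_ge0; apply/cvgrPdist_le => e e0; near=> q.
have q0 : q < 0 by near: q; apply: nbhs_ninfty_lt.
have qC : q <= - (CN / e) by near: q; apply: nbhs_ninfty_le; exact: num_real.
have h1 := Tlow q0; have h2 := Tup q0.
have -> : v - Tf q / - q = (q * v + Tf q) / q by field; rewrite lt_eqF.
have nq0 : 0 < - q by rewrite oppr_gt0.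
rewrite normrM normfV (ltr0_norm q0) ler_pdivrMr //.
rewrite lerNr ler_pdivrMr // in qC.
rewrite ler_norml; move: h1 h2 qC C0; clear - XP; set w := q * v; rewrite mulNr -/w.
clearbody w; move=> *; apply/andP; split; nra.
Unshelve. all: by end_near. Qed.

Lemma dimBlow_ge : (v%:E <= dimBlow nuX)%E.
Proof.
apply: le_ereal_inf_tmp => _ [s [s0 [c [c0 [dl [dl01 [dlc hc]]]]]] <-].
rewrite lee_fin leNgt; apply/negP => sv.
pose q := - ((`|Tf 0| + 1) / (v - s)).
have sv0 : 0 < v - s by rewrite subr_gt0.
have q0 : q < 0 by rewrite oppr_lt0 divr_gt0 // ltr_wpDl.
have : Tf q <= Tf 0 - q * s.
  apply: (@Tf_scale q s (ln c)) => s1.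
  have /cvgrPdist_lt/(_ (expR (- s1)) (expR_gt0 _)) := dlc.
  move=> [n _ /(_ n (leqnn n))] /=; rewrite sub0r normrN.
  have /andP[d0 d1] := dl01 n; rewrite (gtr0_norm d0) => dn.
  exists (- ln (dl n)).
    by rewrite lerNr -[leRHS]expRK ler_ln ?posrE ?expR_gt0 // ltW.
  move=> z zs; rewrite expRNln // ler_nM2l //.
  have nu0 : 0 < nub z (dl n) by apply: msupp_nub.
  have := hc z zs n; rewrite nuX_nub // lee_fin -ler_ln ?posrE ?mulr_gt0 ?powR_gt0 //.
  by rewrite lnM ?posrE ?powR_gt0 // ln_powR mulrN opprK.
have := Tlow q0; have qe : - q * (v - s) = `|Tf 0| + 1 by rewrite opprK divfK // gt_eqF.
have := ler_norm (Tf 0); move: qe; clear - XP; move=> *; nra.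
Qed.

Lemma dimBlow_le_up : (dimBlow nuX <= dimBup nuX)%E.
Proof.
apply: ereal_inf_le_tmp => _ [s [s0 [c [c0 hc]]] <-]; exists s => //; split=> //.
(* Starting at 1/2 keeps all radii strictly below 1. *)
exists c; split=> //; exists (fun n => n.+2%:R^-1); split.
  by move=> k; rewrite invr_gt0 ltr0n /= invf_lt1 ?ltr0n // ltr1n.
split; first by have := @cvg_harmonic R; rewrite -cvg_shiftS.
move=> z zs k; apply: hc => //.
by rewrite invr_gt0 ltr0n /= invf_lt1 ?ltr0n // ltr1n.
Qed.

Lemma dimBup_le : (dimBup nuX <= v%:E)%E.
Proof.
have C0 := CN_ge0; apply/lee_addgt0Pr => e e0.
pose s := v + e; have s0 : 0 <= s by rewrite addr_ge0 // ltW.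
pose q := - ((CN + 1) / e).
have q0 : q < 0 by rewrite oppr_lt0 divr_gt0 // ltr_wpDl.
have qe : - q * e = CN + 1 by rewrite opprK divfK // gt_eqF.
have lt : Tf q < - q * s.
  apply: (le_lt_trans (Tup q0)).
  have -> : - q * s = (CN + 1) - q * v by rewrite -qe /s; ring.
  by rewrite ltrD2r ltrDl ltr01.
have [s2 s21 h] := nub_rate lt.
rewrite -EFinD; apply: ereal_inf_lbound; exists s => //; split=> //.
have s20 : 0 < s2 by exact: lt_le_trans s21.
have low s' z : s2 <= s' -> msupp nuX z -> expR (- (s * s')) <= nub z (expR (- s')).
  move=> ss zs; have nu0 : 0 < nub z (expR (- s')) by apply: msupp_nub => //; exact: expR_gt0.
  have := h _ z ss zs.
  have -> : - q * s * s' = q * - (s * s') by ring.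
  rewrite ler_nM2l // => h'.
  by rewrite -[leRHS]lnK ?posrE // ler_expR.
(* Balls of radius above [expR (- s2)] are bounded below by the concentric ball of that radius. *)
exists (expR (- (s * s2))); split; first exact: expR_gt0.
move=> z zs delta /andP[d0 d1]; rewrite nuX_nub // lee_fin powR_expRN // -expRD.
have ld0 : 0 <= - ln delta by rewrite oppr_ge0 ln_le0 // ltW.
have [dl|dl] := leP s2 (- ln delta).
  have := low _ z dl zs; rewrite expRNln //; apply: le_trans.
  by rewrite ler_expR gerDr oppr_le0 mulr_ge0 // ltW.
apply: (@le_trans _ _ (nub z (expR (- s2)))).
  apply: le_trans (low s2 z (lexx _) zs).
  by rewrite ler_expR gerDl oppr_le0 mulr_ge0.
apply: nub_mono; rewrite ?expR_ge0 //.
by rewrite -[leRHS]expRNln // ler_expR lerN2 ltW.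
Qed.

Lemma dimBup_eq : dimBup nuX = v%:E.
Proof.
by apply/eqP; rewrite eq_le dimBup_le (le_trans dimBlow_ge dimBlow_le_up).
Qed.

Lemma dimBlow_eq : dimBlow nuX = v%:E.
Proof.
by apply/eqP; rewrite eq_le dimBlow_ge (le_trans dimBlow_le_up dimBup_le).
Qed.
End BoxDimension.
End Dimensions.


(** * Extremal values of the variational problem and the dimension formulas *)

Section Duality.
Variables (R : realType) (d N : nat) (S : sponge R d N).
Local Notation a := (sa S).
Local Notation t := (st S).
Local Notation mu := (smu S).
Variable s : {perm 'I_d}.

Lemma inf_yv (k : 'I_d) : exists2 i, Iset a t s k.+1 i & yv S s inf k = yval S s inf k i /\
  forall j, Iset a t s k.+1 j -> yv S s inf k <= yval S s inf k j.
Proof.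
have [|i Ii [e h]] := @inf_finite R _ (Iset a t s k.+1) (yval S s inf k).
  by exists (rep S (Eset s k.+1) (si0 S)); exact: Iset_rep.
exists i => //; rewrite -yvE in e; split=> // j /h; by rewrite e.
Qed.

Lemma sup_yv (k : 'I_d) : exists2 i, Iset a t s k.+1 i & yv S s sup k = yval S s sup k i /\
  forall j, Iset a t s k.+1 j -> yval S s sup k j <= yv S s sup k.
Proof.
have [|i Ii [e h]] := @sup_finite R _ (Iset a t s k.+1) (yval S s sup k).
  by exists (rep S (Eset s k.+1) (si0 S)); exact: Iset_rep.
exists i => //; rewrite -yvE in e; split=> // j /h; by rewrite e.
Qed.

Lemma dualok_inf : dualok S s 1 (fun k => yv S s inf k).
Proof.
by apply: dualok_yv => k i Ii; rewrite !mul1r; have [_ _ [_]] := inf_yv k; apply.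
Qed.

Lemma dualok_sup : dualok S s (-1) (fun k => yv S s sup k).
Proof.
by apply: dualok_yv => k i Ii; rewrite !mulN1r lerN2; have [_ _ [_]] := sup_yv k; apply.
Qed.

Lemma weights_sum w (y : 'I_d -> R) : isW S s w -> \sum_k y k * wcon S s w k = \sum_k y k.
Proof. by move=> [_ wc]; apply: eq_bigr => k _; rewrite wc mulr1. Qed.

Lemma Sund_le_weights w : isW S s w -> Sund a t mu s d <= wS S s w.
Proof.
move=> wW; have := weak_duality wW.1 dualok_inf.
by rewrite weights_sum // !mul1r sum_yv.
Qed.

Lemma Sbar_ge_weights w : isW S s w -> wS S s w <= Sbar a t mu s d.
Proof.
move=> wW; have := weak_duality wW.1 dualok_sup.
by rewrite weights_sum // !mulN1r lerN2 sum_yv.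
Qed.

Lemma wS_ge0 w : isW S s w -> 0 <= wS S s w.
Proof.
move=> [w0 _]; apply: sumr_ge0 => k _; apply: sumr_ge0 => i _; apply: mulr_ge0 => //.
by have /andP[] := ln_muJ_bounds S (Eset s k.+1) i.
Qed.
End Duality.

Section Main.
Variables (R : realType) (d N : nat) (S : sponge R d N).
Variables (dm : measure_display) (T : measurableType dm) (P : probability T R).
Variables (X : T -> Sigma N).
Hypothesis XP : iid_law (smu S) P X.
Local Notation a := (sa S).
Local Notation t := (st S).
Local Notation mu := (smu S).
Local Notation nuX := (nuX S P X).
Local Notation CN := (CN S).
Variable Tf : R -> R.
Hypothesis TfP : forall q, rate (lnT S P X q) (Tf q).

Lemma Tf_cvg q : ln (Tdelta nuX q delta) / - ln delta @[delta --> 0^'+] --> Tf q.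
Proof.
apply: cvg_trans (rate_cvg (TfP q)); apply: near_eq_cvg; near=> x.
have x0 : 0 < x by near: x; exact: nbhs_right_gt.
by rewrite /lnT expRNln.
Unshelve. all: by end_near. Qed.

(** The values for all orderings in [Aset] are pooled, so that the iterated extrema of the theorem
    become one infimum and one supremum of reals. *)
Definition Svals : set R :=
  [set z | exists2 s, Aset a s & exists2 p, Qset a t s p & Ssig a t mu s p = z].

Lemma Svals_weights z : Svals z -> exists s w, [/\ Aset a s, isW S s w & wS S s w = z].
Proof.
by move=> [s As [p Qp <-]]; have [w wW e] := Qset_weights Qp; exists s, w.
Qed.

(** A limit of letter frequencies of a constant word, under the trivial bound [mm_ge], already gives
    a point of some [Qset]. *)
Lemma Svals_neq0 : Svals !=set0.
Proof.
have ll0 := ll_gt0 S.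
have ms0 : 0 <= - ln (mmin S) by rewrite oppr_ge0 ln_le0 // mmin_le1.
have [s1|s [w [As wW wI _]]] := @limit_weights _ _ _ S 1 (- ln (mmin S) * (1 / ll S + 1)).
  exists (Num.max 1 s1), (fun=> si0 S); split; first by rewrite le_max lexx orbT.
  set s' := Num.max 1 s1; have s'1 : 1 <= s' by rewrite le_max lexx.
  have s'0 : 0 < s' by exact: lt_le_trans s'1.
  rewrite mul1r (le_trans (mm_ge S _ s'0)) // mulrCA ler_wpM2l //.
  by rewrite mulrDr mulr1 mulrA mulr1 lerD2l.
have [p Qp e] := weights_Qset wW wI; exists (wS S s w), s => //; by exists p.
Qed.

Lemma Svals_has_inf : has_inf Svals.
Proof.
split; first exact: Svals_neq0.
by exists 0 => z /Svals_weights[s [w [_ wW <-]]]; exact: wS_ge0.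
Qed.

Lemma Svals_has_sup : has_sup Svals.
Proof.
split; first exact: Svals_neq0.
(* At [q = -1] the lower bound of the spectrum by weights reads [wS S s w <= Tf (-1)]. *)
exists (Tf (-1)) => z /Svals_weights[s [w [_ wW <-]]].
by have := Tf_ge_weights XP TfP (-1) wW; rewrite opprK mul1r.
Qed.

Lemma inf_Svals_ge0 : 0 <= inf Svals.
Proof.
apply: lb_le_inf; first exact: Svals_neq0.
by move=> z /Svals_weights[s [w [_ wW <-]]]; exact: wS_ge0.
Qed.

Lemma sup_Svals_ge0 : 0 <= sup Svals.
Proof.
have [z Sz] := Svals_neq0; apply: (@le_trans _ _ z); last exact: sup_upper_bound Svals_has_sup _ Sz.
by have [s [w [_ wW <-]]] := Svals_weights Sz; exact: wS_ge0.
Qed.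

Lemma Tf_ge_inf q : 0 < q -> - q * inf Svals <= Tf q.
Proof.
move=> q0; rewrite mulNr lerNl mulrC -ler_pdivrMr //.
apply: lb_le_inf; first exact: Svals_neq0.
move=> z /Svals_weights[s [w [_ wW <-]]]; rewrite ler_pdivrMr // mulrC lerNl -mulNr.
exact: Tf_ge_weights.
Qed.

Lemma Tf_ge_sup q : q < 0 -> - q * sup Svals <= Tf q.
Proof.
move=> q0; have nq0 : 0 < - q by rewrite oppr_gt0.
rewrite mulrC -ler_pdivlMr //; apply: ge_sup; first exact: Svals_neq0.
move=> z /Svals_weights[s [w [_ wW <-]]]; rewrite ler_pdivlMr // mulrC.
exact: Tf_ge_weights.
Qed.

Lemma Tf_le_inf q : 0 < q -> Tf q <= CN - q * inf Svals.
Proof.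
move=> q0; rewrite -{2}(gtr0_norm q0); apply: (@Tf_le_weights _ _ _ S _ _ _ _ XP _ TfP q 1).
  by rewrite mul1r gtr0_norm.
move=> s w As wW wI; rewrite mul1r; apply: (ge_inf Svals_has_inf.2).
by have [p Qp e] := weights_Qset wW wI; exists s => //; exists p.
Qed.

Lemma Tf_le_sup q : q < 0 -> Tf q <= CN - q * sup Svals.
Proof.
move=> q0.
have -> : CN - q * sup Svals = CN - `|q| * - sup Svals by rewrite (ltr0_norm q0) mulrNN.
apply: (@Tf_le_weights _ _ _ S _ _ _ _ XP _ TfP q (-1)); first by rewrite (ltr0_norm q0) mulN1r opprK.
move=> s w As wW wI; rewrite mulN1r lerN2; apply: (sup_upper_bound Svals_has_sup).
by have [p Qp e] := weights_Qset wW wI; exists s => //; exists p.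
Qed.

Lemma ereal_inf_Svals :
  ereal_inf [set ereal_inf [set (Ssig a t mu s p)%:E | p in Qset a t s] | s in Aset a] =
  (inf Svals)%:E.
Proof.
apply/eqP; rewrite eq_le; apply/andP; split.
- apply/lee_addgt0Pr => e e0; have [z [s As [p Qp <-]] lt] := inf_adherent e0 Svals_has_inf.
  apply: (@le_trans _ _ (Ssig a t mu s p)%:E); last by rewrite -EFinD lee_fin ltW.
  apply: ge_ereal_inf; exists (ereal_inf [set (Ssig a t mu s p)%:E | p in Qset a t s]).
    by exists s.
  by apply: ge_ereal_inf; exists (Ssig a t mu s p)%:E => //; exists p.
- apply: le_ereal_inf_tmp => _ [s As <-]; apply: le_ereal_inf_tmp => _ [p Qp <-].
  by rewrite lee_fin; apply: (ge_inf Svals_has_inf.2); exists s => //; exists p.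
Qed.

Lemma ereal_sup_Svals :
  ereal_sup [set ereal_sup [set (Ssig a t mu s p)%:E | p in Qset a t s] | s in Aset a] =
  (sup Svals)%:E.
Proof.
apply/eqP; rewrite eq_le; apply/andP; split.
- apply: ge_ereal_sup => _ [s As <-]; apply: ge_ereal_sup => _ [p Qp <-].
  by rewrite lee_fin; apply: (sup_upper_bound Svals_has_sup); exists s => //; exists p.
- apply/lee_addgt0Pr => e e0; have [z [s As [p Qp <-]] lt] := sup_adherent e0 Svals_has_sup.
  apply: (@le_trans _ _ ((Ssig a t mu s p)%:E + e%:E)).
    by rewrite -EFinD lee_fin -lerBlDr ltW.
  rewrite leeD2r //; apply: le_trans (ereal_sup_ubound _); last by exists s.
  by apply: ereal_sup_ubound; exists p.
Qed.

Lemma inf_Svals_ge : (maxe 0%E (ereal_inf [set (Sund a t mu s d)%:E | s in Aset a]) <= (inf Svals)%:E)%E.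
Proof.
rewrite ge_max lee_fin inf_Svals_ge0 /=.
apply/lee_addgt0Pr => e e0; have [z Sz lt] := inf_adherent e0 Svals_has_inf.
have [s [w [As wW wz]]] := Svals_weights Sz.
apply: ge_ereal_inf; exists (Sund a t mu s d)%:E; first by exists s.
by rewrite -EFinD lee_fin (le_trans (Sund_le_weights wW)) // wz ltW.
Qed.

Lemma sup_Svals_le : ((sup Svals)%:E <= ereal_sup [set (Sbar a t mu s d)%:E | s in Aset a])%E.
Proof.
apply/lee_addgt0Pr => e e0; have [z Sz lt] := sup_adherent e0 Svals_has_sup.
have [s [w [As wW wz]]] := Svals_weights Sz.
apply: (@le_trans _ _ ((Sbar a t mu s d)%:E + e%:E)).
  rewrite -EFinD lee_fin -lerBlDr (le_trans (ltW lt)) // -wz; exact: Sbar_ge_weights.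
by rewrite leeD2r //; apply: ereal_sup_ubound; exists s.
Qed.

Lemma eventually_ge (v C g : R) : g < v -> exists s1 : R, 0 < s1 /\ forall s, s1 <= s -> s * g <= s * v - C.
Proof.
move=> gv; have vg0 : 0 < v - g by rewrite subr_gt0.
exists (Num.max 1 (C / (v - g))); split; first by rewrite lt_max ltr01.
move=> s; rewrite ge_max ler_pdivrMr // => /andP[_]; rewrite mulrBr; lra.
Qed.

Lemma Tf_le_LG s q e (y : 'I_d -> R) : LGo S s -> dualok S s e y -> q = e * `|q| ->
  Tf q <= CN - `|q| * (e * \sum_k y k).
Proof.
move=> lg dy qe; have [C hC] := LG_mass lg dy.
set v := e * _ in hC *.
have hg g : g < v -> Tf q <= CN - `|q| * g.
  move=> /(eventually_ge C)[s1 [s10 h]]; apply: (Tf_le_mm XP TfP (s1 := s1) qe) => s' x ss.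
  by apply: (le_trans (h s' ss)); apply: hC; exact: lt_le_trans ss.
exact: (Tf_le_approx hg).
Qed.

Lemma LG_dimF s : LGo S s -> dimF nuX = (Sund a t mu s d)%:E.
Proof.
move=> lg.
have [|w wW we] := @LG_tight _ _ _ S s inf lg.
  by move=> k; have [i Ii [h _]] := inf_yv S s k; exists i.
rewrite -[Sund _ _ _ _ _]we; apply: (dimF_eq XP TfP).
- by move=> q _; exact: Tf_ge_weights.
- move=> q q0; have := @Tf_le_LG s q 1 _ lg (dualok_inf S s).
  by rewrite (gtr0_norm q0) !mul1r sum_yv we; apply.
Qed.

Lemma LG_dimB s : LGo S s -> dimBup nuX = (Sbar a t mu s d)%:E /\ dimBlow nuX = (Sbar a t mu s d)%:E.
Proof.
move=> lg.
have [|w wW we] := @LG_tight _ _ _ S s sup lg.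
  by move=> k; have [i Ii [h _]] := sup_yv S s k; exists i.
have v0 := wS_ge0 wW.
have low q : q < 0 -> - q * wS S s w <= Tf q by move=> _; exact: Tf_ge_weights.
have up q : q < 0 -> Tf q <= CN - q * wS S s w.
  move=> q0; have := @Tf_le_LG s q (-1) _ lg (dualok_sup S s).
  by rewrite (ltr0_norm q0) !mulN1r opprK sum_yv we mulrNN; apply.
rewrite -[Sbar _ _ _ _ _]we; split; [exact: (dimBup_eq XP TfP v0 low up)|exact: (dimBlow_eq XP TfP v0 low up)].
Qed.
End Main.


(** * Uniform constants from the hypotheses and the final assembly *)

Lemma positive_lower_bound (R : realType) (I : finType) (f : I -> R) (i0 : I) :
  (forall i, 0 < f i) -> exists2 m, 0 < m & forall i, m <= f i.
Proof.
move=> f0; case: (@arg_minP _ _ _ i0 xpredT f isT) => i _ imin.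
by exists (f i) => // j; exact: imin.
Qed.

Lemma strict_upper_bound (R : realType) (I : finType) (f : I -> R) (i0 : I) (b : R) :
  (forall i, f i < b) -> exists2 m, m < b & forall i, f i <= m.
Proof.
move=> fb; case: (@arg_maxP _ _ _ i0 xpredT f isT) => i _ imax.
by exists (f i) => // j; exact: imax.
Qed.

Lemma sponge_ex (R : realType) (d N : nat) (a t : 'I_N -> 'I_d -> R) (mu : 'I_N -> R) :
  (0 < d)%N -> (0 < N)%N ->
  (forall i n, 0 < `|a i n| < 1) ->
  (forall i x, cube x -> cube (ifsmap a t i x)) ->
  (exists r0 : R, 0 < r0 /\ forall (n : 'I_d) (u : R), (u = 0 \/ u = 1) ->
     exists k, forall x y, cube x -> x n = u -> (ifsmap a t k @` cube) y ->
       r0 <= eucl_dist x y) ->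
  (forall i, 0 < mu i) -> \sum_i mu i = 1 -> SPPC a t ->
  exists S : sponge R d N, [/\ sa S = a, st S = t & smu S = mu].
Proof.
move=> d0 N0 ha hcube [r0 [r00 face]] mu0 mu1 sppc.
pose c0 := Ordinal d0; pose i0 := Ordinal N0.
have [l l0 lP] := @positive_lower_bound R _ (fun p : 'I_N * 'I_d => lam a p.1 p.2) (i0, c0)
  (fun p => proj1 (andP (ha p.1 p.2))).
have [u u1 uP] := @strict_upper_bound R _ (fun p : 'I_N * 'I_d => lam a p.1 p.2) (i0, c0) 1
  (fun p => proj2 (andP (ha p.1 p.2))).
have [m m0 mP] := positive_lower_bound i0 mu0.
have us i c z : 0 <= z <= 1 -> 0 <= a i c * z + t i c <= 1.
  by move=> z01; exact: (hcube i (fun=> z) (fun=> z01) c).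
have fe : exists2 r0 : R, 0 < r0 & forall c v, v = 0 \/ v = 1 ->
    exists k, forall z, 0 <= z <= 1 -> r0 <= `|a k c * z + t k c - v|.
  exists r0 => // c v v01; have [k hk] := face c v v01; exists k => z z01.
  pose y := ifsmap a t k (fun=> z).
  have yc : cube y by apply: hcube => n.
  (* The orthogonal projection of [y] to the face: its Euclidean distance from [y] is the difference
     in coordinate [c] alone. *)
  pose x n := if n == c then v else y n.
  have xc : cube x.
    move=> n; rewrite /x; case: eqP => // _.
    by case: v01 => ->; rewrite ?lexx ?ler01.
  have := hk x y xc; rewrite /x eqxx => /(_ erefl) h.
  apply: le_trans (h _) _; first by exists (fun=> z).
  apply: le_trans (eucl_le_sum _ _) _; rewrite (bigD1 c) //= eqxx big1 ?addr0 => [|n /negbTE nc].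
    by rewrite distrC.
  by rewrite nc subrr normr0.
by exists (@Sponge R d N a t mu c0 i0 l u m l0 u1 m0 (fun i c => lP (i, c)) (fun i c => uP (i, c))
  mP mu1 us fe sppc).
Qed.

Theorem theorem3p8 (R : realType) (d N : nat) (a t : 'I_N -> 'I_d -> R)
  (mu : 'I_N -> R) (dm : measure_display) (T : measurableType dm)
  (P : probability T R) (X : T -> Sigma N) :
  (0 < d)%N -> (0 < N)%N ->
  (forall i n, 0 < `|a i n| < 1) ->
  (forall i x, cube x -> cube (ifsmap a t i x)) ->
  (forall i j, i != j -> exists x, cube x /\ ifsmap a t i x <> ifsmap a t j x) ->
  (exists r0 : R, 0 < r0 /\ forall (n : 'I_d) (u : R), (u = 0 \/ u = 1) ->
     exists k, forall x y, cube x -> x n = u -> (ifsmap a t k @` cube) y ->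
       r0 <= eucl_dist x y) ->
  (forall i, 0 < mu i) -> \sum_i mu i = 1 ->
  (* X is a random sequence with i.i.d. coordinates of law mu, so that
     nu_mu = mu^N o pi^{-1} = law of (coding o X) *)
  (forall k (w : 'I_k -> 'I_N), measurable (X @^-1` cyl w) /\
      P (X @^-1` cyl w) = (\prod_(j < k) mu (w j))%:E) ->
  SPPC a t ->
  let nu := fun A => P ((coding a t \o X) @^-1` A) in
  (exists Tf : R -> R,
     (forall q : R, ln (Tdelta nu q delta) / - ln delta @[delta --> 0^'+] --> Tf q) /\
     (exists vF : R,
        dimF nu = vF%:E /\
        ereal_inf [set ereal_inf [set (Ssig a t mu s p)%:E | p in Qset a t s]
                  | s in Aset a] = vF%:E /\
        Tf q / - q @[q --> +oo] --> vF /\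
        (maxe 0%E (ereal_inf [set (Sund a t mu s d)%:E | s in Aset a]) <= vF%:E)%E) /\
     (exists vB : R,
        dimBup nu = vB%:E /\ dimBlow nu = vB%:E /\
        ereal_sup [set ereal_sup [set (Ssig a t mu s p)%:E | p in Qset a t s]
                  | s in Aset a] = vB%:E /\
        Tf q / - q @[q --> -oo] --> vB /\
        (vB%:E <= ereal_sup [set (Sbar a t mu s d)%:E | s in Aset a])%E)) /\
  (forall s : {perm 'I_d}, LG_ordered a t s ->
     dimF nu = (Sund a t mu s d)%:E /\
     dimBup nu = (Sbar a t mu s d)%:E /\ dimBlow nu = (Sbar a t mu s d)%:E).
Proof.
move=> d0 N0 ha hcube _ face mu0 mu1 hX sppc nu.
have [S [ea et em]] := sponge_ex d0 N0 ha hcube face mu0 mu1 sppc.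
subst a t mu; have XP : iid_law (smu S) P X by [].
have [Tf TfP] := choice (rate_lnT XP).
split.
- exists Tf; split; first exact: Tf_cvg.
  split; [exists (inf (Svals S))|exists (sup (Svals S))].
  + split; first exact: (dimF_eq XP TfP (Tf_ge_inf XP TfP) (Tf_le_inf XP TfP)).
    split; first exact: ereal_inf_Svals.
    split; last exact: inf_Svals_ge.
    exact: (Tf_cvg_pinfty (Tf_ge_inf XP TfP) (Tf_le_inf XP TfP)).
  + have v0 := sup_Svals_ge0 XP TfP.
    split; first exact: (dimBup_eq XP TfP v0 (Tf_ge_sup XP TfP) (Tf_le_sup XP TfP)).
    split; first exact: (dimBlow_eq XP TfP v0 (Tf_ge_sup XP TfP) (Tf_le_sup XP TfP)).
    split; first exact: (ereal_sup_Svals XP TfP).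
    split; last exact: (sup_Svals_le XP TfP).
    exact: (Tf_cvg_ninfty (Tf_ge_sup XP TfP) (Tf_le_sup XP TfP)).
- move=> s [_ lg]; split; first exact: (LG_dimF XP TfP).
  exact: (LG_dimB XP TfP).
Qed.
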